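(* Let $q$ be a prime power and let $f\in\mathbb{F}_q[T][X]$ be irreducible and special, with $d=\deg_X f\ge 2$. Then as $n\to\infty$, $$\deg L_f(n)\sim c_f(d-1)\,n q^n .$$
   Context: A polynomial $f\in R[X]$ over a UFD $R$ with $\deg f=d\ge 2$ is called special if $f(X)-f(Y)=\prod_{i=1}^d(a_iX+b_iY+c_i)$ for some $a_i,b_i,c_i\in R$; here $R=\mathbb{F}_q[T]$. $M_n$ is the set of monic polynomials of degree $n$ in $\mathbb{F}_q[T]$; for $n$ large, $L_f(n)=\mathrm{lcm}(f(Q):Q\in M_n)$; $\deg$ is degree in $T$. $V_f=\{g\in\mathbb{F}_q[T]: f(X+g)=f(X)\}$ and $c_f=1/|V_f|$. $A\sim B$ means $A(n)/B(n)\to1$. *)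

(* Defs.v *)
From HB Require Import structures.
From mathcomp Require Import all_boot all_order all_algebra finmap.
From mathcomp Require Import all_classical all_reals all_analysis.
Set Implicit Arguments.
Unset Strict Implicit.
Unset Printing Implicit Defensive.
Import Order.TTheory GRing.Theory Num.Theory.
Import numFieldNormedType.Exports.
Local Open Scope classical_set_scope.
Local Open Scope ring_scope.

Definition deg (R : nzRingType) (p : {poly R}) : nat := (size p).-1.

(* Irreducibility as an element of the ring A.  For A = {poly {poly F}} this is
   stronger than polydiv's irreducible_poly, which ignores the content (it
   amounts to irreducibility over the fraction field). *)
Definition irreducible_elt (A : idomainType) (x : A) : Prop :=
  [/\ x != 0, x \isn't a GRing.unit &
      forall y z : A, x = y * z ->
        y \is a GRing.unit \/ z \is a GRing.unit].

(* R[X, Y] is {poly {poly R}} with X = 'X and Y = 'X%:P, so that f(X) is f^:P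
   and f(Y) is f%:P. *)
Definition special (R : idomainType) (f : {poly R}) : Prop :=
  (2 <= deg f)%N /\
  exists a b c : 'I_(deg f) -> R,
    f^:P - f%:P =
      \prod_(i < deg f)
        ((a i)%:P%:P * 'X + (b i)%:P%:P * 'X%:P + (c i)%:P%:P).

Section Lcm.
Variable F : fieldType.
Implicit Types p q m : {poly F}.

Definition lcmp p q : {poly F} := (p * q) %/ gcdp p q.

Lemma dvdp_lcm p q m : (lcmp p q %| m) = (p %| m) && (q %| m).
Proof.
rewrite /lcmp; have [g0|g0] := eqVneq (gcdp p q) 0.
  move/eqP: g0; rewrite gcdp_eq0 => /andP[/eqP-> /eqP->].
  by rewrite mul0r div0p andbb.
have pE : p = p %/ gcdp p q * gcdp p q by rewrite divpK ?dvdp_gcdl.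
have qE : q = q %/ gcdp p q * gcdp p q by rewrite divpK ?dvdp_gcdr.
have cop : coprimep (p %/ gcdp p q) (q %/ gcdp p q).
  apply: coprimep_div_gcd; apply/orP.
  by move: g0; rewrite gcdp_eq0 negb_and => /orP.
move: pE qE cop g0; set g := gcdp p q; set a := p %/ g; set b := q %/ g.
move=> pE qE cop g0; rewrite pE qE mulrA mulpK //.
apply/idP/andP => [h|[ha hb]].
  split; apply: dvdp_trans h; first exact: dvdp_mulIl.
  by rewrite -mulrA [g * b]mulrC dvdp_mulIr.
have /dvdpP[m' mE] : g %| m by apply: dvdp_trans ha; apply: dvdp_mulIr.
move: ha hb; rewrite mE !dvdp_mul2r // => ha hb.
by rewrite mulrAC dvdp_mul2r // Gauss_dvdp // ha hb.
Qed.

Lemma dvdp_biglcm (I : finType) (P : pred I) (G : I -> {poly F}) m :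
  reflect (forall i, P i -> G i %| m) (\big[lcmp/1]_(i | P i) G i %| m).
Proof.
have -> : (\big[lcmp/1]_(i | P i) G i %| m) = \big[andb/true]_(i | P i) (G i %| m).
  apply: (big_rec2 (fun x b => (x %| m) = b)) => [|i b x _ <-].
    by rewrite dvd1p.
  by rewrite dvdp_lcm.
by rewrite big_andE; apply: forall_inP.
Qed.
End Lcm.

Section LcmValues.
Variable F : finFieldType.
Implicit Type f : {poly {poly F}}.

(* M_n, as a predicate on the finite type of polynomials of degree at most n. *)
Definition monic_deg (n : nat) : pred {poly_n.+1 F} :=
  fun Q => (polyn Q \is monic) && (deg (polyn Q) == n).

Definition L_ f (n : nat) : {poly F} :=
  \big[@lcmp F/1]_(Q : {poly_n.+1 F} | monic_deg Q) f.[polyn Q].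

(* L_ f n is a least common multiple of the f(Q), Q monic of degree n. *)
Lemma L_P f n (m : {poly F}) :
  L_ f n %| m <->
  (forall Q : {poly F}, Q \is monic -> deg Q = n -> f.[Q] %| m).
Proof.
split=> [/dvdp_biglcm h Q mQ dQ|h].
  have sQ : (size Q <= n.+1)%N by rewrite -dQ leqSpred.
  by apply: (h (NPoly sQ)); rewrite /monic_deg /= mQ dQ eqxx.
by apply/dvdp_biglcm => Q /andP[mQ /eqP dQ]; apply: h.
Qed.

Definition V_ f : set {poly F} := [set g | f \Po ('X + g%:P) = f].

(* fset_set is only meaningful on finite sets, see finite_V. *)
Definition c_ (R : realType) f : R := (#|` fset_set (V_ f)|%fset)%:R^-1.

Lemma finite_V f : (0 < deg f)%N -> finite_set (V_ f).
Proof.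
move=> df; set p := f - (f.[0])%:P.
have p0 : p != 0.
  apply/eqP => /eqP; rewrite subr_eq0 => /eqP fE.
  by move: df; rewrite /deg fE size_polyC; case: (_ != _).
have Vp g : V_ f g -> root p g.
  move=> /(congr1 (fun h => h.[0])); rewrite horner_comp !hornerE => fg.
  by rewrite rootE /p !hornerE fg subrr.
have bnd (s : seq {poly F}) : uniq s -> {subset s <= V_ f} -> (size s <= size p)%N.
  move=> us sV; apply/ltnW/max_poly_roots => //.
  by apply/allP => g /sV; rewrite inE => /Vp.
apply: contrapT => infV.
have := @infinite_set_fset _ (V_ f) (size p).+1 infV.
case=> X XV sX.
have := bnd X (fset_uniq X).
rewrite leqNgt (leq_trans _ sX) // => h; suff: false by [].
by apply: h => x xX; rewrite inE; apply: XV.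
Qed.
End LcmValues.

(* Main.v *)
Require Import Defs.
From HB Require Import structures.
From mathcomp Require Import all_boot all_order all_algebra all_field finmap.
From mathcomp Require Import all_classical all_reals all_analysis.
From mathcomp Require Import ring lra zify.
Set Implicit Arguments.
Unset Strict Implicit.
Unset Printing Implicit Defensive.
Import Order.TTheory GRing.Theory Num.Theory.
Local Open Scope ring_scope.

(* Write A = F_q[T] and let P run over the monic irreducibles of A.

   Large primes.  If deg P > n + O(1) and P divides f(Q1) and f(Q2), then P
   divides one of the linear factors of f(Q1) - f(Q2), which vanishes; this forces
   Q1 - Q2 in V_f.  So P divides none or exactly |V_f| of the values f(Q), to the same
   power, and
     |V_f| deg L_f(n) = sum_Q deg f(Q) - W(n) + o(n q^n) = d n q^n - W(n) + o(n q^n),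
   where W(n) is the contribution to the first sum of the primes with
   deg P <= n + O(1).

   Small primes.  Only primes with deg P <= n dividing f(Q) exactly once matter, so
   W(n) ~ q^n sum_(deg P <= n) deg P rho_f(P) / q^(deg P), rho_f(P) being the number
   of roots of f mod P, and it remains to show that this Mertens sum is ~ n.

   Mertens sum.  A substitution turns f into h(X^N), with N a power of the
   characteristic and h monic, irreducible, separable, such that h(t) = h for
   deg h affine polynomials t in A[X]; these play the role of a Galois group.  The
   product of the a(t) is congruent mod h to a constant, the norm of a, and the sum
   is estimated by averaging the factorization of the norms of the elements
   1 + M (T^m + b), where b runs over a box: these norms all have the same degree, are
   prime to M, and outside M are divisible by P about rho_h(P) / q^(deg P) of the
   time, as the lattices involved are equidistributed in the box. *)

(** * Irreducible polynomials over a finite field *)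

(** Averaging rho_h(P) would normally mean counting the primes of the extension defined by h. The
    affine symmetries make it elementary: their leading coefficients are roots of unity, hence
    constants, so when X gets a suitable weight c neither a substitution X -> t(X) nor division by h
    raises the weighted degree. This bound fixes the degree of the test norms and also controls
    reduction modulo a lattice, with a loss C0 that depends on h alone. Box points in a lattice are
    therefore counted exactly up to index q^(e(mu - C0)), and boundedly beyond. Primes with degree
    between e(mu - C0) and the degree E of the norms cost O(q^(e mu)), against a main term E q^(e
    mu).

    Hence M absorbs the small primes along with the inseparable ones, and is chosen after the
    tolerance. The primes dividing M must then be handled on the values of f, where P may occur to
    high powers: these are bounded outside a proportion q^(-J) of the arguments, J again depending
    on the tolerance. *)

Section Degree.
Variable R : idomainType.
Implicit Types a b : {poly R}.

Lemma degM a b : a != 0 -> b != 0 -> deg (a * b) = (deg a + deg b)%N.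
Proof.
move=> a0 b0; rewrite /deg size_mul //.
by move: a0 b0; rewrite -!size_poly_gt0; case: (size a) => // n; case: (size b) => //= m _ _; rewrite addnS.
Qed.

Lemma degS a : a != 0 -> (deg a).+1 = size a.
Proof. by move=> a0; rewrite /deg prednK // size_poly_gt0. Qed.

Lemma deg_exp a k : deg (a ^+ k) = (deg a * k)%N.
Proof.
have [->|a0] := eqVneq a 0.
  by case: k => [|k]; rewrite ?expr0 ?exprS ?mul0r /deg ?size_poly0 ?size_poly1 ?muln0 ?mul0n.
elim: k => [|k IH]; first by rewrite expr0 /deg size_poly1 muln0.
by rewrite exprS degM ?expf_neq0 // IH mulnS.
Qed.

End Degree.

Section Primes.
Variable F : finFieldType.
Implicit Types (P Q a b : {poly F}).

Definition mirr P : bool := (P \is monic) && irreducibleb P.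

Lemma mirr_irreducible P : mirr P -> irreducible_poly P.
Proof. by case/andP=> _ /irreducibleP. Qed.

Lemma mirr_monic P : mirr P -> P \is monic.
Proof. by case/andP. Qed.

Lemma mirr_size P : mirr P -> (1 < size P)%N.
Proof. by move/mirr_irreducible => []. Qed.

Lemma mirr_deg P : mirr P -> (0 < deg P)%N.
Proof. by move/mirr_size; rewrite /deg; case: (size P) => [|[]]. Qed.

Lemma mirr_neq0 P : mirr P -> P != 0.
Proof. by move/mirr_monic/monic_neq0. Qed.

Lemma mirr_coprime P a : mirr P -> coprimep P a = ~~ (P %| a).
Proof.
move=> hP; have [_ irr] := mirr_irreducible hP.
apply/idP/idP => [cop|]; last first.
  apply: contraR => ncop.
  have e : gcdp P a %= P by apply: irr (dvdp_gcdl _ _); rewrite -coprimep_def.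
  by rewrite -(eqp_dvdl _ e) dvdp_gcdr.
apply/negP => dv; move: cop; rewrite coprimep_def.
have -> : size (gcdp P a) = size P by apply/eqp_size; rewrite /eqp dvdp_gcdl dvdp_gcd dvdpp dv.
by move/eqP => s1; have := mirr_size hP; rewrite s1.
Qed.

Lemma mirr_euclid P a b : mirr P -> P %| a * b -> (P %| a) || (P %| b).
Proof.
move=> hP dv; case: (boolP (P %| a)) => //= na.
by rewrite -(Gauss_dvdpr _ (q := a)) // mirr_coprime.
Qed.

Lemma mirr_dvd_prod (I : eqType) P (r : seq I) (E : I -> {poly F}) :
  mirr P -> P %| \prod_(i <- r) E i -> exists2 i, i \in r & P %| E i.
Proof.
move=> hP; elim: r => [|i r IH].
  rewrite big_nil dvdp1 => /eqP s1.
  by have := mirr_size hP; rewrite s1.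
rewrite big_cons => /(mirr_euclid hP)/orP[dv|/IH[j jr dv]].
  by exists i; rewrite ?mem_head.
by exists j; rewrite // inE jr orbT.
Qed.

Lemma mirr_dvd_exists a : (1 < size a)%N -> exists2 P, mirr P & P %| a.
Proof.
elim: {a}(size a) {-2}a (leqnn (size a)) => [|n IH] a; first by case: (size a).
move=> sa s1.
have [irr|red] := boolP (irreducibleb a).
  exists ((lead_coef a)^-1 *: a).
    have lc0 : (lead_coef a)^-1 != 0.
      by rewrite invr_eq0 lead_coef_eq0 -size_poly_gt0; apply: leq_trans s1.
    apply/andP; split.
      by rewrite monicE lead_coefZ mulVf // lead_coef_eq0 -size_poly_gt0 (leq_trans _ s1).
    apply/irreducibleP; case/irreducibleP: irr => [_ irr]; split.
      by rewrite size_scale.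
    move=> q sq; rewrite dvdpZr // => /(irr q sq) e.
    by rewrite (eqp_trans e) // eqp_sym eqp_scale.
  by rewrite dvdpZl ?dvdpp // invr_eq0 lead_coef_eq0 -size_poly_gt0 (leq_trans _ s1).
move: red; rewrite /irreducibleb s1 /= negb_forall => /existsP[q].
rewrite negb_imply -ltnNge => /andP[dv sq].
have a0 : a != 0 by rewrite -size_poly_gt0 (leq_trans _ s1).
have [|P hP Pq] := IH (polyn q) _ sq.
- by rewrite -ltnS; apply: leq_trans sa; rewrite -[ltnRHS]prednK ?ltnS ?size_npoly // (leq_trans _ s1).
exists P => //; apply: dvdp_trans Pq _.
by rewrite Pdiv.Idomain.dvdpE.
Qed.

Lemma mirr_dvd_eq P Q : mirr P -> mirr Q -> P %| Q -> P = Q.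
Proof.
move=> hP hQ dv; have [_ irr] := mirr_irreducible hQ.
have e := irr P _ dv; apply/eqP; rewrite -eqp_monic ?mirr_monic //.
by apply: e; rewrite neq_ltn mirr_size // orbT.
Qed.

Lemma mirr_coprime_neq P Q k : mirr P -> mirr Q -> P != Q -> coprimep (P ^+ k) Q.
Proof.
move=> hP hQ ne; apply: coprimep_expl; rewrite mirr_coprime //.
by apply: contra ne => dv; apply/eqP/mirr_dvd_eq.
Qed.

Lemma size_mirr_exp P k : mirr P -> (k < size (P ^+ k))%N.
Proof.
move=> hP; rewrite -degS ?expf_neq0 ?mirr_neq0 // ltnS deg_exp.
by rewrite -[leqLHS]mul1n leq_mul2r mirr_deg ?orbT.
Qed.

(** The range [size a] is large enough because P^k has size above k. For [a = 0] the maximum is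
    empty and the value is 0. *)
Definition vp P a : nat := \max_(k < size a | P ^+ k %| a) (k : nat).

Lemma dvdp_exp_vp P a k : mirr P -> a != 0 -> (P ^+ k %| a) = (k <= vp P a)%N.
Proof.
move=> hP a0; apply/idP/idP => [dv|].
  have ks : (k < size a)%N.
    by apply: leq_trans (size_mirr_exp k hP) _; apply: dvdp_leq.
  by rewrite /vp (bigop.bigmax_sup (Ordinal ks)).
have i0 : (0 < size a)%N by rewrite size_poly_gt0.
rewrite /vp.
have [|i Pi ->] := eq_bigmax_cond (fun k : 'I_(size a) => k : nat) (A := [pred k : 'I_(size a) | P ^+ k %| a]).
  by apply/card_gt0P; exists (Ordinal i0); rewrite inE expr0 dvd1p.
by move=> ki; apply: dvdp_trans Pi; apply: dvdp_exp2l.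
Qed.

Lemma vp_gt0 P a : mirr P -> a != 0 -> (0 < vp P a)%N = (P %| a).
Proof. by move=> hP a0; rewrite -dvdp_exp_vp // expr1. Qed.

Lemma vp_uniq P a n : mirr P -> a != 0 ->
  (forall k, (P ^+ k %| a) = (k <= n)%N) -> vp P a = n.
Proof.
move=> hP a0 h; apply/eqP; rewrite eqn_leq -h dvdp_exp_vp // leqnn /=.
by rewrite -dvdp_exp_vp // h.
Qed.

Lemma vp_mul P Q a : mirr P -> mirr Q -> a != 0 ->
  vp Q (P * a) = ((Q == P) + vp Q a)%N.
Proof.
move=> hP hQ a0; have Pa0 : P * a != 0 by apply: mulf_neq0 => //; exact: mirr_neq0.
apply: vp_uniq => // k; have [->|ne] := eqVneq Q P.
  case: k => [|k]; first by rewrite expr0 dvd1p.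
  by rewrite exprS dvdp_mul2l ?mirr_neq0 // dvdp_exp_vp // add1n ltnS.
by rewrite Gauss_dvdpr ?mirr_coprime_neq // dvdp_exp_vp.
Qed.

Lemma deg_sum_vp a N : a != 0 -> (deg a <= N)%N ->
  deg a = (\sum_(P : {poly_N.+1 F} | mirr (polyn P)) deg (polyn P) * vp (polyn P) a)%N.
Proof.
elim: {a}(size a) {-2}a (leqnn (size a)) => [|n IH] a.
  by rewrite leqn0 size_poly_eq0 => /eqP-> /eqP.
move=> sa a0 dN; have [s1|s1] := ltnP 1 (size a); last first.
  have sz1 : size a = 1%N by apply/eqP; rewrite eqn_leq s1 size_poly_gt0.
  rewrite {1}/deg sz1 big1 //= => P hP; apply/eqP; rewrite muln_eq0; apply/orP; right.
  rewrite -leqn0 leqNgt vp_gt0 //; apply/negP => /(dvdp_leq a0).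
  by rewrite sz1 leqNgt mirr_size.
have [P hP /dvdpP[b aE]] := mirr_dvd_exists s1.
have b0 : b != 0 by apply: contraNneq a0 => b0; rewrite aE b0 mul0r.
have P0 := mirr_neq0 hP.
have daE : deg a = (deg P + deg b)%N by rewrite aE mulrC degM.
have dP := mirr_deg hP.
have dbN : (deg b <= N)%N by apply: leq_trans dN; rewrite daE leq_addl.
have dPN : (deg P <= N)%N by apply: leq_trans dN; rewrite daE leq_addr.
rewrite daE (IH b) //; last first.
  have := degS a0; have := degS b0; rewrite daE => h1 h2.
  by rewrite -h1 -ltnS; apply: leq_trans sa; rewrite -h2 ltnS -addn1 addnC leq_add2r.
have sP : (size P <= N.+1)%N by rewrite -degS.
have hP' : mirr (polyn (NPoly sP)) by [].
rewrite (bigD1 (NPoly sP)) //= [in RHS](bigD1 (NPoly sP)) //=.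
rewrite aE mulrC vp_mul // eqxx mulnDr muln1 -addnA; congr (_ + (_ + _))%N.
apply: eq_bigr => Q /andP[hQ ne]; rewrite vp_mul //.
by rewrite (_ : (polyn Q == P) = false) //; apply: contraNF ne => /eqP QP; apply/eqP/val_inj.
Qed.

Lemma dvdp_prod_uniq (r : seq {poly F}) a :
  uniq r -> all mirr r -> all (fun P => P %| a) r -> \prod_(P <- r) P %| a.
Proof.
elim: r => [|P r IH]; first by rewrite big_nil dvd1p.
move=> /= /andP[Pr ur] /andP[hP hr] /andP[Pa ra]; rewrite big_cons.
rewrite Gauss_dvdp ?Pa ?IH //.
rewrite mirr_coprime //; apply/negP => /(mirr_dvd_prod hP)[Q Qr PQ].
by move: Pr; rewrite (mirr_dvd_eq hP _ PQ) ?Qr //; apply: (allP hr).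
Qed.

Lemma in_qpoly_eq0 P a : mirr P -> (in_qpoly P a == 0) = (P %| a).
Proof.
move=> hP; have mP := mirr_monic hP; have sP := mirr_size hP.
by rewrite -val_eqE /= /mk_monic sP mP /= Pdiv.Idomain.dvdpE.
Qed.

Lemma mirr_monic_irreducible P : mirr P -> monic_irreducible_poly P.
Proof. by move=> hP; split; [exact: mirr_irreducible | exact: mirr_monic]. Qed.

(** The residue field of P has q^(deg P) elements, and each of them is fixed by that power. *)
Lemma mirr_dvd_Fermat P x : mirr P -> P %| x ^+ (#|F| ^ deg P) - x.
Proof.
move=> hP; rewrite -in_qpoly_eq0 // rmorphB rmorphXn /=.
pose K := {poly %/ P with mirr_monic_irreducible hP}.
have := @expf_card K (in_qpoly P x : K).
rewrite card_qfpoly /deg => h; rewrite subr_eq0; apply/eqP; exact: h.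
Qed.

(* The product of the primes of degree [D] divides T^(q^D) - T. *)
Lemma sum_mirr_deg_le D N :
  (\sum_(P : {poly_N F} | mirr (polyn P) && (deg (polyn P) == D)) D <= #|F| ^ D)%N.
Proof.
have [->|D0] := eqVneq D 0%N; first by rewrite big1.
set q := #|F|.
have q1 : (1 < q)%N := card_finNzRing_gt1 F.
have qD1 : (1 < q ^ D)%N by rewrite -{1}(expn0 q) ltn_exp2l // lt0n.
pose r := [seq polyn u | u <- enum [pred u : {poly_N F} | mirr (polyn u) && (deg (polyn u) == D)]].
pose a : {poly F} := 'X^(q ^ D) - 'X.
have sa : size a = (q ^ D).+1 by rewrite size_polyDl size_polyXn // size_polyN size_polyX.
have ur : uniq r by rewrite map_inj_uniq ?enum_uniq //; exact: val_inj.
have rP P : P \in r -> mirr P /\ deg P = D.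
  by case/mapP=> Q; rewrite mem_enum inE => /andP[h /eqP d] ->.
have a0 : a != 0 by rewrite -size_poly_gt0 sa.
have dv : \prod_(P <- r) P %| a.
  apply: dvdp_prod_uniq => //; apply/allP => P /rP[hP dP] //.
  by rewrite /a -dP; apply: mirr_dvd_Fermat.
have dprod s : all (fun P => mirr P && (deg P == D)) s -> deg (\prod_(P <- s) P) = (size s * D)%N.
  elim: s => [|P s IH] /=; first by rewrite big_nil /deg size_poly1.
  case/andP=> /andP[hP /eqP dP] hs; have p0 : \prod_(j <- s) j != 0.
    rewrite prodf_seq_neq0; apply/allP => Q Qs.
    by case/andP: (allP hs _ Qs) => /mirr_neq0.
  by rewrite big_cons degM // ?IH ?dP ?mulSn // mirr_neq0.
have : (deg (\prod_(P <- r) P) <= q ^ D)%N.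
  by move: (dvdp_leq a0 dv); rewrite sa /deg; case: (size _).
rewrite dprod; last by apply/allP => P /rP[-> ->] /=.
by rewrite sum_nat_const size_map -cardE.
Qed.

End Primes.

(** * Norms along affine symmetries *)

Section Stabilizer.
Variable R : idomainType.
Implicit Types (a b p t u v : {poly R}).

Lemma irreducible_dvd_mul h a b :
  irreducible_poly h -> h %| a * b -> (h %| a) || (h %| b).
Proof.
move=> [h1 irr] dv; case: (boolP (h %| a)) => //= na.
rewrite -(Gauss_dvdpr _ (q := a)) // coprimep_def; apply: contraR na => s1.
by rewrite -(eqp_dvdl _ (irr _ s1 (dvdp_gcdl _ _))) dvdp_gcdr.
Qed.

Lemma irreducible_dvd_prod (I : eqType) h (r : seq I) (E : I -> {poly R}) :
  irreducible_poly h -> h %| \prod_(i <- r) E i -> exists2 i, i \in r & h %| E i.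
Proof.
move=> irr; elim: r => [|i r IH].
  rewrite big_nil dvdp1 => /eqP s1.
  by case: irr => h1; rewrite s1 in h1.
rewrite big_cons => /(irreducible_dvd_mul irr)/orP[dv|/IH[j jr dv]].
  by exists i; rewrite ?mem_head.
by exists j; rewrite // inE jr orbT.
Qed.

Lemma monic_mul_small h a r : h \is monic -> a * h = r -> (size r < size h)%N -> a = 0.
Proof.
move=> hm <-; have [->//|a0] := eqVneq a 0.
have := size_Mmonic a0 hm => ->; have := monic_neq0 hm; move: a0.
by rewrite -!size_poly_gt0; lia.
Qed.

Lemma comp_poly_inj t : size t = 2%N -> injective (fun p => p \Po t).
Proof.
move=> st p p' /eqP; rewrite -subr_eq0 -rmorphB /= comp_poly2_eq0 // subr_eq0.
by move/eqP.
Qed.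

Lemma uniq_roots_factor (S : idomainType) (p : {poly S}) (r : seq S) :
  uniq r -> all (root p) r -> exists q, p = q * \prod_(x <- r) ('X - x%:P).
Proof.
elim: r p => [|x r IH] p; first by exists p; rewrite big_nil mulr1.
move=> /= /andP[xr ur] /andP[/factor_theorem[q ->] pr].
have [|q' ->] := IH q ur.
  apply/allP => y yr; have := allP pr y yr.
  rewrite rootM => /orP[//|]; rewrite root_XsubC => /eqP yx.
  by move: xr; rewrite -yx yr.
by exists q'; rewrite big_cons -mulrA [_ * ('X - _)]mulrC.
Qed.

(** The left side substitutes [u] for X and [v] for Y in p(X), where Y does not occur. *)
Lemma horner2_comp p u v :
  (map_poly (comp_poly v) p^:P).[u] = p \Po u.
Proof.
rewrite -map_poly_comp /comp_poly; congr (_.[_]).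
by apply: eq_map_poly => x /=; rewrite comp_polyC.
Qed.

Variables (h : {poly R}) (s : seq {poly R}).
Hypotheses (hm : h \is monic) (h1 : (1 < size h)%N) (us : uniq s).
Hypotheses (ss : size s = (size h).-1).
Hypothesis (sP : forall t, t \in s -> h \Po t = h).

(** The elements of [s] are deg h distinct roots of h(X) - h(Y), which is monic of degree deg h in
    X. *)
Lemma stab_prod : h^:P - h%:P = \prod_(t <- s) ('X - t%:P) :> {poly {poly R}}.
Proof.
have sz : size (h^:P - h%:P) = size h.
  rewrite size_polyDl ?size_map_polyC //.
  by rewrite size_polyN size_polyC; apply: leq_ltn_trans h1; case: (h != 0).
have lc : lead_coef (h^:P - h%:P) = 1.
  rewrite /lead_coef sz coefB coef_map /= coefC.
  have -> : (size h).-1 == 0%N = false by move: h1; case: (size h) => [|[]].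
  by rewrite subr0 -[h`_(_)]/(lead_coef h) (eqP hm).
have [|q qE] := @uniq_roots_factor _ (h^:P - h%:P) s us.
  apply/allP => t ts; rewrite rootE hornerD hornerN hornerC.
  by rewrite -[h^:P.[t]]/(h \Po t) sP ?subrr.
have pm : \prod_(t <- s) ('X - t%:P) \is monic by apply: monic_prod_XsubC.
have sq : (size q <= 1)%N.
  have q0 : q != 0 by apply: contra_eq_neq lc => q0; rewrite qE q0 mul0r lead_coef0 eq_sym oner_neq0.
  move: sz; rewrite qE size_Mmonic // size_prod_XsubC ss => e.
  by move: h1 e; rewrite -size_poly_gt0 in q0; move: (size q) (size h) q0 => x y; lia.
move: lc; rewrite qE lead_coef_Mmonic // (size1_polyC sq) lead_coefC => ->.
by rewrite mul1r.
Qed.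

Lemma stab_comp_sub u v :
  (h \Po u) - (h \Po v) = \prod_(t <- s) (u - (t \Po v)).
Proof.
have /(congr1 (fun p : {poly {poly R}} => (map_poly (comp_poly v) p).[u])) := stab_prod.
rewrite rmorphB /= hornerD hornerN horner2_comp map_polyC /= hornerC => ->.
rewrite rmorph_prod horner_prod /=; apply: eq_bigr => t _.
by rewrite rmorphB /= map_polyX map_polyC /= hornerD hornerN hornerX hornerC.
Qed.

Lemma stab_horner x y : h.[x] - h.[y] = \prod_(t <- s) (x - t.[y]).
Proof.
apply: polyC_inj; rewrite rmorphB rmorph_prod /= -!comp_polyCr stab_comp_sub.
by apply: eq_bigr => t _; rewrite rmorphB /= comp_polyCr.
Qed.

(** Substituting [t] for X and X for Y in [stab_prod] gives a vanishing product in a domain. So [s]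
    is the full stabilizer of [h], which is what makes it closed under composition and inverses. *)
Lemma stab_mem t : h \Po t = h -> t \in s.
Proof.
move=> ht; have := stab_comp_sub t 'X; rewrite ht comp_polyXr subrr => /esym/eqP.
rewrite prodf_seq_eq0 => /hasP[u us' /=]; rewrite comp_polyXr subr_eq0.
by move=> /eqP->.
Qed.

Lemma stab_X : 'X \in s.
Proof. by apply: stab_mem; rewrite comp_polyXr. Qed.

Lemma stab_comp t u : t \in s -> u \in s -> t \Po u \in s.
Proof. by move=> ts us'; apply: stab_mem; rewrite comp_polyA sP // sP. Qed.

Lemma stab_size t : t \in s -> size t = 2%N.
Proof.
move=> ts; have := size_comp_poly h t; rewrite sP //.
move: h1; case: (size h) => [|[|n]] //= _.
by case: (size t) => [|[|[|m]]] //=; rewrite ?muln0 // mulnS => /eqP; lia.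
Qed.

Lemma stab_lead t : t \in s -> lead_coef t ^+ (size h).-1 = 1.
Proof.
move=> ts; have := lead_coef_comp h (q := t); rewrite stab_size // sP //.
by move=> /(_ isT); rewrite (eqP hm) mul1r => <-.
Qed.

Lemma stab_perm t : t \in s -> perm_eq [seq u \Po t | u <- s] s.
Proof.
move=> ts; have um : uniq [seq u \Po t | u <- s].
  by rewrite map_inj_uniq //; apply: comp_poly_inj; apply: stab_size.
apply: uniq_perm => //.
have sub : {subset [seq u \Po t | u <- s] <= s}.
  by move=> _ /mapP[u us' ->]; apply: stab_comp.
have [|_ e] := uniq_min_size um sub; first by rewrite size_map.
exact: e.
Qed.

Lemma stab_inv t : t \in s -> exists2 u, u \in s & u \Po t = 'X /\ t \Po u = 'X.
Proof.
move=> ts; have := stab_X; rewrite -(perm_mem (stab_perm ts)) => /mapP[u us' e].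
exists u => //; split=> //; apply: (comp_poly_inj (stab_size ts)) => /=.
by rewrite -comp_polyA -e comp_polyXr comp_polyX.
Qed.

Local Notation rmodp := Pdiv.CommonRing.rmodp.
Local Notation rdivp := Pdiv.CommonRing.rdivp.
(* The constant to which the product of the [a \Po t] is congruent mod [h]; see
   [rmodp_nprod]. *)
Definition nprod a := \prod_(t <- s) (a \Po t).
Definition stab_norm a : R := (rmodp (nprod a) h)`_0.

Lemma nprod_comp a t : t \in s -> nprod a \Po t = nprod a.
Proof.
move=> ts; rewrite /nprod rmorph_prod /= -[RHS](perm_big _ (stab_perm ts)) big_map /=.
by apply: eq_bigr => u _; rewrite comp_polyA.
Qed.

(** The remainder r is fixed by every t in [s]: the product and [h] are, and t preserves degrees, so
    division is unique. Then r(X) - r(Y) has the deg h roots [s] but smaller degree, hence is zero,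
    and r is constant. *)
Lemma rmodp_nprod a : rmodp (nprod a) h = (stab_norm a)%:P.
Proof.
set p := nprod a; set q := rdivp p h; set r := rmodp p h.
have pE : p = q * h + r by apply: Pdiv.RingMonic.rdivp_eq.
have sr : (size r < size h)%N by rewrite Pdiv.CommonRing.ltn_rmodpN0 ?monic_neq0.
have rt t : t \in s -> r \Po t = r.
  move=> ts; have := nprod_comp a ts; rewrite -/p pE rmorphD rmorphM /= sP //.
  move/eqP; rewrite -subr_eq0 => /eqP e.
  have e2 : ((q \Po t) - q) * h = r - (r \Po t).
    by apply/eqP; rewrite -subr_eq0 -e; apply/eqP; ring.
  have q0 : (q \Po t) - q = 0.
    apply: (monic_mul_small hm e2); apply: leq_ltn_trans (size_polyD _ _) _.
    by rewrite gtn_max size_polyN sr size_comp_poly2 // stab_size.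
  by apply/eqP; move/eqP: e2; rewrite q0 mul0r eq_sym subr_eq0 eq_sym.
suff rC : r^:P = r%:P.
  have : (size r <= 1)%N by rewrite -(size_map_polyC r) rC size_polyC leq_b1.
  by move/size1_polyC => {1}->.
apply/eqP; rewrite -subr_eq0; apply/eqP.
apply: (@roots_geq_poly_eq0 _ _ s) => //.
  apply/allP => t ts; rewrite rootE hornerD hornerN hornerC.
  by rewrite -[r^:P.[t]]/(r \Po t) rt ?subrr.
rewrite ss -ltnS prednK; last exact: ltnW.
apply: leq_ltn_trans (size_polyD _ _) _.
by rewrite gtn_max size_polyN size_map_polyC sr size_polyC; apply: leq_ltn_trans h1; case: (_ != _).
Qed.

Lemma stab_normE a : nprod a = rdivp (nprod a) h * h + (stab_norm a)%:P.
Proof. by rewrite -rmodp_nprod; apply: Pdiv.RingMonic.rdivp_eq. Qed.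

Lemma stab_norm_neq0 a : irreducible_poly h -> a != 0 -> (size a < size h)%N -> stab_norm a != 0.
Proof.
move=> irr a0 sa; apply/eqP => n0; have := stab_normE a; rewrite n0 addr0 => e.
have : h %| nprod a by rewrite e dvdp_mulIr.
case/(irreducible_dvd_prod irr) => t ts.
have st := stab_size ts.
move/dvdp_leq; rewrite comp_poly2_eq0 // => /(_ a0).
by rewrite size_comp_poly2 // leqNgt sa.
Qed.

Lemma stab_norm_conj a : exists b k, a * b = k * h + (stab_norm a)%:P.
Proof.
exists (\prod_(t <- rem 'X s) (a \Po t)), (rdivp (nprod a) h).
by rewrite -stab_normE /nprod (big_rem _ stab_X) /= comp_polyXr.
Qed.

(** When [r] is a root of [h] modulo a power of P, the norm is, modulo that power, the product of
    the values of [a] at the conjugate roots t(r). *)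
Lemma stab_norm_horner a r : exists k, stab_norm a = \prod_(t <- s) a.[t.[r]] - k * h.[r].
Proof.
have /(congr1 (fun p => p.[r])) := stab_normE a; rewrite hornerD hornerM hornerC => e.
exists (rdivp (nprod a) h).[r]; apply/eqP; rewrite eq_sym subr_eq addrC -e /nprod horner_prod.
by apply/eqP; apply: eq_bigr => t _; rewrite horner_comp.
Qed.

End Stabilizer.

(** * Weighted degrees in A[X] *)

Section Weights.
Variable F : fieldType.
Implicit Types (p a b t v : {poly {poly F}}) (x y : {poly F}).
Local Notation rmodp := Pdiv.CommonRing.rmodp.
Local Notation rdivp := Pdiv.CommonRing.rdivp.

(* [wdeg_lt c w p] bounds the degree of [p] by [w - 1] when X has weight [c]; the
   truncated subtraction forces the coefficients with [w <= c * i] to vanish. *)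
Definition wdeg_lt (c w : nat) p : Prop := forall i, (size (p`_i)%R <= w - c * i)%N.

Lemma wdeg_lt0 c w : wdeg_lt c w 0.
Proof. by move=> i; rewrite coef0 size_poly0. Qed.

Lemma wdeg_lt_weak c w w' p : (w <= w')%N -> wdeg_lt c w p -> wdeg_lt c w' p.
Proof. by move=> ww h i; apply: leq_trans (h i) _; apply: leq_sub2r. Qed.

Lemma wdeg_ltD c w p p' : wdeg_lt c w p -> wdeg_lt c w p' -> wdeg_lt c w (p + p').
Proof.
move=> h h' i; rewrite coefD; apply: leq_trans (size_polyD _ _) _.
by rewrite geq_max h h'.
Qed.

Lemma wdeg_ltN c w p : wdeg_lt c w p -> wdeg_lt c w (- p).
Proof. by move=> h i; rewrite coefN size_polyN. Qed.

Lemma wdeg_lt_sum c w (I : Type) (r : seq I) (E : I -> {poly {poly F}}) :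
  (forall i, wdeg_lt c w (E i)) -> wdeg_lt c w (\sum_(i <- r) E i).
Proof.
move=> h; elim: r => [|i r IH]; rewrite ?big_nil ?big_cons; first exact: wdeg_lt0.
exact: wdeg_ltD.
Qed.

Lemma wdeg_ltM c w w' p p' : wdeg_lt c w p -> wdeg_lt c w' p' -> wdeg_lt c (w + w').-1 (p * p').
Proof.
move=> hp hp' i; rewrite coefM; apply: leq_trans (size_sum _ _ _) _.
apply/bigmax_leqP => j _.
have [->|x0] := eqVneq p`_j 0; first by rewrite mul0r size_poly0.
have [->|y0] := eqVneq p'`_(i - j) 0; first by rewrite mulr0 size_poly0.
apply: leq_trans (size_polyMleq _ _) _.
have := hp j; have := hp' (i - j)%N; move: x0 y0; rewrite -!size_poly_gt0.
have -> : (c * i = c * j + c * (i - j))%N by rewrite -mulnDr subnKC // -ltnS ltn_ord.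
by move: (size _) (size _) (c * j)%N (c * (i - j))%N => A B C D; lia.
Qed.

Lemma wdeg_ltC c x : wdeg_lt c (size x) x%:P.
Proof. by move=> [|i]; rewrite coefC /= ?muln0 ?subn0 // size_poly0. Qed.

Lemma wdeg_lt_exp c t i : wdeg_lt c c.+1 t -> wdeg_lt c (c * i).+1 (t ^+ i).
Proof.
move=> ht; elim: i => [|i IH].
  by rewrite expr0 muln0; apply: wdeg_lt_weak (wdeg_ltC c 1); rewrite size_poly1.
by rewrite exprS; have := wdeg_ltM ht IH; rewrite mulnS; congr (wdeg_lt _ _ _); lia.
Qed.

(** The image [t] of X weighs at most [c], as X does, so no monomial gains weight. *)
Lemma wdeg_lt_comp c w a t : wdeg_lt c c.+1 t -> wdeg_lt c w a -> wdeg_lt c w (a \Po t).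
Proof.
move=> ht ha; rewrite comp_polyE; apply: wdeg_lt_sum => i; rewrite -mul_polyC.
have [->|a0] := eqVneq a`_i 0; first by rewrite mul0r; apply: wdeg_lt0.
apply: wdeg_lt_weak (wdeg_ltM (wdeg_ltC c _) (wdeg_lt_exp i ht)).
by move: (ha i); rewrite -size_poly_gt0 in a0; move: (size _) (c * i)%N a0 => A B; lia.
Qed.

Lemma wdeg_lt_small c w m p : (forall i, (size (p`_i)%R <= m)%N) ->
  (forall i, (i < size p)%N -> m + c * i <= w)%N -> wdeg_lt c w p.
Proof.
move=> h1 h2 i; have [mirr|mirr] := ltnP i (size p); last first.
  by rewrite nth_default // size_poly0.
by apply: leq_trans (h1 i) _; have := h2 i mirr; lia.
Qed.

Lemma rmodp_uniq (S : nzRingType) (h q r p : {poly S}) :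
  h \is monic -> p = q * h + r -> (size r < size h)%N -> rmodp p h = r.
Proof. by move=> hm -> sr; rewrite Pdiv.RingMonic.rmodp_addl_mul_small. Qed.

(** The heaviest that [h] can be is the weight of its leading term, so each division step subtracts
    a multiple of [h] that weighs no more than the leading term it cancels. *)
Lemma wdeg_lt_rmodp c w (h : {poly {poly F}}) p : h \is monic -> wdeg_lt c (c * deg h).+1 h ->
  wdeg_lt c w p -> wdeg_lt c w (rmodp p h).
Proof.
move=> hm hh; have h0 := monic_neq0 hm.
have sh : (0 < size h)%N by rewrite size_poly_gt0.
elim: {p}(size p) {-2}p (leqnn (size p)) => [|n IH] p sp hp.
  move: sp; rewrite leqn0 size_poly_eq0 => /eqP->.
  by rewrite Pdiv.CommonRing.rmod0p; apply: wdeg_lt0.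
have [lt|ge] := ltnP (size p) (size h); first by rewrite Pdiv.CommonRing.rmodp_small.
pose k := (size p - size h)%N.
pose u := lead_coef p *: 'X^k : {poly {poly F}}.
have p0 : p != 0 by rewrite -size_poly_gt0 (leq_trans sh).
have lc0 : lead_coef p != 0 by rewrite lead_coef_eq0.
have su : size u = k.+1 by rewrite size_scale // size_polyXn.
have u0 : u != 0 by rewrite -size_poly_gt0 su.
have suh : size (u * h) = size p by rewrite size_Mmonic // su /k; move: ge sh; move: (size p) (size h) => x y; lia.
have luh : lead_coef (u * h) = lead_coef p.
  by rewrite lead_coef_Mmonic // lead_coefZ lead_coefXn mulr1.
have sp' : (size (p - u * h)%R < size p)%N.
  rewrite ltn_neqAle; apply/andP; split; last first.
    by apply: leq_trans (size_polyD _ _) _; rewrite size_polyN suh maxnn.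
  apply/eqP => e; have : lead_coef (p - u * h) = 0.
    by rewrite /lead_coef e coefB -{2}suh -!/(lead_coef _) luh subrr.
  move/eqP; rewrite lead_coef_eq0 => /eqP z; move: e; rewrite z size_poly0 => e.
  by move: p0; rewrite -size_poly_gt0 -e.
have wuh : wdeg_lt c w (u * h).
  have hlc := hp (size p).-1; rewrite -/(lead_coef p) in hlc.
  have e1 : ((size p).-1 = k + deg h)%N.
    by rewrite /k /deg; move: ge sh; move: (size p) (size h) => x y; lia.
  rewrite e1 mulnDr in hlc.
  have lgt : (0 < size (lead_coef p))%N by rewrite size_poly_gt0.
  have hu : wdeg_lt c (w - c * deg h) u.
    move=> i; rewrite coefZ coefXn; case: eqP => [->|_]; last by rewrite mulr0 size_poly0.
    by rewrite mulr1; move: hlc; lia.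
  apply: wdeg_lt_weak (wdeg_ltM hu hh); move: hlc lgt.
  by move: (size _) (c * deg h)%N (c * k)%N => A B C; lia.
have -> : rmodp p h = rmodp (p - u * h) h.
  apply: (@rmodp_uniq _ _ (rdivp (p - u * h) h + u)) => //.
    rewrite mulrDl addrAC -Pdiv.RingMonic.rdivp_eq //; ring.
  by rewrite Pdiv.CommonRing.ltn_rmodpN0.
apply: IH; first by rewrite -ltnS; apply: leq_trans sp.
by apply: wdeg_ltD => //; apply: wdeg_ltN.
Qed.

Lemma wdeg_lt_monic c (h : {poly {poly F}}) : h \is monic -> (forall i, (size (h`_i)%R <= c)%N) ->
  wdeg_lt c (c * deg h).+1 h.
Proof.
move=> hm hc i; have h0 := monic_neq0 hm.
have sh : (0 < size h)%N by rewrite size_poly_gt0.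
have [lt|] := ltnP i (deg h).
  apply: leq_trans (hc i) _.
  have -> : deg h = (i + (deg h - i).-1.+1)%N by lia.
  by rewrite mulnDr mulnS; lia.
rewrite leq_eqVlt => /orP[/eqP<-|lt].
  by rewrite -[h`_(deg h)]/(lead_coef h) (eqP hm) size_poly1; lia.
by rewrite nth_default ?size_poly0 //; move: lt sh; rewrite /deg; move: (size h) => x; lia.
Qed.

End Weights.

(** * Degree of a norm, and reduction modulo a lattice *)

Section NormSize.
Variable F : fieldType.
Implicit Types (a b t v : {poly {poly F}}).
Local Notation rmodp := Pdiv.CommonRing.rmodp.
Local Notation rdivp := Pdiv.CommonRing.rdivp.
Variables (h : {poly {poly F}}) (s : seq {poly {poly F}}).
Hypotheses (hm : h \is monic) (h1 : (1 < size h)%N) (us : uniq s).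
Hypotheses (ss : size s = (size h).-1).
Hypothesis (sP : forall t, t \in s -> h \Po t = h).
Variable c : nat.
Hypothesis (hc : wdeg_lt c (c * deg h).+1 h).

(** The constant [a0] outweighs [b], so in the product over [s] the power a0^e outweighs all other
    terms. Substitutions and reduction mod [h] do not raise weights, so this constant still
    dominates the norm. *)
Lemma stab_norm_size (a0 : {poly F}) b m0 : size a0 = m0.+1 -> wdeg_lt c m0 b ->
  (forall t, t \in s -> wdeg_lt c c.+1 t) ->
  size (stab_norm h s (a0%:P + b)) = (deg h * m0).+1.
Proof.
move=> sa hb ht.
have a00 : a0 != 0 by rewrite -size_poly_gt0 sa.
have key (s0 : seq {poly {poly F}}) : (forall t, t \in s0 -> wdeg_lt c c.+1 t) ->
    exists r, nprod s0 (a0%:P + b) = (a0 ^+ size s0)%:P + r /\ wdeg_lt c (size s0 * m0) r.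
  rewrite /nprod; elim: s0 => [|t s' IH] {}ht.
    by exists 0; rewrite big_nil expr0 addr0; split=> //; apply: wdeg_lt0.
  have [|r [e wr]] := IH; first by move=> u us'; apply: ht; rewrite inE us' orbT.
  rewrite big_cons e rmorphD /= comp_polyC.
  have wbt : wdeg_lt c m0 (b \Po t) by apply: wdeg_lt_comp => //; apply: ht; rewrite mem_head.
  exists ((b \Po t) * (a0 ^+ size s')%:P + a0%:P * r + (b \Po t) * r); split.
    by rewrite exprS polyCM; ring.
  apply: wdeg_ltD; first apply: wdeg_ltD.
  - apply: wdeg_lt_weak (wdeg_ltM wbt (wdeg_ltC c _)); have e1 := size_exp a0 (size s').
    rewrite sa /= mulnC in e1; rewrite mulSn -e1.
    by move: (size _) => x; lia.
  - by apply: wdeg_lt_weak (wdeg_ltM (wdeg_ltC c _) wr); rewrite sa mulSn; lia.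
  - by apply: wdeg_lt_weak (wdeg_ltM wbt wr); rewrite mulSn; lia.
have [r [nE wr]] := key s ht.
rewrite /stab_norm nE Pdiv.RingMonic.rmodpD // coefD Pdiv.CommonRing.rmodp_small ?coefC /=; last first.
  by apply: leq_ltn_trans h1; apply: size_polyC_leq1.
have sz : size (a0 ^+ size s) = (size s * m0).+1.
  have := size_exp a0 (size s); rewrite sa /= => e.
  by rewrite mulnC -e prednK // size_poly_gt0 expf_neq0.
have := wdeg_lt_rmodp hm hc wr 0; rewrite muln0 subn0 => le.
by rewrite size_polyDl sz // ss.
Qed.

(* Since a * b = N(a) mod h, dividing the coefficients of b * v by N(a)
   reduces v modulo the lattice generated by the a * X^j. *)
Lemma reduce_mod a m v : irreducible_poly h -> a != 0 -> (size a < size h)%N ->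
  (forall i, (size (a`_i)%R <= m)%N) ->
  exists v' k u, [/\ v = v' + a * k + u * h, (size v' < size h)%N &
    forall i, (size (v'`_i)%R <= m + 2 * (c * deg h))%N].
Proof.
move=> irr a0 sa am.
have [b [k abE]] := stab_norm_conj hm h1 us ss sP a.
have N0 : stab_norm h s a != 0 by apply: stab_norm_neq0.
move: abE N0; set N := stab_norm h s a => abE N0.
pose w := rmodp (b * v) h; pose q := rdivp (b * v) h.
have bvE : b * v = q * h + w by apply: Pdiv.RingMonic.rdivp_eq.
have sw : (size w < size h)%N by rewrite Pdiv.CommonRing.ltn_rmodpN0 ?monic_neq0.
pose k1 := map_poly (fun x => x %/ N) w; pose k2 := map_poly (fun x => x %% N) w.
have wE : w = N%:P * k1 + k2.
  apply/polyP => i; rewrite coefD coefCM !coef_map_id0 ?div0p ?mod0p //.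
  by rewrite mulrC -divp_eq.
have sk2 : (size k2 <= size w)%N by apply: size_poly.
pose x := v - a * k1; pose v' := rmodp x h; pose q' := rdivp x h.
have xE : x = q' * h + v' by apply: Pdiv.RingMonic.rdivp_eq.
have sv' : (size v' < size h)%N by rewrite Pdiv.CommonRing.ltn_rmodpN0 ?monic_neq0.
exists v', k1, q'; split=> //; first by rewrite -[LHS](subrK (a * k1)) -/x xE; ring.
(* The size of v' is read off N * v', which is a * k2 reduced mod [h]; the degree of N cancels since
   the coefficients of k2 are remainders modulo N. *)
have NvE : a * k2 = (N%:P * q' - a * q + k * v) * h + N%:P * v'.
  have e1 : N%:P * v = a * w + (a * q - k * v) * h.
    have -> : N%:P * v = a * (b * v) - k * h * v.
      by rewrite mulrA abE; ring.
    by rewrite bvE; ring.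
  have e2 : N%:P * x = a * k2 + (a * q - k * v) * h.
    by rewrite /x mulrBr e1 wE; ring.
  have -> : a * k2 = N%:P * x - (a * q - k * v) * h by rewrite e2; ring.
  by rewrite xE; ring.
have Nv' : rmodp (a * k2) h = N%:P * v'.
  apply: rmodp_uniq NvE _ => //; apply: leq_ltn_trans sv'.
  by rewrite mul_polyC; apply: size_scale_leq.
have wa : wdeg_lt c (m + c * deg h) a.
  apply: (wdeg_lt_small am) => i ia; rewrite leq_add2l leq_mul2l /deg; apply/orP; right.
  by move: ia sa; move: (size a) (size h) => A B; lia.
have N1 : (0 < size N)%N by rewrite size_poly_gt0.
have wk : wdeg_lt c ((size N).-1 + c * deg h) k2.
  apply: (@wdeg_lt_small _ _ _ (size N).-1) => i.
    rewrite coef_map_id0 ?mod0p // -ltnS prednK //.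
    by rewrite ltn_modp.
  move=> ia; rewrite leq_add2l leq_mul2l /deg; apply/orP; right.
  by move: ia sk2 sw; move: (size k2) (size w) (size h) => A B C; lia.
have := wdeg_lt_rmodp hm hc (wdeg_ltM wa wk); rewrite Nv' => wv i.
have := wv i; rewrite coefCM; have [->|vi0] := eqVneq v'`_i 0; first by rewrite size_poly0.
rewrite size_mul // => le; have := size_poly_gt0 v'`_i; rewrite vi0 => vgt.
by move: le vgt N1; move: (size _) (size N) (c * deg h)%N (c * i)%N => A B C D; lia.
Qed.

End NormSize.

(** * Lattices and residues *)

Section Lattice.
Variable F : finFieldType.
Local Notation rmodp := Pdiv.CommonRing.rmodp.
Local Notation rdivp := Pdiv.CommonRing.rdivp.

Lemma card_fiber_le (U : finType) (Z : Type) (psi : U -> Z) (u v : U) (g : U -> U) :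
  injective g -> g u = v -> (forall x y, psi x = psi y -> psi (g x) = psi (g y)) ->
  (#|[pred x | `[< psi x = psi u >]]| <= #|[pred x | `[< psi x = psi v >]]|)%N.
Proof.
move=> gi <- gp; rewrite -(fintype.card_image gi); apply: subset_leq_card.
apply/fintype.subsetP => y /fintype.imageP[x]; rewrite !inE => xu ->.
exact: gp.
Qed.

(** The bijections [g u v] respect the partition into fibres and send [u] to [v], so all fibres have
    the same size. In the uses they are translations; no group structure on the target is
    required. *)
Lemma card_fibers (U Z : finType) (psi : U -> Z) (g : U -> U -> U -> U) :
  (forall u v, injective (g u v)) -> (forall u v, g u v u = v) ->
  (forall u v x y, psi x = psi y -> psi (g u v x) = psi (g u v y)) ->
  (forall z, exists u, psi u = z) ->
  forall z, (#|[pred x | `[< psi x = z >]]| * #|Z| = #|U|)%N.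
Proof.
move=> gi gu gp sur z.
have -> : #|U| = (\sum_(y : Z) #|[pred x | `[< psi x = y >]]|)%N.
  rewrite -sum1_card (partition_big psi predT) //=; apply: eq_bigr => y _.
  by rewrite -sum1_card; apply: eq_bigl => x; rewrite inE; apply/eqP/asboolP.
rewrite (eq_bigr (fun=> #|[pred x | `[< psi x = z >]]|)).
  by rewrite sum_nat_const mulnC.
move=> y _; have [u <-] := sur y; have [v <-] := sur z.
by apply/eqP; rewrite eqn_leq !(card_fiber_le (gi _ _) (gu _ _) (gp _ _)).
Qed.

Implicit Types (m M : {poly F}) (p l a : {poly {poly F}}).

(** Membership in the ideal (l, m) of A[X]. For [l] monic and [m] nonzero its index is q^(deg l *
    deg m), the classes being told apart by [res]. *)
Definition in_lattice m l p : Prop := exists u w, p = u * l + m%:P * w.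

Lemma in_latticeD m l p p' : in_lattice m l p -> in_lattice m l p' -> in_lattice m l (p + p').
Proof. by move=> [u [w ->]] [u' [w' ->]]; exists (u + u'), (w + w'); ring. Qed.

Lemma in_latticeM m l p (q : {poly {poly F}}) : in_lattice m l p -> in_lattice m l (q * p).
Proof. by move=> [u [w ->]]; exists (q * u), (q * w); ring. Qed.

Lemma in_latticeN m l p : in_lattice m l p -> in_lattice m l (- p).
Proof. by move=> [u [w ->]]; exists (- u), (- w); ring. Qed.

Lemma in_latticeC m l p : in_lattice m l (m%:P * p).
Proof. by exists 0, p; ring. Qed.

Definition res m l p : {ffun 'I_(deg l) -> {poly_(deg m) F}} :=
  [ffun i : 'I_(deg l) => npolyp (deg m) ((rmodp p l)`_i %% m)].

Lemma size_mod_deg m (x : {poly F}) : m != 0 -> (size (x %% m)%R <= deg m)%N.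
Proof. by move=> m0; rewrite -ltnS degS // ltn_modp. Qed.

Lemma resP m l p p' : m != 0 -> l \is monic ->
  res m l p = res m l p' <-> in_lattice m l (p - p').
Proof.
move=> m0 lm; have l0 := monic_neq0 lm; split.
  move=> /ffunP e; pose r := rmodp p l - rmodp p' l.
  have pE : p - p' = (rdivp p l - rdivp p' l) * l + r.
    by rewrite /r {1}(Pdiv.RingMonic.rdivp_eq lm p) {1}(Pdiv.RingMonic.rdivp_eq lm p'); ring.
  rewrite pE; exists (rdivp p l - rdivp p' l), (map_poly (fun x => x %/ m) r).
  congr (_ + _); apply/polyP => i; rewrite coefCM coef_map_id0 ?div0p // mulrC divpK //.
  rewrite /r coefB; have [ii|ii] := ltnP i (deg l); last first.
    rewrite -ltnS degS // in ii.
    by rewrite !nth_default ?subrr ?dvdp0 // -ltnS; apply: leq_trans ii; rewrite Pdiv.CommonRing.ltn_rmodpN0.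
  have := e (Ordinal ii); rewrite !ffunE /= => /(congr1 (@polyn _ _)).
  rewrite !npolypK ?size_mod_deg // => /eqP.
  by rewrite /dvdp modpD modpN => /eqP ->; rewrite subrr.
move=> [u [w e]]; apply/ffunP => i; rewrite !ffunE; congr npolyp.
have -> : rmodp p l = rmodp p' l + m%:P * rmodp w l.
  have -> : p = p' + (u * l + m%:P * w) by rewrite -e; ring.
  by rewrite !Pdiv.RingMonic.rmodpD // Pdiv.RingMonic.rmodp_mull // add0r mul_polyC Pdiv.RingMonic.rmodpZ // mul_polyC.
by rewrite coefD coefCM modpD modp_mulr addr0.
Qed.

Variable e : nat.

Definition box_poly (mu : nat) (b : {ffun 'I_e -> {poly_mu F}}) : {poly {poly F}} :=
  \poly_(k < e) (if insub k is Some i then polyn (b i) else 0).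

Lemma coef_box mu (b : {ffun 'I_e -> {poly_mu F}}) (i : 'I_e) : (box_poly b)`_i = polyn (b i).
Proof. by rewrite coef_poly ltn_ord valK. Qed.

Lemma size_box mu (b : {ffun 'I_e -> {poly_mu F}}) : (size (box_poly b) <= e)%N.
Proof. exact: size_poly. Qed.

Lemma size_coef_box mu (b : {ffun 'I_e -> {poly_mu F}}) i : (size ((box_poly b)`_i)%R <= mu)%N.
Proof.
have [ii|ii] := ltnP i e.
  by rewrite (coef_box b (Ordinal ii)) size_npoly.
by rewrite nth_default ?size_poly0 // (leq_trans (size_box b)).
Qed.

Lemma box_ext mu mu' (b : {ffun 'I_e -> {poly_mu F}}) (b' : {ffun 'I_e -> {poly_mu' F}}) :
  (forall i, polyn (b i) = polyn (b' i)) -> box_poly b = box_poly b'.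
Proof.
move=> h; apply/polyP => i; have [ii|ii] := ltnP i e.
  by rewrite (coef_box b (Ordinal ii)) (coef_box b' (Ordinal ii)).
by rewrite !nth_default ?(leq_trans (size_box _)).
Qed.

Lemma box_polyD mu (b b' : {ffun 'I_e -> {poly_mu F}}) : box_poly (b + b') = box_poly b + box_poly b'.
Proof.
apply/polyP => i; rewrite coefD; have [ii|ii] := ltnP i e.
  by rewrite !(coef_box _ (Ordinal ii)) ffunE.
by rewrite !nth_default ?addr0 ?(leq_trans (size_box _)).
Qed.

Lemma box_polyN mu (b : {ffun 'I_e -> {poly_mu F}}) : box_poly (- b) = - box_poly b.
Proof.
apply/polyP => i; rewrite coefN; have [ii|ii] := ltnP i e.
  by rewrite !(coef_box _ (Ordinal ii)) ffunE.
by rewrite !nth_default ?oppr0 ?(leq_trans (size_box _)).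
Qed.

Lemma box_inj mu : injective (@box_poly mu).
Proof. by move=> b b' bb; apply/ffunP => i; apply: val_inj; rewrite /= -!coef_box bb. Qed.

Lemma box_surj mu (v : {poly {poly F}}) : (size v <= e)%N -> (forall i, (size (v`_i)%R <= mu)%N) ->
  exists b : {ffun 'I_e -> {poly_mu F}}, box_poly b = v.
Proof.
move=> sv vm; exists [ffun i : 'I_e => npolyp mu v`_i].
apply/polyP => i; have [ii|ii] := ltnP i e.
  by rewrite (coef_box _ (Ordinal ii)) ffunE npolypK.
by rewrite !nth_default ?(leq_trans (size_box _)) // (leq_trans sv).
Qed.

Lemma card_box mu : #|{ffun 'I_e -> {poly_mu F}}| = (#|F| ^ (e * mu))%N.
Proof. by rewrite card_ffun card_ord card_npoly -expnM mulnC. Qed.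

Lemma card_res m l : #|{ffun 'I_(deg l) -> {poly_(deg m) F}}| = (#|F| ^ (deg l * deg m))%N.
Proof. by rewrite card_ffun card_ord card_npoly -expnM mulnC. Qed.

Lemma res_surj m l (z : {ffun 'I_(deg l) -> {poly_(deg m) F}}) :
  m != 0 -> l \is monic -> exists p, res m l p = z.
Proof.
move=> m0 lm; have l0 := monic_neq0 lm.
pose p : {poly {poly F}} := \poly_(k < deg l) (if insub k is Some i then polyn (z i) else 0).
exists p; apply/ffunP => i; rewrite ffunE Pdiv.CommonRing.rmodp_small; last first.
  by rewrite -(degS l0) ltnS; apply: size_poly.
rewrite coef_poly ltn_ord valK modp_small; last by rewrite -(degS m0) ltnS size_npoly.
by apply: val_inj; rewrite /= npolypK // size_npoly.
Qed.

Variables (h : {poly {poly F}}) (s : seq {poly {poly F}}).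
Hypotheses (hm : h \is monic) (h1 : (1 < size h)%N) (us : uniq s).
Hypotheses (ss : size s = (size h).-1).
Hypothesis (sP : forall t, t \in s -> h \Po t = h).
Hypothesis (irr : irreducible_poly h) (he : e = deg h).
Variable c : nat.
Hypothesis (hc : wdeg_lt c (c * deg h).+1 h).
Let C0 := (2 * (c * e))%N.
Let q := #|F|.

Let q1 : (1 < q)%N. Proof. exact: card_finNzRing_gt1. Qed.

Lemma lattice_repr m l a (m1 : nat) p : in_lattice m l h -> in_lattice m l a -> a != 0 ->
  (size a <= e)%N -> (forall i, (size (a`_i)%R <= m1)%N) ->
  exists b : {ffun 'I_e -> {poly_(m1 + C0) F}}, in_lattice m l (p - box_poly b).
Proof.
move=> hL aL a0 sa am; have sh : size h = e.+1 by rewrite he degS // monic_neq0.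
have sah : (size a < size h)%N by rewrite sh ltnS.
have [v' [k [u [pE sv' vm]]]] := reduce_mod hm h1 us ss sP hc p irr a0 sah am.
have [||b bE] := @box_surj (m1 + C0) v'.
- by rewrite -ltnS -sh.
- by move=> i; rewrite /C0 he.
exists b; rewrite bE; have -> : p - v' = k * a + u * h by rewrite pE; ring.
by apply: in_latticeD; apply: in_latticeM.
Qed.

(** Every class has a representative in the box by [lattice_repr], so the index is at most the size
    of the box. Read contrapositively, a lattice of large index contains no short element. *)
Lemma lattice_index_le m l a (m1 : nat) : m != 0 -> l \is monic -> in_lattice m l h -> in_lattice m l a -> a != 0 ->
  (size a <= e)%N -> (forall i, (size (a`_i)%R <= m1)%N) ->
  (deg l * deg m <= e * (m1 + C0))%N.
Proof.
move=> m0 lm hL aL a0 sa am; rewrite -(leq_exp2l _ _ q1) -card_res -card_box.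
pose psi (b : {ffun 'I_e -> {poly_(m1 + C0) F}}) := res m l (box_poly b).
have sur z : exists b, psi b = z.
  have [p <-] := res_surj z m0 lm; have [b bE] := lattice_repr p hL aL a0 sa am.
  by exists b; apply/esym/resP.
have -> : #|{ffun 'I_(deg l) -> {poly_(deg m) F}}| = #|codom psi|.
  apply/esym/eq_card => z; rewrite !inE; apply/codomP.
  by have [b <-] := sur z; exists b.
exact: leq_image_card.
Qed.

(** Pigeonhole, as in Minkowski's theorem: the box has more points than there are classes, and the
    difference of two congruent points is short and nonzero. *)
Lemma lattice_point m l (m1 : nat) : m != 0 -> l \is monic ->
  (deg l * deg m < e * m1)%N ->
  exists a, [/\ in_lattice m l a, a != 0, (size a <= e)%N & forall i, (size (a`_i)%R <= m1)%N].
Proof.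
move=> m0 lm lt; pose psi (b : {ffun 'I_e -> {poly_m1 F}}) := res m l (box_poly b).
have : ~~ injectiveb psi.
  apply/negP => /injectiveP/leq_card.
  by rewrite card_res card_box leqNgt ltn_exp2l // lt.
case/injectivePn => b [b' bb' /(resP _ _ m0 lm) e'].
have bE : box_poly b - box_poly b' = box_poly (b - b') by rewrite box_polyD box_polyN.
exists (box_poly (b - b')); split.
- by rewrite -bE.
- by rewrite -bE subr_eq0; apply: contra bb' => /eqP/box_inj->.
- exact: size_box.
- exact: size_coef_box.
Qed.

(** Pigeonhole in the box of size mu - C0 gives a nonzero lattice element; reducing by it loses C0,
    so every class is represented in the box of size [mu]. Since M is invertible mod [m], b -> a0 +
    M b is onto the classes, with fibres of equal size. *)
Lemma card_lattice mu m l M a0 : m != 0 -> l \is monic -> in_lattice m l h -> coprimep M m ->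
  (deg l * deg m < e * (mu - C0))%N ->
  (#|[pred b : {ffun 'I_e -> {poly_mu F}} | `[< in_lattice m l (a0 + M%:P * box_poly b) >]]|
    * q ^ (deg l * deg m) = q ^ (e * mu))%N.
Proof.
move=> m0 lm hL cop lt.
have [a [aL an0 sa am]] := lattice_point m0 lm lt.
have Cmu : (C0 <= mu)%N.
  by move: lt; have [//|/ltnW] := leqP C0 mu; rewrite -subn_eq0 => /eqP->; rewrite muln0.
pose psi (b : {ffun 'I_e -> {poly_mu F}}) := res m l (a0 + M%:P * box_poly b).
have [[u v] /= uv] : exists uv : {poly F} * {poly F}, uv.1 * M + uv.2 * m = 1.
  by have /Bezout_eq1_coprimepP[uv uvE] := cop; exists uv.
have := @card_fibers _ _ psi (fun u0 v0 x0 => x0 - u0 + v0) _ _ _ _ (res m l 0).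
rewrite card_res card_box -/q => <-.
- congr (_ * _)%N; apply: eq_card => b; rewrite !inE; apply: asbool_equiv_eq.
  by rewrite /psi resP // subr0.
- by move=> u0 v0; apply: (can_inj (g := fun x => x - v0 + u0)) => x; rewrite addrK subrK.
- by move=> u0 v0; rewrite subrr add0r.
- move=> u0 v0 x y; rewrite /psi !resP // !box_polyD !box_polyN; congr in_lattice; ring.
move=> z; have [p pz] := res_surj z m0 lm.
(* As [u] inverts M mod [m], a representative of u (p - a0) is sent by b -> a0 + M b to the class of
   p. *)
have := lattice_repr (u%:P * (p - a0)) hL aL an0 sa am.
rewrite subnK // => -[b bE]; exists b; rewrite -pz /psi resP //.
have -> : a0 + M%:P * box_poly b - p = - (M%:P * (u%:P * (p - a0) - box_poly b)) - m%:P * (v%:P * (p - a0)).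
  have e1 : (u * M + v * m)%:P = 1 :> {poly {poly F}} by rewrite uv.
  rewrite polyCD !polyCM in e1.
  have -> : a0 + M%:P * box_poly b - p = M%:P * box_poly b - (u%:P * M%:P + v%:P * m%:P) * (p - a0) by rewrite e1; ring.
  by ring.
apply: in_latticeD; apply: in_latticeN; first exact: in_latticeM.
exact: in_latticeC.
Qed.

Lemma card_lattice_widen mu mu' m l M a0 : (mu <= mu')%N ->
  (#|[pred b : {ffun 'I_e -> {poly_mu F}} | `[< in_lattice m l (a0 + M%:P * box_poly b) >]]| <=
   #|[pred b : {ffun 'I_e -> {poly_mu' F}} | `[< in_lattice m l (a0 + M%:P * box_poly b) >]]|)%N.
Proof.
move=> le; pose g (b : {ffun 'I_e -> {poly_mu F}}) : {ffun 'I_e -> {poly_mu' F}} :=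
  [ffun i => npolyp mu' (polyn (b i))].
have gE b : box_poly (g b) = box_poly b.
  by apply: box_ext => i; rewrite ffunE npolypK // (leq_trans (size_npoly _)).
have gi : injective g by move=> b b' bb; apply: box_inj; rewrite -!gE bb.
rewrite -(fintype.card_image gi); apply: subset_leq_card; apply/fintype.subsetP => _ /fintype.imageP[b bL ->].
by move: bL; rewrite !inE gE.
Qed.

Lemma card_lattice_small mu m l M a0 : m != 0 -> l \is monic -> in_lattice m l h -> coprimep M m ->
  (e * (mu - C0) <= deg l * deg m)%N ->
  (#|[pred b : {ffun 'I_e -> {poly_mu F}} | `[< in_lattice m l (a0 + M%:P * box_poly b) >]]|
    <= q ^ (e * C0.+1))%N.
Proof.
move=> m0 lm hL cop le; set I := (deg l * deg m)%N in le *.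
have e0 : (0 < e)%N by rewrite he /deg; move: h1; move: (size h) => x; lia.
(* The least box for which [card_lattice] applies to index q^I; there it leaves at most q^(e (C0 +
   1)) points, a bound independent of the lattice. *)
pose mu' := (I %/ e + C0.+1)%N.
have le1 : (mu <= mu')%N.
  have : (mu - C0 <= I %/ e)%N by rewrite leq_divRL // mulnC.
  by rewrite /mu'; lia.
have lt : (I < e * (mu' - C0))%N.
  rewrite /mu' addnS -addSn addnK mulnC; exact: ltn_ceil.
apply: leq_trans (card_lattice_widen _ _ _ _ le1) _.
have := card_lattice a0 m0 lm hL cop lt; rewrite -/I => cE.
have qI : (0 < q ^ I)%N by rewrite expn_gt0 (ltnW q1).
rewrite -(leq_pmul2r qI) cE -expnD leq_exp2l // /mu' mulnDr addnC leq_add2l.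
by rewrite mulnC leq_trunc_div.
Qed.

End Lattice.

Lemma horner_taylor2 (R : comNzRingType) (p : {poly R}) x y :
  exists w, p.[x + y] = p.[x] + p^`().[x] * y + w * y ^+ 2.
Proof.
elim/poly_ind: p => [|p a [w IH]]; first by exists 0; rewrite deriv0 !horner0; ring.
exists (w * (x + y) + p^`().[x]).
rewrite derivMXaddC hornerD hornerMX !hornerMXaddC IH; ring.
Qed.

(** Bezout over a domain holds up to a nonzero constant [b], which serves as a resultant: modulo a
    prime not dividing it, [h] and [w] have no common root. *)
Lemma irreducible_bezout (R : idomainType) (h w : {poly R}) :
  irreducible_poly h -> w != 0 -> (size w < size h)%N ->
  exists u v b, b != 0 /\ u * h + v * w = b%:P.
Proof.
move=> [h1 irr] w0 sw.
have cop : size (gcdp h w) == 1%N.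
  apply/negPn/negP => /irr/(_ (dvdp_gcdl _ _))/eqp_size e.
  by have := dvdp_leq w0 (dvdp_gcdr h w); rewrite e leqNgt sw.
have [[u v] /= uv] := Bezoutp h w.
have /eqpP[[c1 c2] /= /andP[c10 c20] e] : u * h + v * w %= 1.
  by apply: eqp_trans uv _; rewrite -size_poly_eq1.
exists (c1 *: u), (c1 *: v), c2; split=> //.
by rewrite -!scalerAl -scalerDr e alg_polyC.
Qed.

(** The section [lift] is not additive; fixing its values at 0 and 1 is what lets [map_poly lift]
    lift monic polynomials to monic ones. *)
Lemma residue_field (F : finFieldType) (P : {poly F}) : mirr P ->
  exists (K : finFieldType) (pi : {rmorphism {poly F} -> K}) (lift : K -> {poly F}),
  [/\ forall x, pi (lift x) = x, forall a, (pi a == 0) = (P %| a), lift 0 = 0 & lift 1 = 1].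
Proof.
move=> hP; pose K := {poly %/ P with mirr_monic_irreducible hP}.
pose pi : {rmorphism {poly F} -> K} := in_qpoly P.
exists K, pi, (fun x : K => polyn x); split=> //.
- move=> x; apply: val_inj => /=; apply: in_qpoly_small; exact: size_mk_monic.
- by move=> a; apply: in_qpoly_eq0.
Qed.

(** * Norms modulo a prime *)

Section LocalNorm.
Variable F : finFieldType.
Local Notation A := {poly F}.
Variables (h : {poly A}) (s : seq {poly A}).
Hypotheses (hm : h \is monic) (h1 : (1 < size h)%N) (us : uniq s).
Hypotheses (ss : size s = (size h).-1).
Hypothesis (sP : forall t, t \in s -> h \Po t = h).
Local Notation e := (deg h).

Definition sep (P : A) := forall y, P %| h.[y] -> ~~ (P %| h^`().[y]).

Definition nroots (P : A) : nat := #|[pred r : {poly_(deg P) F} | P %| h.[polyn r]]|.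
Definition common_roots (P : A) (a : {poly A}) : nat :=
  #|[pred r : {poly_(deg P) F} | (P %| h.[polyn r]) && (P %| a.[polyn r])]|.

Lemma dvdp_horner_congr (P : A) (p : {poly A}) x y : P %| x - y -> P %| p.[x] - p.[y].
Proof.
move=> dv; have /factor_theorem[q qE] : root (p - p.[y]%:P) y.
  by rewrite rootE !hornerE subrr.
have -> : p.[x] - p.[y] = (p - p.[y]%:P).[x] by rewrite !hornerE.
by rewrite qE !hornerE; apply: dvdp_mull.
Qed.

Variable P : A.
Hypotheses (hP : mirr P) (hsep : sep P).

Lemma stab_root y t : t \in s -> h.[t.[y]] = h.[y].
Proof. by move=> ts; rewrite -horner_comp sP. Qed.

(** If t(y) and t'(y) agreed modulo P, then t(y) would be a double root of [h] modulo P, because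
    h(X) - h(y) splits with both as roots. *)
Lemma stab_distinct y t t' : P %| h.[y] -> t \in s -> t' \in s -> t != t' ->
  ~~ (P %| t.[y] - t'.[y]).
Proof.
move=> Py ts ts' tt'; apply/negP => dv.
have := stab_comp_sub hm h1 us ss sP 'X y%:P; rewrite comp_polyXr comp_polyCr.
rewrite (big_rem t) //= (big_rem t') /=; last by rewrite mem_rem_uniq // !inE eq_sym tt'.
rewrite !comp_polyCr; set G := \prod_(_ <- _) _ => hE.
have {}hE : h = ('X - t.[y]%:P) * (('X - t'.[y]%:P) * G) + h.[y]%:P by rewrite -hE; ring.
have : P %| h^`().[t.[y]].
  rewrite hE derivD derivM derivC derivXsubC !hornerE subrr mul0r !addr0.
  by apply: dvdp_mulr.
by apply/negP/hsep; rewrite stab_root.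
Qed.

Lemma hensel r k : P %| h.[r] -> exists2 r', P ^+ k.+1 %| h.[r'] & P %| r' - r.
Proof.
move=> Pr; elim: k => [|k [x xP xr]]; first by exists r; rewrite ?expr1 // subrr dvdp0.
have Px : P %| h.[x] by apply: dvdp_trans xP; rewrite exprS dvdp_mulIl.
have cop : coprimep (h^`().[x]) P by rewrite coprimep_sym mirr_coprime // hsep.
have /Bezout_eq1_coprimepP[[u v] /= uv] := cop.
have /dvdpP[z zE] := xP.
pose d := - (z * u).
exists (x + d * P ^+ k.+1); last first.
  by rewrite addrAC dvdp_add // dvdp_mull // exprS dvdp_mulIl.
have [w ->] := horner_taylor2 h x (d * P ^+ k.+1).
have -> : h.[x] + h^`().[x] * (d * P ^+ k.+1) + w * (d * P ^+ k.+1) ^+ 2 =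
  P ^+ k.+2 * (z * v + w * d ^+ 2 * P ^+ k).
  have e1 : z = z * (u * h^`().[x] + v * P) by rewrite uv mulr1.
  rewrite zE {1}e1 /d !exprS; ring.
exact: dvdp_mulIl.
Qed.

Lemma rootP_stab r x k : P ^+ k.+1 %| h.[r] -> P %| h.[x] ->
  exists2 t, t \in s & P %| x - t.[r].
Proof.
move=> Pr Px; apply: (mirr_dvd_prod hP).
rewrite -(stab_horner hm h1 us ss sP); apply: dvdp_sub => //.
by apply: dvdp_trans Pr; rewrite exprS dvdp_mulIl.
Qed.

Lemma size_modP x : (size (x %% P)%R <= deg P)%N.
Proof. by rewrite -ltnS degS ?mirr_neq0 // ltn_modp mirr_neq0. Qed.

(** Once [h] has a root [r] modulo P, its roots are the t(r), and these are pairwise incongruent; so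
    residues can be traded for elements of [s]. *)
Lemma common_roots_stab r k a : P ^+ k.+1 %| h.[r] ->
  common_roots P a = count (fun t => P %| a.[t.[r]]) s.
Proof.
move=> Pr; have Pr1 : P %| h.[r] by apply: dvdp_trans Pr; rewrite exprS dvdp_mulIl.
pose g (t : {poly A}) := npolyp (deg P) (t.[r] %% P).
have gE t : polyn (g t) = t.[r] %% P by rewrite npolypK ?size_modP.
have gD t : P %| polyn (g t) - t.[r].
  rewrite gE {2}(divp_eq t.[r] P) opprD addrCA subrr addr0 -mulNr.
  exact: dvdp_mulIr.
have gi : {in s &, injective g}.
  move=> t t' ts ts' /(congr1 (@polyn _ _)); rewrite !gE => e'.
  apply/eqP; apply: contraLR isT => tt'.
  have := stab_distinct Pr1 ts ts' tt'; rewrite (_ : P %| _) //.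
  by rewrite /dvdp modpD modpN e' subrr.
rewrite -size_filter -(size_map g).
have um : uniq [seq g t | t <- s & P %| a.[t.[r]]].
  rewrite map_inj_in_uniq ?filter_uniq // => t t'.
  by rewrite !mem_filter => /andP[_ ?] /andP[_ ?]; apply: gi.
rewrite -(card_uniqP um); apply: eq_card => x; rewrite !inE.
have tr p y z : P %| y - z -> (P %| p.[y]) = (P %| p.[z]) :> bool.
  move=> /(@dvdp_horner_congr P p) dv.
  by rewrite -[p.[y]](subrK p.[z]) dvdp_addr.
apply/andP/mapP => [[hx ax]|[t]].
  have [t ts dv] := rootP_stab Pr hx; exists t.
    by rewrite mem_filter ts -(tr _ _ _ dv) ax.
  apply: val_inj; rewrite /= gE -[LHS](@modp_small _ _ P); last first.
    by rewrite -(degS (mirr_neq0 hP)) ltnS size_npoly.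
  by apply/eqP; rewrite -subr_eq0 -modpN -modpD; exact: dv.
rewrite mem_filter => /andP[at' ts] ->.
by rewrite !(tr _ _ _ (gD t)) at' stab_root.
Qed.

Lemma dvdp_prod_count (I : eqType) (r : seq I) (E : I -> A) :
  P ^+ count (fun i => P %| E i) r %| \prod_(i <- r) E i.
Proof.
elim: r => [|i r IH]; first by rewrite big_nil expr0 dvdpp.
rewrite big_cons /=; case: (boolP (P %| E i)) => [dv|_]; last by apply: dvdp_mull.
by rewrite exprS dvdp_mul.
Qed.

Lemma dvdp_prod_sqr (I : eqType) (r : seq I) (E : I -> A) : uniq r ->
  P ^+ 2 %| \prod_(i <- r) E i ->
  (exists i j, [/\ i \in r, j \in r, i != j, P %| E i & P %| E j]) \/
  (exists2 i, i \in r & P ^+ 2 %| E i).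
Proof.
elim: r => [|i r IH].
  rewrite big_nil dvdp1 => _ /eqP sz.
  by have := size_mirr_exp 2 hP; rewrite sz.
rewrite big_cons /= => /andP[ir ur] dv.
case: (boolP (P %| E i)) => [Pi|nPi]; last first.
  have : P ^+ 2 %| \prod_(j <- r) E j.
    by rewrite -(Gauss_dvdpr _ (q := E i)) // coprimep_expl // mirr_coprime.
  case/(IH ur) => [[j [k [jr kr jk Pj Pk]]]|[j jr Pj]].
    by left; exists j, k; rewrite !inE jr kr !orbT.
  by right; exists j => //; rewrite inE jr orbT.
case: (boolP (P %| \prod_(j <- r) E j)) => [|nP].
  case/(mirr_dvd_prod hP) => j jr Pj; left; exists i, j; rewrite !inE eqxx jr orbT; split=> //.
  by apply: contraNneq ir => ->.
right; exists i; rewrite ?mem_head //.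
by rewrite -(Gauss_dvdpl _ (q := \prod_(j <- r) E j)) // coprimep_expl // mirr_coprime.
Qed.

Lemma common_roots_le : (forall r : {poly_(deg P) F}, ~~ (P %| h.[polyn r])) -> forall a, common_roots P a = 0%N.
Proof. by move=> nr a; apply: eq_card0 => r; rewrite inE (negbTE (nr r)). Qed.

Lemma dvdp_exp_common_roots a : P ^+ common_roots P a %| stab_norm h s a.
Proof.
have [/existsP[r Pr]|/existsPn nr] :=
    boolP [exists r : {poly_(deg P) F}, P %| h.[polyn r]]; last first.
  by rewrite common_roots_le // expr0 dvd1p.
(* Precision P^(e+1) suffices: at most [e] factors of the product are counted, so the error k * h(x)
   in the norm is harmless. *)
have [x xP _] := hensel e Pr.
rewrite (common_roots_stab a xP); have [k ->] := stab_norm_horner hm h1 us ss sP a x.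
apply: dvdp_sub; first exact: dvdp_prod_count.
apply: dvdp_mull; apply: dvdp_trans xP; apply: dvdp_exp2l.
by apply: leq_trans (count_size _ _) _; rewrite ss /deg.
Qed.

Lemma in_lattice_XsubC (m x : A) (p : {poly A}) : m %| p.[x] -> in_lattice m ('X - x%:P) p.
Proof.
case/dvdpP=> w wE; have /factor_theorem[u uE] : root (p - p.[x]%:P) x.
  by rewrite rootE !hornerE subrr.
exists u, w%:P; rewrite -uE wE polyCM; ring.
Qed.

Lemma in_lattice_XsubC2 (x y : A) (p : {poly A}) : ~~ (P %| x - y) ->
  P %| p.[x] -> P %| p.[y] -> in_lattice P (('X - x%:P) * ('X - y%:P)) p.
Proof.
move=> xy px py; have /factor_theorem[u uE] : root (p - p.[x]%:P) x.
  by rewrite rootE !hornerE subrr.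
have pE : p = u * ('X - x%:P) + p.[x]%:P by rewrite -uE; ring.
have uy : P %| u.[y].
  have : P %| u.[y] * (x - y).
    have -> : u.[y] * (x - y) = p.[x] - p.[y] by rewrite {2}pE !hornerE; ring.
    exact: dvdp_sub.
  by case/(mirr_euclid hP)/orP => //; rewrite (negbTE xy).
have [u' [w' u'E]] := in_lattice_XsubC uy.
have /dvdpP[z zE] := px.
exists u', (w' * ('X - x%:P) + z%:P).
rewrite pE zE polyCM {1}u'E; ring.
Qed.

(* [B] lists lattices of index at least |P|^2, one of which contains [a] as soon
   as P divides N(a) to a higher power than the number of common roots. *)
Definition excess_lattices (B : seq (A * {poly A})) : Prop :=
  [/\ (size B <= e * e + e)%N,
    forall ml, ml \in B -> [/\ (exists k, ml.1 = P ^+ k), ml.2 \is monic, in_lattice ml.1 ml.2 h &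
       (2 * deg P <= deg ml.2 * deg ml.1)%N] &
    forall a, stab_norm h s a != 0 -> (vp P (stab_norm h s a) <= common_roots P a)%N \/
       exists2 ml, ml \in B & in_lattice ml.1 ml.2 a].

(** If the valuation exceeds the number of common roots, that number is positive, so P^2 divides the
    norm and hence the product of the a(t(x)). Either two factors are divisible by P, or one by P^2;
    the lattices list the e * e and [e] ways for this to happen. *)
Lemma excess_split r : P %| h.[r] -> exists B, excess_lattices B.
Proof.
move=> Pr; have [x xP _] := hensel 1 Pr.
have Px : P %| h.[x] by apply: dvdp_trans xP; rewrite exprS dvdp_mulIl.
pose B1 := [seq (P, ('X - w.1.[x]%:P) * ('X - w.2.[x]%:P)) | w <- [seq (t, t') | t <- s, t' <- s] & w.1 != w.2].
pose B2 := [seq (P ^+ 2, 'X - t.[x]%:P) | t <- s].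
exists (B1 ++ B2); split.
- rewrite size_cat !size_map leq_add //; last by rewrite ss.
  rewrite size_filter; apply: leq_trans (count_size _ _) _.
  by rewrite size_allpairs ss.
- move=> ml; rewrite mem_cat => /orP[/mapP[[t t']]|/mapP[t ts]->/=].
    rewrite mem_filter => /andP[/= tt' /allpairsP[[u u'] /= [us1 us2 [E1 E2]]]] -> /=.
    subst u u'; split.
    + by exists 1%N; rewrite expr1.
    + by rewrite monicMl ?monicXsubC.
    + by apply: in_lattice_XsubC2; rewrite ?stab_distinct ?stab_root.
    + rewrite degM ?polyXsubC_eq0 // leq_mul2r /deg !size_XsubC.
      by rewrite orbT.
  split.
  + by exists 2%N.
  + exact: monicXsubC.
  + by apply: in_lattice_XsubC; rewrite stab_root.
  + by rewrite {2}/deg size_XsubC mul1n deg_exp mulnC.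
move=> a n0; have [k nE] := stab_norm_horner hm h1 us ss sP a x.
case: (leqP (vp P (stab_norm h s a)) (common_roots P a)) => [|lt]; [by left | right].
have P1 : P %| stab_norm h s a by rewrite -vp_gt0 //; apply: leq_ltn_trans lt.
have Pprod j : (j <= 2)%N -> P ^+ j %| stab_norm h s a -> P ^+ j %| \prod_(t <- s) a.[t.[x]].
  move=> j2; rewrite nE => dv; rewrite -[\prod_(_ <- _) _](subrK (k * h.[x])) dvdp_add //.
  by apply: dvdp_mull; apply: dvdp_trans xP; apply: dvdp_exp2l.
have c1 : (0 < common_roots P a)%N.
  rewrite (common_roots_stab a xP) -has_count; apply/hasP.
  by apply: (mirr_dvd_prod hP); have := Pprod 1%N isT; rewrite expr1; apply.
have P2 : P ^+ 2 %| stab_norm h s a by rewrite dvdp_exp_vp // (leq_trans _ lt).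
have [[t [t' [ts ts' tt' Pt Pt']]]|[t ts Pt]] := dvdp_prod_sqr us (Pprod 2%N isT P2).
  exists (P, ('X - t.[x]%:P) * ('X - t'.[x]%:P)).
    rewrite mem_cat; apply/orP; left; apply/mapP; exists (t, t') => //.
    by rewrite mem_filter /= tt'; apply/allpairsP; exists (t, t').
  by apply: in_lattice_XsubC2; rewrite ?stab_distinct.
exists (P ^+ 2, 'X - t.[x]%:P).
  by rewrite mem_cat; apply/orP; right; apply/mapP; exists t.
exact: in_lattice_XsubC.
Qed.

(** Without roots, every irreducible factor of [h] mod P has degree at least 2. If P divides the
    norm, such a factor [l] divides some a(t(X)) mod P, so [a] lies in the lattice of a lift of [l]
    transported by the inverse of t. *)
Lemma excess_nonsplit : (forall r, ~~ (P %| h.[r])) -> exists B, excess_lattices B.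
Proof.
move=> nr; have [K [pi [lift [piK pi0 lift0 lift1]]]] := residue_field hP.
have mapK (p : {poly K}) : map_poly pi (map_poly lift p) = p.
  by apply/polyP => i; rewrite coef_map coef_map_id0 //; apply: piK.
have map0 (p : {poly A}) : map_poly pi p = 0 -> exists w, p = P%:P * w.
  move=> p0; exists (map_poly (fun x => x %/ P) p); apply/polyP => i.
  rewrite coefCM coef_map_id0 ?div0p // mulrC divpK // -pi0 -coef_map p0 coef0.
  by rewrite eqxx.
pose hb := map_poly pi h.
have hb1 : (1 < size hb)%N by rewrite size_map_poly_id0 // (eqP hm) rmorph1 oner_neq0.
have [l hl lh] := mirr_dvd_exists hb1.
pose L := map_poly lift l : {poly A}.
have l0 := mirr_neq0 hl.
have Lsize : size L = size l.
  by rewrite size_map_poly_id0 // (eqP (mirr_monic hl)) lift1 oner_neq0.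
have Lm : L \is monic.
  by rewrite monicE /lead_coef Lsize coef_map_id0 // -/(lead_coef l) (eqP (mirr_monic hl)) lift1.
have inLP p : l %| map_poly pi p -> in_lattice P L p.
  move=> /dvdpP[u uE]; have [|w wE] := map0 (p - map_poly lift u * L).
    by rewrite rmorphB rmorphM /= !mapK uE subrr.
  by exists (map_poly lift u), w; rewrite -wE; ring.
have l2 : (2 <= deg l)%N.
  rewrite leqNgt; apply/negP => dl; have dl1 : size l = 2%N.
    by move: dl (mirr_size hl); rewrite /deg; move: (size l) => x; lia.
  have [r rr] := poly2_root dl1.
  have : root hb r by case/dvdpP: lh => u ->; rewrite rootM rr orbT.
  by rewrite rootE -(piK r) horner_map pi0 (negbTE (nr _)).
(* Leading coefficients of symmetries are roots of unity, so the transported lift can be made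
   monic. *)
have lead_unit u : u \in s -> lead_coef (L \Po u) \is a GRing.unit.
  move=> us'; rewrite lead_coef_comp ?(stab_size hm h1 us ss sP us') // (eqP Lm) mul1r unitrX //.
  have e0 : (0 < (size h).-1)%N by move: h1; move: (size h) => x; lia.
  by rewrite -(unitrX_pos _ e0) (stab_lead hm h1 us ss sP us') unitr1.
pose Lu u := (lead_coef (L \Po u))^-1 *: (L \Po u).
have inLu u t p : u \in s -> t \Po u = 'X -> in_lattice P L (p \Po t) -> in_lattice P (Lu u) p.
  move=> us' tu [w [v pE]]; exists ((w \Po u) * (lead_coef (L \Po u))%:P), (v \Po u).
  have -> : p = ((p \Po t) \Po u) by rewrite -comp_polyA tu comp_polyXr.
  rewrite pE rmorphD !rmorphM /= comp_polyC; congr (_ + _).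
  by rewrite -mulrA mul_polyC scalerA divrr ?lead_unit // scale1r.
have PL : in_lattice P L h by apply: inLP.
exists [seq (P, Lu u) | u <- s]; split.
- by rewrite size_map ss leq_addl.
- move=> _ /mapP[u us' ->] /=; split.
  + by exists 1%N; rewrite expr1.
  + by rewrite monicE lead_coefZ mulVr // lead_unit.
  + have [t ts [tu ut]] := stab_inv hm h1 us ss sP us'.
    by apply: (inLu u t) => //; rewrite sP.
  + rewrite leq_mul2r; apply/orP; right; apply: leq_trans l2 _.
    have c0 : (lead_coef (L \Po u))^-1 != 0.
      by apply: contraTneq (lead_unit u us') => z; rewrite -unitrV z unitr0.
    by rewrite /deg size_scale // size_comp_poly2 ?Lsize // (stab_size hm h1 us ss sP us').
move=> a n0; case: (boolP (P %| stab_norm h s a)) => [Pn|nPn]; last first.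
  by left; rewrite leqNgt; apply: contra nPn => lt; rewrite -vp_gt0 // (leq_ltn_trans _ lt).
right; have : l %| \prod_(t <- s) map_poly pi (a \Po t).
  rewrite -rmorph_prod -/(nprod s a) (stab_normE hm h1 us ss sP a) rmorphD rmorphM /= map_polyC /=.
  have -> : pi (stab_norm h s a) = 0 by apply/eqP; rewrite pi0.
  by rewrite addr0 dvdp_mull.
case/(mirr_dvd_prod hl) => t ts lt; have [u us' [ut tu]] := stab_inv hm h1 us ss sP ts.
exists (P, Lu u); first by apply/mapP; exists u.
by apply: (inLu u t) => //; apply: inLP.
Qed.

Lemma excess_exists : exists B, excess_lattices B.
Proof.
have [[r Pr]|nr] := pselect (exists r, P %| h.[r]); first exact: excess_split Pr.
by apply: excess_nonsplit => r; apply/negP => Pr; apply: nr; exists r.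
Qed.

Lemma nroots_le : (nroots P <= e)%N.
Proof.
have [/existsP[r Pr]|/existsPn nr] :=
    boolP [exists r : {poly_(deg P) F}, P %| h.[polyn r]].
  have [x xP _] := hensel 0 Pr.
  have -> : nroots P = common_roots P 0.
    by apply: eq_card => y; rewrite !inE horner0 dvdp0 andbT.
  by rewrite (common_roots_stab 0 xP); apply: leq_trans (count_size _ _) _; rewrite ss.
by rewrite /nroots eq_card0 // => r; rewrite inE; apply: negbTE.
Qed.

End LocalNorm.

(** * Sums over irreducible polynomials *)

Section PrimeSums.
Variable F : finFieldType.
Local Notation q := #|F|.

Definition irreds (n : nat) : seq {poly F} :=
  [seq polyn u | u <- enum [pred u : {poly_n.+1 F} | mirr (polyn u)]].

Lemma irreds_uniq n : uniq (irreds n).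
Proof. by rewrite map_inj_uniq ?enum_uniq //; apply: val_inj. Qed.

Lemma mem_irreds n P : (P \in irreds n) = mirr P && (deg P <= n)%N.
Proof.
apply/mapP/andP => [[u]|[hP dP]].
  rewrite mem_enum inE => hu ->; split=> //.
  by rewrite -ltnS degS ?mirr_neq0 // size_npoly.
have sP : (size P <= n.+1)%N by rewrite -degS ?mirr_neq0.
by exists (NPoly sP); rewrite // mem_enum inE.
Qed.

Lemma irreds_le n N : (n <= N)%N -> perm_eq [seq P <- irreds N | (deg P <= n)%N] (irreds n).
Proof.
move=> nN; apply: uniq_perm; rewrite ?filter_uniq ?irreds_uniq // => P.
rewrite mem_filter !mem_irreds; apply/andP/andP => [[dn /andP[hP _]]|[hP dn]] //.
by split=> //; rewrite hP (leq_trans dn).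
Qed.

Lemma big_irreds_le (V : nmodType) n N (E : {poly F} -> V) (C : pred {poly F}) : (n <= N)%N ->
  \sum_(P <- irreds n | C P) E P = \sum_(P <- irreds N | C P && (deg P <= n)%N) E P.
Proof.
move=> nN; rewrite -(perm_big _ (irreds_le nN)) big_filter_cond.
by apply: eq_bigl => P; rewrite andbC.
Qed.

Lemma sum_irreds (n : nat) (G : {poly F} -> nat) :
  (\sum_(P : {poly_n.+1 F} | mirr (polyn P)) G (polyn P) = \sum_(P <- irreds n) G P)%N.
Proof. by rewrite big_map big_enum. Qed.

Lemma deg_sum_irreds a N : a != 0 -> (deg a <= N)%N ->
  deg a = (\sum_(P <- irreds N) deg P * vp P a)%N.
Proof. by move=> a0 aN; rewrite (deg_sum_vp a0 aN) -sum_irreds. Qed.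

Definition pc N D := count (fun P => deg P == D) (irreds N).

Lemma pc_deg_le N D : (D * pc N D <= q ^ D)%N.
Proof.
apply: leq_trans (sum_mirr_deg_le F D N.+1); rewrite sum_nat_const mulnC leq_mul2r.
apply/orP; right; rewrite /pc /irreds count_map -size_filter cardE.
rewrite /enum_mem -filter_predI !size_filter; apply: eq_leq; apply: eq_count => u.
by rewrite !inE andbC.
Qed.

Lemma pc_le N D : (pc N D <= q ^ D)%N.
Proof.
case: D => [|D]; last by apply: leq_trans (pc_deg_le N _); rewrite mulSn leq_addr.
rewrite /pc (@eq_in_count _ _ pred0) ?count_pred0 // => P.
by rewrite mem_irreds => /andP[/mirr_deg]; case: (deg P).
Qed.

Variable R : realType.

Lemma sum_irreds_deg N (C : pred nat) (G : nat -> R) :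
  \sum_(P <- irreds N | C (deg P)) G (deg P) = \sum_(0 <= D < N.+1 | C D) (pc N D)%:R * G D.
Proof.
have e1 D : (pc N D)%:R * G D = \sum_(P <- irreds N) (if deg P == D then G D else 0).
  by rewrite -big_mkcond /= big_const_seq /pc iter_addr addr0 mulr_natl.
under [RHS]eq_bigr do rewrite e1.
rewrite exchange_big /= [LHS]big_mkcond /=; rewrite big_seq [RHS]big_seq.
apply: eq_bigr => P; rewrite mem_irreds => /andP[_ dP].
rewrite -big_mkcondr /= (big_mkcond (fun i => C i && _)) /=.
rewrite (bigD1_seq (deg P)) ?iota_uniq ?mem_index_iota ?ltnS //= eqxx andbT big1 ?addr0 // => D ne.
by rewrite eq_sym (negbTE ne) andbF.
Qed.

Variable Q : R.
Hypothesis QE : Q = q%:R.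

Let Q2 : 2 <= Q.
Proof. by rewrite QE ler_nat; exact: card_finNzRing_gt1. Qed.

Lemma geo_sum_le N : \sum_(0 <= D < N.+1) Q ^+ D <= 2 * Q ^+ N.
Proof.
elim: N => [|N IH]; first by rewrite big_nat1 expr0; lra.
rewrite big_nat_recr //=; apply: le_trans (lerD IH (lexx _)) _.
have q2 := Q2; have Q0 : 0 <= Q ^+ N by rewrite exprn_ge0 //; lra.
by rewrite exprS; move: (Q ^+ N) Q0 => y y0; nra.
Qed.

Lemma geo_tail_le N D0 : \sum_(0 <= D < N.+1 | (D0 <= D)%N) Q ^- D <= 2 * Q ^- D0.
Proof.
have q2 := Q2; have Q0 : 0 < Q by lra.
(* The subtracted term makes the induction telescope; [maxn] covers [k] below D0, where the sum is
   empty. *)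
suff h : forall k, \sum_(0 <= D < k | (D0 <= D)%N) Q ^- D <= 2 * Q ^- D0 - 2 * Q ^- maxn D0 k.
  apply: le_trans (h N.+1) _; rewrite lerBlDr lerDl mulr_ge0 // invr_ge0 exprn_ge0 //; lra.
elim=> [|k IH]; first by rewrite big_nil maxn0 subrr.
rewrite big_mkcond big_nat_recr //= -big_mkcond /=; case: leqP => [le|lt] /=.
  rewrite (maxn_idPr le) in IH; apply: le_trans (lerD IH (lexx _)) _.
  rewrite (maxn_idPr _) ?(leq_trans le) //.
  have -> : Q ^- k = Q ^- k.+1 * Q by rewrite exprS invfM mulrAC mulVf ?mul1r // gt_eqF.
  have : 0 <= Q ^- k.+1 by rewrite invr_ge0 exprn_ge0 //; lra.
  by nra.
by rewrite (maxn_idPl lt) addr0; rewrite (maxn_idPl (ltnW lt)) in IH.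
Qed.

Lemma sum_irreds_deg_le N : \sum_(P <- irreds N) (deg P)%:R <= 2 * Q ^+ N.
Proof.
apply: le_trans (geo_sum_le N); rewrite (sum_irreds_deg N predT (fun D => D%:R)).
apply: ler_sum => D _; rewrite mulrC -natrM QE -natrX ler_nat; exact: pc_deg_le.
Qed.

Lemma size_irreds_le N : (size (irreds N))%:R <= 2 * Q ^+ N.
Proof.
apply: le_trans (geo_sum_le N).
have -> : (size (irreds N))%:R = \sum_(P <- irreds N | predT (deg P)) (1 : R).
  by rewrite big_const_seq count_predT iter_addr addr0.
rewrite (sum_irreds_deg N predT (fun=> 1)).
apply: ler_sum => D _; rewrite mulr1 QE -natrX ler_nat; exact: pc_le.
Qed.

Lemma sum_irreds_tail N D0 :
  \sum_(P <- irreds N | (D0 <= deg P)%N) Q ^- (2 * deg P) <= 2 * Q ^- D0.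
Proof.
apply: le_trans (geo_tail_le N D0).
rewrite (sum_irreds_deg N (fun D => D0 <= D)%N (fun D => Q ^- (2 * D))).
have q2 := Q2; have Q0 : 0 < Q by lra.
apply: ler_sum => D _; rewrite mul2n -addnn exprD invfM mulrA.
apply: ler_piMl; first by rewrite invr_ge0 exprn_ge0 // ltW.
by rewrite ler_pdivrMr ?exprn_gt0 // mul1r QE -natrX ler_nat pc_le.
Qed.

(** A Chebyshev bound: primes of degree above N/2 are weighted by 2 deg P, which is at least N, and
    the others are few. *)
Lemma size_irreds_small N : N%:R * (size (irreds N))%:R <= 4 * Q ^+ N + N%:R * (2 * Q ^+ N./2).
Proof.
have q2 := Q2; have Q0 : 0 < Q by lra.
have -> : (size (irreds N))%:R = \sum_(P <- irreds N | predT P) (1 : R).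
  by rewrite big_const_seq count_predT iter_addr addr0.
rewrite (bigID (fun P : {poly F} => (deg P <= N./2)%N)) /= mulrDr addrC; apply: lerD.
  apply: le_trans (_ : \sum_(P <- irreds N | ~~ (deg P <= N./2)%N) 2 * (deg P)%:R <= _).
    rewrite mulr_sumr; apply: ler_sum => P; rewrite -ltnNge => lt.
    rewrite mulr1 -[2]/(2%:R) -natrM ler_nat; have := odd_double_half N.
    by rewrite -addnn; lia.
  rewrite -mulr_sumr -[4]/(4%:R) (_ : 4%:R = 2 * 2 :> R) -?mulrA; last by rewrite -natrM.
  apply: ler_wpM2l => //; apply: le_trans (sum_irreds_deg_le N).
  by rewrite big_mkcond /=; apply: ler_sum => P _; case: ifP.
apply: ler_wpM2l => //; apply: le_trans (size_irreds_le N./2).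
have h2 : (N./2 <= N)%N by have := odd_double_half N; rewrite -addnn; lia.
have := big_irreds_le (fun=> 1 : R) predT h2; rewrite /= => <-.
by rewrite big_const_seq count_predT iter_addr addr0.
Qed.

End PrimeSums.

(** * The Mertens estimate *)

Section Mertens.
Variables (F : finFieldType) (R : realType).
Local Notation A := {poly F}.
Local Notation q := #|F|.

Definition mertens_sum (h : {poly A}) (M : A) (n : nat) : R :=
  \sum_(P <- irreds F n | ~~ (P %| M)) (deg P * nroots h P)%:R / q%:R ^+ deg P.

Variables (h : {poly A}) (s : seq {poly A}).
Hypotheses (hm : h \is monic) (h1 : (1 < size h)%N) (us : uniq s).
Hypotheses (ss : size s = (size h).-1).
Hypothesis (sP : forall t, t \in s -> h \Po t = h).
Hypothesis (irr : irreducible_poly h).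
Local Notation e := (deg h).
Variable c : nat.
Hypothesis (hc : wdeg_lt c (c * e).+1 h).
Hypothesis (ht : forall t, t \in s -> wdeg_lt c c.+1 t).
Variables (M : A) (D0 : nat).
Hypothesis M0 : M != 0.
Hypothesis hsep : forall P, mirr P -> ~~ (P %| M) -> sep h P.
Hypothesis hD0 : forall P, mirr P -> ~~ (P %| M) -> (D0 <= deg P)%N.
Variable mu : nat.
Hypothesis mu0 : (0 < mu)%N.

Variable Q : R.
Hypothesis QE : Q = q%:R.

Let Q1 : 1 < Q.
Proof. by rewrite QE ltr1n; exact: card_finNzRing_gt1. Qed.

Let Q0 : 0 < Q.
Proof. exact: lt_trans Q1. Qed.

(** The exponent [m] makes the constant 1 + M T^m, of degree [m0], outweigh M b even after the
    weight c * e of X^e is counted; the norms then have degree [E]. [E'] bounds the exponent of the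
    index of a lattice that contains a test element, and [C2] is the bounded term of
    [card_lattice_small]. *)
Local Notation C0 := (2 * (c * e))%N.
Local Notation C2 := (e * C0.+1)%N.
Local Notation m := (mu + c * e)%N.
Local Notation m0 := (mu + c * e + deg M)%N.
Local Notation E := (e * (mu + c * e + deg M))%N.
Local Notation E' := (e * ((mu + c * e + deg M).+1 + C0))%N.
Local Notation Bt := {ffun 'I_e -> {poly_mu F}}.

(* Test elements: congruent to 1 mod [M], with norm of degree [E] for every [b]. *)
Definition test_elt (b : Bt) : {poly A} := (1 + M * 'X^m)%:P + M%:P * box_poly b.

Let e0 : (0 < e)%N.
Proof. by rewrite /deg; move: h1; move: (size h) => x; lia. Qed.

Lemma size_al0 : size (1 + M * 'X^m) = m0.+1.
Proof.
have sM : size (M * 'X^m) = m0.+1.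
  by rewrite size_mulXn // -(degS M0) addnS.
by rewrite addrC size_polyDl sM // size_poly1; lia.
Qed.

Lemma size_coef_MB (b : Bt) i : (size ((M%:P * box_poly b)`_i)%R <= mu + deg M)%N.
Proof.
rewrite coefCM; apply: leq_trans (size_polyMleq _ _) _.
have := size_coef_box b i; rewrite -(degS M0) addSn /=.
by move: (size _) (deg M) => x y; lia.
Qed.

Lemma size_stab_norm_test_elt b : size (stab_norm h s (test_elt b)) = E.+1.
Proof.
apply: (stab_norm_size hm h1 us ss hc) => //; first exact: size_al0.
apply: (wdeg_lt_small (size_coef_MB b)) => i.
rewrite mul_polyC => /leq_trans/(_ (size_scale_leq _ _))/leq_trans/(_ (size_box b)) ie.
have : (c * i <= c * e)%N by rewrite leq_mul2l (ltnW ie) orbT.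
by move: (c * i)%N (c * e)%N => x y; lia.
Qed.

Lemma stab_norm_test_elt_neq0 b : stab_norm h s (test_elt b) != 0.
Proof. by rewrite -size_poly_gt0 size_stab_norm_test_elt. Qed.

Lemma deg_stab_norm_test_elt b : deg (stab_norm h s (test_elt b)) = E.
Proof. by rewrite /deg size_stab_norm_test_elt. Qed.

Lemma test_elt_neq0 b : test_elt b != 0.
Proof.
apply: contraNneq (stab_norm_test_elt_neq0 b) => ->; apply/eqP; rewrite /stab_norm /nprod.
rewrite (big_rem 'X) ?(stab_X hm h1 us ss sP) //=.
by rewrite comp_poly0 mul0r Pdiv.CommonRing.rmod0p coef0.
Qed.

Lemma size_test_elt b : (size (test_elt b) <= e)%N.
Proof.
apply: leq_trans (size_polyD _ _) _; rewrite geq_max; apply/andP; split.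
  by apply: leq_trans (size_polyC_leq1 _) e0.
by rewrite mul_polyC; apply: leq_trans (size_scale_leq _ _) (size_box b).
Qed.

Lemma size_coef_test_elt b i : (size ((test_elt b)`_i)%R <= m0.+1)%N.
Proof.
rewrite coefD; apply: leq_trans (size_polyD _ _) _; rewrite geq_max; apply/andP; split.
  by rewrite coefC; case: eqP => _; rewrite ?size_al0 ?size_poly0.
by apply: leq_trans (size_coef_MB b i) _; lia.
Qed.

Lemma stab_norm_test_elt_coprime P b : mirr P -> P %| M -> ~~ (P %| stab_norm h s (test_elt b)).
Proof.
move=> hP PM; have alE : test_elt b = 1 + M%:P * ('X^m%:P + box_poly b).
  by rewrite /test_elt polyCD polyCM polyC1; ring.
have [Z ZE] : exists Z, nprod s (test_elt b) = 1 + M%:P * Z.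
  rewrite /nprod; elim: (s) => [|t s' [Z IH]]; first by exists 0; rewrite big_nil; ring.
  rewrite big_cons IH alE rmorphD rmorphM /= rmorph1 comp_polyC.
  set Y := (_ \Po t); exists (Y + Z + M%:P * Y * Z); ring.
have nE : stab_norm h s (test_elt b) = 1 + M * (Pdiv.CommonRing.rmodp Z h)`_0.
  rewrite /stab_norm ZE Pdiv.RingMonic.rmodpD // Pdiv.CommonRing.rmodp_small ?size_poly1 //.
  by rewrite mul_polyC Pdiv.RingMonic.rmodpZ // coefD coefZ coef1.
rewrite nE dvdp_addl; last exact: dvdp_mulr.
by rewrite dvdp1 neq_ltn (mirr_size hP) orbT.
Qed.

Lemma coprime_MP P k : mirr P -> ~~ (P %| M) -> coprimep M (P ^+ k).
Proof. by move=> hP nP; rewrite coprimep_sym coprimep_expl // mirr_coprime. Qed.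

Lemma in_lattice_root P r (a : {poly A}) : (P %| a.[r]) = `[< in_lattice P ('X - r%:P) a >].
Proof.
apply/idP/asboolP => [|[u [w ->]]]; first exact: in_lattice_XsubC.
by rewrite !hornerE subrr mulr0 add0r dvdp_mulIl.
Qed.

Lemma sum_common_roots P : (\sum_(b : Bt) common_roots h P (test_elt b) =
  \sum_(r : {poly_(deg P) F} | (P %| h.[polyn r])%R)
     #|[pred b : Bt | `[< in_lattice P ('X - (polyn r)%:P) (test_elt b) >]]|)%N.
Proof.
under eq_bigr do rewrite /common_roots -sum1_card big_mkcondr /=.
rewrite exchange_big /=; apply: eq_bigr => r _.
by rewrite -big_mkcond /= sum1_card; apply: eq_card => b; rewrite [RHS]inE -in_lattice_root.
Qed.

Lemma nrootsE P : nroots h P = (\sum_(r : {poly_(deg P) F} | (P %| h.[polyn r])%R) 1)%N.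
Proof. by rewrite sum1_card; apply: eq_card => r; rewrite !inE. Qed.

(** For each root r of [h] mod P, the condition on b is membership in the lattice (P, X - r) of
    index |P|, and P is small enough for exact counting. *)
Lemma sum_common_roots_exact P : mirr P -> ~~ (P %| M) -> (deg P < e * (mu - C0))%N ->
  (\sum_(b : Bt) common_roots h P (test_elt b) * q ^ deg P = nroots h P * q ^ (e * mu))%N.
Proof.
move=> hP nP lt; rewrite -big_distrl /= sum_common_roots big_distrl /= nrootsE big_distrl /=.
apply: eq_bigr => r Pr.
have d1 : (deg ('X - (polyn r)%:P)%R * deg P = deg P)%N by rewrite {1}/deg size_XsubC mul1n.
rewrite mul1n.
have := card_lattice hm h1 us ss sP irr erefl hc (1 + M * 'X^m)%:P (mirr_neq0 hP) (monicXsubC (polyn r)) _ _ _.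
rewrite d1; apply=> //; first exact: in_lattice_XsubC.
by have := coprime_MP 1 hP nP; rewrite expr1.
Qed.

Lemma sum_common_roots_small P : mirr P -> ~~ (P %| M) -> (e * (mu - C0) <= deg P)%N ->
  (\sum_(b : Bt) common_roots h P (test_elt b) <= e * q ^ C2)%N.
Proof.
move=> hP nP le; rewrite sum_common_roots.
apply: leq_trans (_ : nroots h P * q ^ C2 <= _)%N; last first.
  by rewrite leq_mul2r (nroots_le hm h1 us ss sP hP (hsep hP nP)) orbT.
rewrite nrootsE big_distrl /=; apply: leq_sum => r Pr; rewrite mul1n.
have d1 : (deg ('X - (polyn r)%:P)%R * deg P = deg P)%N by rewrite {1}/deg size_XsubC mul1n.
apply: (card_lattice_small hm h1 us ss sP irr erefl hc _ (mirr_neq0 hP) (monicXsubC (polyn r))) => //.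
- exact: in_lattice_XsubC.
- by have := coprime_MP 1 hP nP; rewrite expr1.
- by rewrite d1.
Qed.

Definition exc P (b : Bt) : nat :=
  (deg P * vp P (stab_norm h s (test_elt b)) - deg P * common_roots h P (test_elt b))%N.

Lemma vp_deg_le P b : mirr P -> (deg P * vp P (stab_norm h s (test_elt b)) <= E)%N.
Proof.
move=> hP; rewrite -deg_exp -(deg_stab_norm_test_elt b); have n0 := stab_norm_test_elt_neq0 b.
have : P ^+ vp P (stab_norm h s (test_elt b)) %| stab_norm h s (test_elt b) by rewrite dvdp_exp_vp.
by move/(dvdp_leq n0); rewrite /deg; move: (size _) (size _) => x y; lia.
Qed.

Lemma card_lattice_le (mm : A) l a0 D : mm != 0 -> l \is monic -> in_lattice mm l h -> coprimep M mm ->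
  (2 * D <= deg l * deg mm)%N ->
  #|[pred b : Bt | `[< in_lattice mm l (a0 + M%:P * box_poly b) >]]|%:R <=
    Q ^+ (e * mu) * Q ^- (2 * D) + Q ^+ C2.
Proof.
move=> mm0 lm hL cop le.
have p1 : 0 <= Q ^+ (e * mu) * Q ^- (2 * D).
  by rewrite mulr_ge0 // ?invr_ge0 exprn_ge0 // ltW.
have p2 : 0 <= Q ^+ C2 by rewrite exprn_ge0 // ltW.
have [lt|ge] := ltnP (deg l * deg mm) (e * (mu - C0)); last first.
  rewrite -[leLHS]add0r lerD // QE -natrX ler_nat.
  exact: (card_lattice_small hm h1 us ss sP irr erefl hc).
have /(congr1 (fun k => k%:R : R)) := card_lattice hm h1 us ss sP irr erefl hc a0 mm0 lm hL cop lt.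
rewrite natrM !natrX -QE => cE; rewrite -[leLHS]addr0 lerD //.
rewrite -cE -mulrA ler_peMr // ler_pdivlMr ?exprn_gt0 // mul1r.
by apply: ler_weXn2l => //; apply: ltW.
Qed.

(** Excess, at most [E], occurs only for test elements in one of the lattices of index at least
    |P|^2. When 2 deg P exceeds [E'] no such lattice contains a test element, by [lattice_index_le];
    this halves the degree range over which the bounded term is summed. *)
Lemma excess_sum P : mirr P -> ~~ (P %| M) ->
  (\sum_(b : Bt) exc P b)%:R <=
  if (2 * deg P <= E')%N then
    E%:R * ((e * e + e)%:R * (Q ^+ (e * mu) * Q ^- (2 * deg P) + Q ^+ C2))
  else 0.
Proof.
move=> hP nP; have [B [sB BP Bx]] := excess_exists hm h1 us ss sP hP (hsep hP nP).
pose X (b : Bt) := has (fun ml => `[< in_lattice ml.1 ml.2 (test_elt b) >]) B.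
have excX b : (exc P b <= E * X b)%N.
  have [le|[ml mlB ain]] := Bx _ (stab_norm_test_elt_neq0 b).
    by rewrite /exc (eqP (_ : _ - _ == 0)%N) // subn_eq0 leq_mul2l le orbT.
  have -> : X b = true by apply/hasP; exists ml => //; apply/asboolP.
  by rewrite muln1; apply: leq_trans (leq_subr _ _) (vp_deg_le b hP).
have mlP ml : ml \in B -> [/\ ml.1 != 0, ml.2 \is monic, in_lattice ml.1 ml.2 h, coprimep M ml.1 &
    (2 * deg P <= deg ml.2 * deg ml.1)%N].
  move=> /BP[[k ->] lm hL le]; split=> //; first by rewrite expf_neq0 // mirr_neq0.
  exact: coprime_MP.
case: leqP => [le|lt]; last first.
  rewrite big1 ?mulr0n // => b _; apply/eqP; rewrite -leqn0; apply: leq_trans (excX b) _.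
  rewrite leqn0 muln_eq0; apply/orP; right; rewrite eqb0; apply/hasPn => ml mlB.
  apply/asboolP => ain; have [m'0 lm hL cop le] := mlP ml mlB.
  have := lattice_index_le hm h1 us ss sP irr erefl hc m'0 lm hL ain (test_elt_neq0 b) (size_test_elt b) (size_coef_test_elt b).
  by move: lt le; move: (deg ml.2 * deg ml.1)%N => x; lia.
apply: le_trans (_ : (E * \sum_(ml <- B) #|[pred b : Bt | `[< in_lattice ml.1 ml.2 (test_elt b) >]]|)%:R <= _).
  rewrite ler_nat; apply: leq_trans (leq_sum _ (fun b _ => excX b)) _.
  rewrite -big_distrr leq_mul2l; apply/orP; right.
  apply: leq_trans (_ : \sum_(b : Bt) \sum_(ml <- B) (`[< in_lattice ml.1 ml.2 (test_elt b) >] : nat) <= _)%N.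
    apply: leq_sum => b _; rewrite /X; elim: (B) => [|ml B' IH] /=; first by rewrite big_nil.
    by rewrite big_cons; case: `[< _ >].
  rewrite exchange_big; apply: leq_sum => ml _; apply: eq_leq.
  by rewrite -sum1_card [RHS]big_mkcond /=; apply: eq_bigr => b _; rewrite inE; case: `[< _ >].
rewrite natrM ler_wpM2l // natr_sum.
apply: le_trans (_ : (size B)%:R * (Q ^+ (e * mu) * Q ^- (2 * deg P) + Q ^+ C2) <= _).
  rewrite -[(size B)%:R](_ : \sum_(ml <- B) 1 = _); last first.
    by rewrite big_const_seq count_predT iter_addr addr0.
  rewrite big_distrl /= big_seq [leRHS]big_seq; apply: ler_sum => ml mlB; rewrite mul1r.
  have [m'0 lm hL cop le'] := mlP ml mlB.
  exact: card_lattice_le.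
apply: ler_wpM2r; last by rewrite ler_nat.
by rewrite addr_ge0 // ?mulr_ge0 // ?invr_ge0 exprn_ge0 // ltW.
Qed.

Lemma E_sum (b : Bt) : E = (\sum_(P <- irreds F E | ~~ (P %| M)%R) deg P * vp P (stab_norm h s (test_elt b)))%N.
Proof.
rewrite -{1}(deg_stab_norm_test_elt b) (deg_sum_irreds (stab_norm_test_elt_neq0 b) (eq_leq (deg_stab_norm_test_elt b))).
rewrite (bigID (fun P => P %| M)) /= big_seq_cond big1 ?add0n // => P /andP[].
rewrite mem_irreds => /andP[hP _] PM; apply/eqP; rewrite muln_eq0; apply/orP; right.
by rewrite -leqn0 leqNgt vp_gt0 ?stab_norm_test_elt_neq0 // stab_norm_test_elt_coprime.
Qed.

Lemma card_Bt : (#|Bt|)%:R = Q ^+ (e * mu) :> R.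
Proof. by rewrite card_box natrX QE. Qed.

(** Each norm has degree [E] and contains P at least as often as it has common roots; for deg P <= n
    their number averages to exactly rho_h(P) / |P|. *)
Lemma mertens_upper n : (n < e * (mu - C0))%N -> mertens_sum h M n <= E%:R.
Proof.
move=> lt; have nE : (n <= E)%N.
  by apply: leq_trans (ltnW lt) _; rewrite leq_mul2l; apply/orP; right; lia.
have Qp : 0 < Q ^+ (e * mu) by rewrite exprn_gt0.
rewrite -(ler_pM2r Qp) -{2}card_Bt -natrM /mertens_sum -QE big_distrl /=.
apply: le_trans (_ : (\sum_(P <- irreds F n | ~~ (P %| M)%R) deg P * \sum_(b : Bt) common_roots h P (test_elt b))%N%:R <= _).
  rewrite natr_sum big_seq_cond [leRHS]big_seq_cond; apply: ler_sum => P /andP[].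
  rewrite mem_irreds => /andP[hP dP] nP.
  have /(congr1 (fun k => k%:R : R)) := sum_common_roots_exact hP nP (leq_ltn_trans dP lt).
  rewrite -big_distrl /= !natrM !natrX -QE => cE.
  have -> : (\sum_(b : Bt) common_roots h P (test_elt b))%:R = (nroots h P)%:R * Q ^+ (e * mu) / Q ^+ deg P.
    by rewrite -cE mulfK // expf_neq0 // gt_eqF.
  by rewrite !mulrA mulrAC.
rewrite ler_nat mulnC -sum_nat_const.
rewrite (eq_bigr _ (fun b _ => E_sum b)) exchange_big /= (big_irreds_le _ _ nE).
rewrite big_mkcondr /= big_seq_cond [leqRHS]big_seq_cond; apply: leq_sum => P /andP[].
rewrite mem_irreds => /andP[hP _] nP; case: ifP => // _.
rewrite big_distrr /=; apply: leq_sum => b _; rewrite leq_mul2l; apply/orP; right.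
by rewrite -dvdp_exp_vp ?stab_norm_test_elt_neq0 // (dvdp_exp_common_roots hm h1 us ss sP hP (hsep hP nP)).
Qed.

(** The second term collects the common roots at primes beyond the exact range, each P being met at
    most e * q^C2 times. The third is the excess, which splits into a tail of the sum of |P|^(-2)
    from degree D0 on and a bounded amount for each prime of degree at most E'/2. *)
Lemma mertens_lower :
  E%:R * Q ^+ (e * mu) <= Q ^+ (e * mu) * mertens_sum h M (e * (mu - C0))
    + e%:R * Q ^+ C2 * (2 * Q ^+ E)
    + E%:R * ((e * e + e)%:R * (Q ^+ (e * mu) * (2 * Q ^- D0) + Q ^+ C2 * (2 * Q ^+ E'./2))).
Proof.
have step1 : (E * #|Bt| <= \sum_(P <- irreds F E | ~~ (P %| M)%R)
    (deg P * (\sum_(b : Bt) common_roots h P (test_elt b)) + \sum_(b : Bt) exc P b))%N.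
  rewrite mulnC -sum_nat_const (eq_bigr _ (fun b _ => E_sum b)) exchange_big /=.
  apply: leq_sum => P _; rewrite big_distrr /= -big_split /=; apply: leq_sum => b _.
  by rewrite /exc; lia.
rewrite -{1}card_Bt -natrM.
apply: le_trans (_ : (\sum_(P <- irreds F E | ~~ (P %| M)%R)
    (deg P * (\sum_(b : Bt) common_roots h P (test_elt b)) + \sum_(b : Bt) exc P b))%N%:R <= _).
  by rewrite ler_nat.
rewrite natr_sum; under eq_bigr do rewrite natrD.
rewrite big_split /=; apply: lerD.
  rewrite (bigID (fun P : A => (deg P < e * (mu - C0))%N)) /=; apply: lerD.
    have nE : (e * (mu - C0) <= E)%N by rewrite leq_mul2l; apply/orP; right; lia.
    rewrite /mertens_sum -QE (big_irreds_le _ _ nE) big_distrr /=.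
    rewrite big_mkcond [leRHS]big_mkcond /= big_seq [leRHS]big_seq.
    apply: ler_sum => P; rewrite mem_irreds => /andP[hP _].
    case: (boolP (P %| M)) => //= nP; case: ltnP => [lt|_]; last first.
      by case: ifP => // _; rewrite mulr_ge0 ?divr_ge0 // exprn_ge0 // ltW.
    rewrite (ltnW lt).
    have /(congr1 (fun k => k%:R : R)) := sum_common_roots_exact hP nP lt.
    rewrite -big_distrl /= !natrM !natrX -QE => cE.
    have -> : (\sum_(b : Bt) common_roots h P (test_elt b))%:R = (nroots h P)%:R * Q ^+ (e * mu) / Q ^+ deg P.
      by rewrite -cE mulfK // expf_neq0 // gt_eqF.
    by rewrite !mulrA [Q ^+ (e * mu) * _]mulrC -!mulrA [Q ^+ (e * mu) * _]mulrCA.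
  apply: le_trans (_ : \sum_(P <- irreds F E) e%:R * Q ^+ C2 * (deg P)%:R <= _); last first.
    rewrite -big_distrr /=; apply: ler_wpM2l; last exact: (sum_irreds_deg_le QE).
    by rewrite mulr_ge0 // exprn_ge0 // ltW.
  rewrite big_mkcond /= big_seq [leRHS]big_seq; apply: ler_sum => P; rewrite mem_irreds => /andP[hP _].
  case: ifP => [/andP[nP]|_]; last by rewrite !mulr_ge0 // exprn_ge0 // ltW.
  rewrite -leqNgt => ge; rewrite natrM mulrC; apply: ler_wpM2r => //.
  by rewrite QE -natrX -natrM ler_nat sum_common_roots_small.
apply: le_trans (_ : \sum_(P <- irreds F E) (E%:R * ((e * e + e)%:R *
   ((if (D0 <= deg P)%N then Q ^+ (e * mu) * Q ^- (2 * deg P) else 0) + (if (deg P <= E'./2)%N then Q ^+ C2 else 0)))) <= _).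
  rewrite big_mkcond /= big_seq [leRHS]big_seq; apply: ler_sum => P; rewrite mem_irreds => /andP[hP _].
  have t1 : 0 <= Q ^+ (e * mu) * Q ^- (2 * deg P) by rewrite mulr_ge0 // ?invr_ge0 exprn_ge0 // ltW.
  have t2 : 0 <= Q ^+ C2 by rewrite exprn_ge0 // ltW.
  have t3 : 0 <= E%:R * ((e * e + e)%:R * ((if (D0 <= deg P)%N then Q ^+ (e * mu) * Q ^- (2 * deg P) else 0) + (if (deg P <= E'./2)%N then Q ^+ C2 else 0))).
    by rewrite mulr_ge0 // mulr_ge0 // addr_ge0 //; case: ifP.
  case: (boolP (P %| M)) => //= nP.
  apply: le_trans (excess_sum hP nP) _; rewrite (hD0 hP nP).
  case: (leqP (2 * deg P) E') => [le|_]; last by rewrite (hD0 hP nP) in t3.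
  by rewrite (_ : deg P <= E'./2)%N // -leq_double -mul2n; move: le; have := odd_double_half E'; lia.
rewrite -big_distrr /= -big_distrr /=; apply: ler_wpM2l => //; apply: ler_wpM2l => //.
rewrite big_split /=; apply: lerD.
  rewrite -big_mkcond /= -big_distrr /=; apply: ler_wpM2l; first by rewrite exprn_ge0 // ltW.
  exact: (sum_irreds_tail QE).
have -> : \sum_(P <- irreds F E) (if (deg P <= E'./2)%N then Q ^+ C2 else 0) =
    Q ^+ C2 * (count (fun P => deg P <= E'./2)%N (irreds F E))%:R.
  by rewrite -big_mkcond /= big_const_seq iter_addr addr0 mulr_natr.
apply: ler_wpM2l; first by rewrite exprn_ge0 // ltW.
apply: le_trans (size_irreds_le QE E'./2); rewrite ler_nat -size_filter.
apply: uniq_leq_size; first by rewrite filter_uniq // irreds_uniq.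
by move=> P; rewrite mem_filter !mem_irreds => /andP[-> /andP[->]].
Qed.

End Mertens.

(** * Passage to the limit in the Mertens estimate *)

Section MertensLimit.
Variables (F : finFieldType) (R : realType).
Local Notation A := {poly F}.
Local Notation q := #|F|.

Lemma archi_expr (Q x : R) : 2 <= Q -> exists k, forall n, (k <= n)%N -> x <= Q ^+ n.
Proof.
move=> Q2; exists (Num.bound x) => n kn.
apply: le_trans (ltW (le_lt_trans (ler_norm x) (archi_boundP (normr_ge0 x)))) _.
have box_poly : (Num.bound `|x| <= Num.bound x)%N.
  by rewrite /Num.bound normr_id.
apply: le_trans (_ : n%:R <= _); first by rewrite ler_nat (leq_trans box_poly).
elim: n {kn} => [|n IH]; first by rewrite expr0.
rewrite -natr1 exprS; have : 1 <= Q ^+ n by rewrite exprn_ege1 //; lra.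
by move: (Q ^+ n) IH => y; nra.
Qed.

Lemma mertens_sum_ge0 h (M : A) n : 0 <= mertens_sum R h M n.
Proof. by apply: sumr_ge0 => P _; rewrite divr_ge0 // exprn_ge0. Qed.

Lemma mertens_sum_mono h (M : A) n n' : (n <= n')%N ->
  mertens_sum R h M n <= mertens_sum R h M n'.
Proof.
move=> nn; rewrite /mertens_sum (big_irreds_le _ _ nn) big_mkcondr /=.
by apply: ler_sum => P _; case: ifP => // _; rewrite divr_ge0 // exprn_ge0.
Qed.

Variables (h : {poly A}) (s : seq {poly A}).
Hypotheses (hm : h \is monic) (h1 : (1 < size h)%N) (us : uniq s).
Hypotheses (ss : size s = (size h).-1).
Hypothesis (sP : forall t, t \in s -> h \Po t = h).

(** The slope of each t is a unit of A, so only its constant term and the coefficients of [h]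
    constrain [c]. *)
Lemma weight_exists : exists c, [/\ (0 < c)%N, wdeg_lt c (c * deg h).+1 h &
  forall t, t \in s -> wdeg_lt c c.+1 t].
Proof.
pose c := ((\max_(i < size h) size (h`_i)%R) + \sum_(t <- s) size (t`_0)%R).+1%N.
exists c; split=> //.
  apply: wdeg_lt_monic => // i; have [ii|ii] := ltnP i (size h); last by rewrite nth_default // size_poly0.
  have : (size (h`_i)%R <= \max_(i < size h) size (h`_i)%R)%N.
    exact: (bigop.leq_bigmax_cond (F := fun i : 'I_(size h) => size h`_i) (Ordinal ii)).
  by rewrite /c; move: (size _) (\max_(_ < _) _) (\sum_(_ <- _) _)%N => x y z; lia.
move=> t ts [|[|i]].
- rewrite muln0 subn0 /c (big_rem t ts) /=.
  by move: (size _) (\max_(_ < _) _) (\sum_(_ <- _) _)%N => x y z; lia.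
- rewrite muln1 subSnn; have st := stab_size hm h1 us ss sP ts.
  have -> : t`_1 = lead_coef t by rewrite /lead_coef st.
  have e0 : (0 < (size h).-1)%N by move: h1; move: (size h) => x; lia.
  have : lead_coef t \is a GRing.unit.
    by rewrite -(unitrX_pos _ e0) (stab_lead hm h1 us ss sP ts) unitr1.
  by rewrite poly_unitE => /andP[/eqP->].
by rewrite nth_default ?size_poly0 // (stab_size hm h1 us ss sP ts).
Qed.

Hypothesis (irr : irreducible_poly h).
Hypothesis (h' : h^`() != 0).

Lemma sep_exists : exists2 b : A, b != 0 & forall P, ~~ (P %| b) -> sep h P.
Proof.
have [|u [v [b [b0 uvb]]]] := irreducible_bezout irr h'; first exact: lt_size_deriv (monic_neq0 hm).
exists b => // P nP y Py; apply: contra nP => Py'.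
have /(congr1 (fun p => p.[y])) := uvb; rewrite !hornerE => <-.
by rewrite dvdp_add // dvdp_mull.
Qed.

Lemma small_primes_multiple D0 : exists2 W : A, W != 0 &
  forall P, mirr P -> ~~ (P %| W) -> (D0 <= deg P)%N.
Proof.
exists (\prod_(u : {poly_D0 F} | polyn u != 0) polyn u).
  by apply/prodf_neq0.
move=> P hP; apply: contraR; rewrite -ltnNge => lt.
have sP0 : (size P <= D0)%N by rewrite -degS ?mirr_neq0.
by rewrite (bigD1 (NPoly sP0)) ?mirr_neq0 //= dvdp_mulIl.
Qed.

End MertensLimit.

(** The modulus depends on the tolerance, since it has to absorb the primes of degree below D0.
    Allowing every multiple of it lets other finite sets of primes be discarded later. *)
Theorem mertens_asymp (F : finFieldType) (R : realType) (h : {poly {poly F}})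
    (s : seq {poly {poly F}}) (eps : R) :
  h \is monic -> (1 < size h)%N -> uniq s -> size s = (size h).-1 ->
  (forall t, t \in s -> h \Po t = h) -> irreducible_poly h -> h^`() != 0 ->
  0 < eps -> exists2 M0 : {poly F}, M0 != 0 &
  forall M, M != 0 -> M0 %| M -> exists n0, forall n, (n0 <= n)%N ->
    `|mertens_sum R h M n - n%:R| <= eps * n%:R.
Proof.
move=> hm h1 us ss sP irr h' eps0; pose Q : R := #|F|%:R; have QE : Q = #|F|%:R by [].
have Q2 : 2 <= Q by rewrite QE ler_nat; exact: card_finNzRing_gt1.
clearbody Q; have Q0 : 0 < Q by move: Q2; clear; lra.
have [c [c0 hc ht]] := weight_exists hm h1 us ss sP.
have [b b0 hb] := sep_exists hm irr h'.
pose e := deg h; have e0 : (0 < e)%N by rewrite /e /deg; move: h1; move: (size h) => x; lia.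
pose K : R := (e * e + e)%:R; have K0 : 0 < K by rewrite ltr0n addn_gt0 e0 orbT.
(* Brings the proportion K * 2 q^(-D0) lost to the excess below eps / 4. *)
have [D0 hD0] := archi_expr (8 * K / eps) Q2.
have [W W0 hW] := small_primes_multiple F D0.
exists (b * W); first by rewrite mulf_neq0.
move=> M M0 dvM.
have Mb P : ~~ (P %| M) -> ~~ (P %| b).
  by apply: contra => dv; apply: dvdp_trans dvM; apply: dvdp_mulr.
have MW P : ~~ (P %| M) -> ~~ (P %| W).
  by apply: contra => dv; apply: dvdp_trans dvM; apply: dvdp_mull.
have hsepM P : mirr P -> ~~ (P %| M) -> sep h P by move=> _ /Mb/hb.
have hDM P : mirr P -> ~~ (P %| M) -> (D0 <= deg P)%N by move=> hP /MW/(hW P hP).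
have KQ : K * (2 * Q ^- D0) <= eps / 4.
  have D0' := hD0 D0 (leqnn _); have QD : 0 < Q ^+ D0 by rewrite exprn_gt0.
  rewrite mulrA ler_pdivrMr //; move: D0'; rewrite ler_pdivrMr // => D0'.
  by move: (Q ^+ D0) D0' QD => y; clear; lra.
pose C0 := (2 * (c * e))%N; pose C2 := (e * C0.+1)%N.
pose K1 := (e * (C0.+1 + c * e + deg M))%N.
pose K3 := (e * (c * e + deg M))%N; pose K4 := (e * (c * e + deg M + 1 + C0))%N.
have [n1 hn1] := archi_expr (K * (Q ^+ C2 * (2 * Q ^+ K4)) * 4 / eps) Q2.
pose K5 : R := e%:R * Q ^+ C2 * (2 * Q ^+ K3).
have K50 : 0 <= K5 by rewrite !mulr_ge0 // exprn_ge0 // ltW.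
have [nb hnb] : exists nb, forall n, (nb <= n)%N -> K1%:R + 2 * K5 <= eps * n%:R.
  exists (Num.bound ((K1%:R + 2 * K5) / eps)) => n nbn.
  rewrite -ler_pdivrMl // mulrC; apply: ltW; apply: lt_le_trans (archi_boundP _) _.
    by apply: divr_ge0; [apply: addr_ge0 => //; apply: mulr_ge0 | apply: ltW].
  by rewrite ler_nat.
exists (nb + 2 * n1 + 2)%N => n n0n.
have nbig : K1%:R + 2 * K5 <= eps * n%:R by apply: hnb; move: n0n; clear; lia.
rewrite ler_norml; apply/andP; split; last first.
  (* The smallest box whose exact range goes past degree [n]. *)
  pose mu := (n %/ e + C0.+1)%N.
  have lt : (n < e * (mu - C0))%N by rewrite /mu addnS -addSn addnK mulnC; exact: ltn_ceil.
  have mu0 : (0 < mu)%N by rewrite /mu addnS.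
  have up := @mertens_upper F R h s hm h1 us ss sP irr c hc ht M M0 hsepM mu mu0 Q QE n lt.
  have : (e * (mu + c * e + deg M))%:R <= n%:R + K1%:R :> R.
    rewrite -natrD ler_nat /mu /K1 -!addnA mulnDr leq_add2r mulnC; exact: leq_trunc_div.
  by move: up; rewrite -/e => up le; move: nbig K50 (le_trans up le); clear; lra.
(* The largest box whose exact range e (mu - C0) stays within [n]. *)
pose mu := (n %/ e + C0)%N.
have mu0 : (0 < mu)%N by rewrite /mu /C0 addn_gt0 !muln_gt0 c0 e0 orbT.
have := @mertens_lower F R h s hm h1 us ss sP irr c hc ht M D0 M0 hsepM hDM mu mu0 Q QE.
rewrite -/e -/C0 -/C2 -/K.
pose E := (e * (mu + c * e + deg M))%N; rewrite -/E.
set E' := (e * ((mu + c * e + deg M).+1 + C0))%N.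
set S' := mertens_sum _ _ _ _; set x := Q ^+ (e * mu).
have x0 : 0 < x by rewrite exprn_gt0.
have S'le : S' <= mertens_sum R h M n.
  by apply: mertens_sum_mono; rewrite /mu addnK mulnC; exact: leq_trunc_div.
have EE : Q ^+ E = x * Q ^+ K3 by rewrite -exprD; congr (_ ^+ _); by rewrite /E /K3 -mulnDr -addnA.
(* The number of primes up to degree E'/2 is at most a constant times [y], about the square root of
   the box; for [n] large the other factor [y] absorbs the constant. *)
pose y := Q ^+ (e * mu)./2.
have yx : y * y <= x.
  rewrite /y /x -exprD; apply: ler_weXn2l; first by move: Q2; clear; lra.
  by have := odd_double_half (e * mu); rewrite -addnn; clear; lia.
have y0 : 0 < y by rewrite exprn_gt0.
have ne : (n <= e * mu)%N.
  rewrite /mu mulnDr; have := ltn_ceil n e0; rewrite mulSn mulnC /C0.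
  have : (e <= e * (2 * (c * e)))%N by rewrite leq_pmulr // !muln_gt0 c0 e0.
  by move: (e * (n %/ e))%N (e * (2 * (c * e)))%N => u v; clear; lia.
have E'le : Q ^+ E'./2 <= y * Q ^+ K4.
  rewrite /y -exprD; apply: ler_weXn2l; first by move: Q2; clear; lra.
  have -> : E' = (e * mu + K4)%N by rewrite /E' /K4 -mulnDr; congr (_ * _)%N; clear; lia.
  have := odd_double_half (e * mu + K4); have := odd_double_half (e * mu).
  by rewrite -!addnn; clear; lia.
have ybig : K * (Q ^+ C2 * (2 * Q ^+ K4)) * 4 / eps <= y.
  apply: hn1; have := odd_double_half (e * mu); rewrite -addnn.
  by move: n0n ne; clear; lia.
have small : K * (Q ^+ C2 * (2 * Q ^+ E'./2)) <= x * (eps / 4).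
  apply: le_trans (_ : K * (Q ^+ C2 * (2 * (y * Q ^+ K4))) <= _).
    apply: ler_wpM2l; first exact: ltW.
    apply: ler_wpM2l; first by rewrite exprn_ge0 // ltW.
    exact: ler_wpM2l.
  move: ybig; rewrite ler_pdivrMr // => ybig.
  apply: le_trans (_ : y * y * (eps / 4) <= _); last by apply: ler_wpM2r => //; move: eps0; clear; lra.
  have -> : K * (Q ^+ C2 * (2 * (y * Q ^+ K4))) = (K * (Q ^+ C2 * (2 * Q ^+ K4)) * 4) * y / 4.
    by field.
  move: (K * _ * 4) ybig => z; move: y0 eps0; clear; move: y => y.
  by nra.
rewrite EE => low.
have low2 : E%:R * x <= (S' + K5 + E%:R * (eps / 2)) * x.
  apply: le_trans low _; rewrite /K5.
  have E0 : 0 <= E%:R :> R by [].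
  have h1' : E%:R * (K * (x * (2 * Q ^- D0))) <= E%:R * (x * (eps / 4)).
    apply: ler_wpM2l => //; rewrite mulrCA; apply: ler_wpM2l => //; exact: ltW.
  have h2' := ler_wpM2l E0 small.
  rewrite mulrDr.
  move: h1' h2'; move: (K * (x * _)) (K * (Q ^+ C2 * _)) => u v; clear.
  by move: (E%:R) (e%:R) x (Q ^+ C2) (Q ^+ K3) S' => a1 a2 a3 a4 a5 a6; lra.
rewrite ler_pM2r // in low2.
have nE : n%:R <= E%:R :> R by rewrite ler_nat /E; apply: leq_trans ne _; rewrite leq_mul2l -addnA leq_addr orbT.
have Sn0 := mertens_sum_ge0 R h M n.
have n0' : 0 <= n%:R :> R by [].
have K10 : 0 <= K1%:R :> R by [].
move: low2 nE Sn0 n0' K10 K50 nbig S'le eps0; clear.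
move: (mertens_sum R h M n) (n%:R) (E%:R) (K1%:R) K5 S' => sn nn EE k1 k5 s' low2 nE Sn0 n0 k10 k50 nbig sle eps0.
(* For eps > 1 the bound follows from nonnegativity of the sum; otherwise 1 - eps / 2 is positive
   and [E] may be lowered to [n]. *)
have [e1|e1] := leP eps 1; last by nra.
have : nn * (1 - eps / 2) <= s' + k5 by nra.
by lra.
Qed.

(** * Special polynomials *)

Section LinearFactors.
Variable R : idomainType.
Implicit Types (p q t : {poly R}).

Lemma comp_poly_inj_gt1 t : (1 < size t)%N -> injective (fun p => p \Po t).
Proof.
move=> st p p' /eqP; rewrite -subr_eq0 -rmorphB /= comp_poly_eq0 // subr_eq0.
by move/eqP.
Qed.

Lemma coef_prod_linear (I : Type) (r : seq I) (test_elt be : I -> R) :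
  (size (\prod_(i <- r) ((test_elt i)%:P * 'X + (be i)%:P))%R <= (size r).+1)%N /\
  (\prod_(i <- r) ((test_elt i)%:P * 'X + (be i)%:P))`_(size r) = \prod_(i <- r) test_elt i.
Proof.
elim: r => [|i r [IH1 IH2]]; first by rewrite !big_nil size_poly1 coef1.
rewrite !big_cons mulrDl; set p := \prod_(j <- r) _ in IH1 IH2 *.
split.
  apply: leq_trans (size_polyD _ _) _; rewrite geq_max; apply/andP; split.
    rewrite -mulrA mul_polyC; apply: leq_trans (size_scale_leq _ _) _.
    rewrite mulrC; have [->|p0] := eqVneq p 0; first by rewrite mul0r size_poly0.
    by rewrite size_mulX.
  rewrite mul_polyC; apply: leq_trans (size_scale_leq _ _) _; exact: leqW.
rewrite coefD -mulrA coefCM coefXM /= IH2 coefCM [p`_(size r).+1]nth_default // mulr0 addr0.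
by [].
Qed.

Lemma root_of_split p q (r : seq R) : p * q = \prod_(x <- r) ('X - x%:P) ->
  (1 < size p)%N -> exists2 x, x \in r & root p x.
Proof.
elim: r q => [|x r IH] q.
  rewrite big_nil => e sp; have := congr1 (fun u : {poly R} => size u) e.
  have p0 : p != 0 by rewrite -size_poly_gt0 (leq_trans _ sp).
  have q0 : q != 0 by apply: contra_eq_neq e => ->; rewrite mulr0 eq_sym oner_neq0.
  rewrite size_mul // size_poly1; move: sp; rewrite -size_poly_gt0 in q0.
  by move: (size p) (size q) q0 => a b; lia.
rewrite big_cons => e sp; have [px|npx] := boolP (root p x).
  by exists x; rewrite ?mem_head.
have : root (p * q) x by rewrite e rootM root_XsubC eqxx.
rewrite rootM (negbTE npx) /= => /factor_theorem[q' qE].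
have [|//|y yr py] := IH q'; last by exists y; rewrite // inE yr orbT.
have x0 : 'X - x%:P != 0 by rewrite polyXsubC_eq0.
apply: (mulfI x0); rewrite -e qE; ring.
Qed.

End LinearFactors.

(** * Gauss's lemma over A *)

Section Gauss.
Variable F : finFieldType.
Local Notation A := {poly F}.

(** Polynomials over the residue field of P form a domain. *)
Lemma mirr_dvd_polyM (P : A) (u v w : {poly A}) : mirr P -> u * v = P%:P * w ->
  exists w', u = P%:P * w' \/ v = P%:P * w'.
Proof.
move=> hP e; have [K [pi [lift [piK pi0 lift0 lift1]]]] := residue_field hP.
have map0 (p : {poly A}) : map_poly pi p = 0 -> exists w, p = P%:P * w.
  move=> p0; exists (map_poly (fun x => x %/ P) p); apply/polyP => i.
  rewrite coefCM coef_map_id0 ?div0p // mulrC divpK // -pi0 -coef_map p0 coef0.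
  by rewrite eqxx.
have : map_poly pi u * map_poly pi v == 0.
  rewrite -rmorphM e rmorphM /= map_polyC /=; have -> : pi P = 0 by apply/eqP; rewrite pi0.
  by rewrite mul0r.
by rewrite mulf_eq0 => /orP[/eqP/map0[w' ->]|/eqP/map0[w' ->]]; exists w'; [left|right].
Qed.

(** The denominator [c] is cleared one prime at a time, each prime dividing [u] or [v] entirely. *)
Lemma gauss_factor (f u v : {poly A}) (c : A) : c != 0 -> c%:P * f = u * v ->
  exists u' v', [/\ f = u' * v', size u' = size u & size v' = size v].
Proof.
elim: {c}(size c) {-2}c u v (leqnn (size c)) => [|n IH] c u v sc c0 e.
  by move: sc; rewrite leqn0 size_poly_eq0 (negbTE c0).
have [c1|c1] := leqP (size c) 1.
  have cc : c = (c`_0)%:P := size1_polyC c1.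
  have c00 : c`_0 != 0 by apply: contraNneq c0 => z; rewrite cc z.
  exists ((c`_0)^-1%:P%:P * u), v; split=> //; last first.
    by rewrite mul_polyC size_scale // polyC_eq0 invr_eq0.
  rewrite -mulrA -e mulrA -polyCM {2}cc -polyCM mulVf // mul1r //.
have [P hP /dvdpP[c' cE]] := mirr_dvd_exists c1.
have c'0 : c' != 0 by apply: contraNneq c0 => z; rewrite cE z mul0r.
have P0 := mirr_neq0 hP; have PP0 : P%:P != 0 :> {poly A} by rewrite polyC_eq0.
have sc' : (size c' <= n)%N.
  move: sc; rewrite cE size_mul //; have := mirr_size hP; rewrite -size_poly_gt0 in c'0.
  by move: (size c') (size P) c'0 => x y; clear; lia.
have e' : u * v = P%:P * (c'%:P * f) by rewrite -e cE polyCM; ring.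
have [w [uE|vE]] := mirr_dvd_polyM hP e'.
  have [|u' [v' [fE su sv]]] := IH c' w v sc' c'0.
    by apply: (mulfI PP0); rewrite -e' uE; ring.
  by exists u', v'; split=> //; rewrite su uE mul_polyC size_scale.
have [|u' [v' [fE su sv]]] := IH c' u w sc' c'0.
  by apply: (mulfI PP0); rewrite -e' vE; ring.
by exists u', v'; split=> //; rewrite sv vE mul_polyC size_scale.
Qed.

Lemma irreducible_elt_poly (f : {poly A}) : (1 < size f)%N ->
  irreducible_elt f -> irreducible_poly f.
Proof.
move=> sf [f0 fU firr]; split=> // u su uf.
have [[c w] /= c0 cE] : {cw : A * {poly A} | cw.1 != 0 & cw.1 *: f = cw.2 * u}.
  by have := uf; rewrite Pdiv.Idomain.dvdp_eq => /eqP e; exists (lead_coef u ^+ scalp f u, f %/ u);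
    rewrite //= expf_neq0 // lead_coef_eq0; apply: contraTneq uf => ->; rewrite dvd0p.
have [|w' [u' [fE sw' su']]] := gauss_factor (u := w) (v := u) (f := f) c0.
  by rewrite mul_polyC.
have su0 : size u' != 1%N by rewrite su'.
case: (firr _ _ fE) => [wU|uU].
  rewrite -dvdp_size_eqp // -su'; move: wU; rewrite poly_unitE => /andP[/eqP sw1 _].
  have w0 : w' != 0 by rewrite -size_poly_gt0 sw1.
  have u0 : u' != 0 by apply: contraNneq f0 => z; rewrite fE z mulr0.
  by rewrite fE size_mul // sw1 add1n.
by move: uU; rewrite poly_unitE => /andP[]; rewrite (negbTE su0).
Qed.

End Gauss.

(** * Linear factors of special polynomials *)

Section Special.
Variable F : finFieldType.
Local Notation A := {poly F}.

Lemma special_comp (f : {poly A}) (a b c : 'I_(deg f) -> A) :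
  f^:P - f%:P = \prod_i ((a i)%:P%:P * 'X + (b i)%:P%:P * 'X%:P + (c i)%:P%:P) ->
  forall u v : {poly A},
    (f \Po u) - (f \Po v) = \prod_i ((a i)%:P * u + (b i)%:P * v + (c i)%:P).
Proof.
move=> e u v; have /(congr1 (fun p : {poly {poly A}} => (map_poly (comp_poly v) p).[u])) := e.
rewrite rmorphB /= hornerD hornerN horner2_comp map_polyC /= hornerC => ->.
rewrite rmorph_prod horner_prod /=; apply: eq_bigr => i _.
rewrite !rmorphD !rmorphM /= map_polyX !map_polyC /= comp_polyX !comp_polyC.
by rewrite !hornerE.
Qed.

Lemma special_horner (f : {poly A}) (a b c : 'I_(deg f) -> A) :
  (forall u v : {poly A},
    (f \Po u) - (f \Po v) = \prod_i ((a i)%:P * u + (b i)%:P * v + (c i)%:P)) ->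
  forall x y, f.[x] - f.[y] = \prod_i (a i * x + b i * y + c i).
Proof.
move=> e x y; apply: polyC_inj; rewrite rmorphB rmorph_prod /= -!comp_polyCr e.
by apply: eq_bigr => i _; rewrite !polyCD !polyCM.
Qed.

Lemma comp_scaleX (R : comNzRingType) (p : {poly R}) (x : R) i :
  (p \Po (x *: 'X))`_i = p`_i * x ^+ i.
Proof.
rewrite comp_polyE; under eq_bigr do rewrite exprZn scalerA.
rewrite -(poly_def _ (fun i => p`_i * x ^+ i)) coef_poly; case: ltnP => // le.
by rewrite nth_default ?mul0r.
Qed.

(** Comparing coefficients of X^d at u = xX, v = yX gives lead(f) (x^d - y^d) as the product of the
    a_i x + b_i y. The choice x = b_i, y = -a_i kills a factor, so a_i and b_i have equal d-th
    powers up to sign and are associates: only constant slopes occur. *)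
Lemma special_lead (f : {poly A}) (a b c : 'I_(deg f) -> A) : f != 0 -> (0 < deg f)%N ->
  (forall u v : {poly A},
    (f \Po u) - (f \Po v) = \prod_i ((a i)%:P * u + (b i)%:P * v + (c i)%:P)) ->
  [/\ lead_coef f = \prod_i a i, forall i, a i != 0 &
    forall i, exists2 z : F, z != 0 & b i = - (z%:P * a i)].
Proof.
move=> f0 d0 e; pose d := deg f.
have key x y : lead_coef f * x ^+ d - lead_coef f * y ^+ d = \prod_i (a i * x + b i * y).
  have /(congr1 (fun p : {poly A} => p`_d)) := e (x *: 'X) (y *: 'X).
  rewrite coefB !comp_scaleX -[f`_d]/(lead_coef f) => ->.
  have [_] := coef_prod_linear (enum 'I_d) (fun i => a i * x + b i * y) c.
  rewrite size_enum_ord !big_enum /=.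
  move=> h2; rewrite [RHS](eq_bigl (fun i => i \in 'I_d)) // -h2.
  suff -> : \prod_i ((a i)%:P * (x *: 'X) + (b i)%:P * (y *: 'X) + (c i)%:P) =
    \prod_(i in 'I_d) ((a i * x + b i * y)%:P * 'X + (c i)%:P) by [].
  by apply: eq_big => // i _; rewrite polyCD !polyCM -!mul_polyC; ring.
have lcE : lead_coef f = \prod_i a i.
  have := key 1 0; rewrite expr1n mulr1 expr0n gtn_eqF // mulr0 subr0 => ->.
  by apply: eq_bigr => i _; rewrite mulr1 mulr0 addr0.
have lc0 : lead_coef f != 0 by rewrite lead_coef_eq0.
have a0 i : a i != 0.
  by apply: contraNneq lc0 => z; rewrite lcE (bigD1 i) //= z mul0r.
split=> // i; have := key (b i) (- a i); rewrite [RHS](bigD1 i) //=.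
have -> : a i * b i + b i * - a i = 0 by ring.
rewrite mul0r -mulrBr => /eqP; rewrite mulf_eq0 (negbTE lc0) /= subr_eq0 => /eqP ba.
have dv : a i %| b i.
  by rewrite -(dvdp_pexp2r _ _ d0) ba; apply/dvdp_exp2r/dvdpP; exists (- 1); ring.
have dv' : b i %| a i.
  by rewrite -(dvdp_pexp2r _ _ d0) ba; apply/dvdp_exp2r/dvdpP; exists (- 1); ring.
have : a i %= b i by rewrite /eqp dv dv'.
case/eqpf_eq => z z0 aE; exists (- z^-1); first by rewrite oppr_eq0 invr_eq0.
by rewrite aE mul_polyC scalerA mulNr mulVf // scaleN1r opprK.
Qed.

(* c^(d-1) f(X / c), where c is the leading coefficient of f. *)
Definition monize (f : {poly A}) : {poly A} :=
  \poly_(j < (deg f).+1) (if j == deg f then 1 else f`_j * lead_coef f ^+ ((deg f).-1 - j)).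

Lemma monizeE (f : {poly A}) : f != 0 -> (0 < deg f)%N ->
  monize f \Po (lead_coef f *: 'X) = lead_coef f ^+ (deg f).-1 *: f.
Proof.
move=> f0 d0; apply/polyP => i; rewrite comp_scaleX coefZ coef_poly.
case: ltnP => [|le]; last first.
  by rewrite mul0r nth_default ?mulr0 // -degS.
rewrite ltnS leq_eqVlt => /orP[/eqP->|lt].
  by rewrite eqxx mul1r -[f`_(deg f)]/(lead_coef f) -exprSr prednK.
rewrite (ltn_eqF lt) -mulrA -exprD mulrC; congr (_ ^+ _ * _); lia.
Qed.

Lemma monize_monic (f : {poly A}) : monize f \is monic.
Proof.
rewrite monicE /lead_coef size_poly_eq ?eqxx ?oner_neq0 //=.
by rewrite coef_poly ltnSn eqxx.
Qed.

Lemma size_monize (f : {poly A}) : size (monize f) = (deg f).+1.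
Proof. by rewrite size_poly_eq // eqxx oner_neq0. Qed.

Lemma monize_irreducible (f : {poly A}) : (0 < deg f)%N ->
  irreducible_poly f -> irreducible_poly (monize f).
Proof.
move=> d0 firr; have f0 := irredp_neq0 firr; have [sf irr] := firr.
have lc0 : lead_coef f != 0 by rewrite lead_coef_eq0.
pose X' : {poly A} := lead_coef f *: 'X.
have sX : size X' = 2%N by rewrite size_scale // size_polyX.
split; first by rewrite size_monize ltnS.
move=> u su uf; rewrite -dvdp_size_eqp // size_monize degS // -(size_comp_poly2 u sX).
apply/eqP/eqp_size; apply: irr; first by rewrite size_comp_poly2.
have := uf; rewrite Pdiv.Idomain.dvdp_eq => /eqP/(congr1 (fun p : {poly A} => p \Po X')).
rewrite comp_polyZ monizeE // rmorphM /= => e.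
have u0 : lead_coef u != 0.
  by rewrite lead_coef_eq0; apply: contraTneq uf => ->; rewrite dvd0p monic_neq0 ?monize_monic.
rewrite -(@dvdpZr _ (lead_coef u ^+ scalp (monize f) u * lead_coef f ^+ (deg f).-1)).
  by rewrite -scalerA e dvdp_mulIr.
by rewrite mulf_neq0 // expf_neq0.
Qed.

(** With e_i the product of the other a_j, scaling both variables by lead(f) turns X - t_i(Y) into
    e_i (a_i X + b_i Y + c_i), and the product of the e_i is lead(f)^(d-1). *)
Lemma special_monize (f : {poly A}) : f != 0 -> (0 < deg f)%N -> special f ->
  exists ts : seq {poly A}, [/\ all (fun t : {poly A} => size t == 2%N) ts &
    (monize f)^:P - (monize f)%:P = \prod_(t <- ts) ('X - t%:P) :> {poly {poly A}}].
Proof.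
move=> f0 d0 hs; have [_ [a [b [c e0]]]] := hs; have e := special_comp e0.
have [lcE a0 bE] := special_lead f0 d0 e.
have lc0 : lead_coef f != 0 by rewrite lead_coef_eq0.
have [z zP] : exists z : 'I_(deg f) -> F, forall i, z i != 0 /\ b i = - ((z i)%:P * a i).
  by exists (fun i => s2val (cid2 (bE i))) => i; case: (cid2 (bE i)).
pose ei i := \prod_(j | j != i) a j.
have eiE i : lead_coef f = a i * ei i by rewrite lcE (bigD1 i).
have prod_ei : \prod_i ei i = lead_coef f ^+ (deg f).-1.
  apply: (mulfI lc0); rewrite -exprS prednK // {1}lcE -big_split /=.
  rewrite (eq_bigr (fun=> lead_coef f)) => [|i _]; last by rewrite -eiE.
  by rewrite prodr_const card_ord.
pose t i : {poly A} := (z i)%:P *: 'X - (c i * ei i)%:P.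
exists [seq t i | i <- index_enum 'I_(deg f)]; split.
  apply/allP => _ /mapP[i _ ->]; have [zi0 _] := zP i.
  by rewrite size_polyDl size_scale ?size_polyX ?polyC_eq0 // size_polyN ltnS size_polyC_leq1.
rewrite big_map; set g := monize f; pose X' : {poly A} := lead_coef f *: 'X.
have sX : size X' = 2%N by rewrite size_scale // size_polyX.
pose X2 : {poly {poly A}} := X'^:P.
have sX2 : size X2 = 2%N by rewrite size_map_polyC.
(* The identity is checked after the injective scaling of X, then of Y, by the leading
   coefficient. *)
apply: (comp_poly_inj_gt1 (t := X2)); first by rewrite sX2.
apply: (map_inj_poly (f := comp_poly X')) => /=.
- by apply: comp_poly_inj.
- by rewrite comp_poly0.
rewrite !map_comp_poly /=.
have -> : map_poly (comp_poly X') X2 = X2.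
  by rewrite /X2 -map_poly_comp; apply: eq_map_poly => x /=; rewrite comp_polyC.
rewrite !rmorphB /= map_polyC /= comp_polyC monizeE //.
have -> : (map_poly (comp_poly X') g^:P \Po X2) = (lead_coef f ^+ (deg f).-1 *: f)^:P.
  rewrite -monizeE // map_comp_poly; congr (_ \Po _).
  by rewrite -map_poly_comp; apply: eq_map_poly => x /=; rewrite comp_polyC.
rewrite !rmorph_prod /=.
have -> : (lead_coef f ^+ (deg f).-1 *: f)^:P - (lead_coef f ^+ (deg f).-1 *: f)%:P =
    (lead_coef f ^+ (deg f).-1)%:P%:P * (f^:P - f%:P) :> {poly {poly A}}.
  by rewrite -mul_polyC rmorphM /= map_polyC /= polyCM mulrBr.
rewrite e0 -prod_ei !rmorph_prod /= -big_split /=; apply: eq_bigr => i _.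
have [_ biE] := zP i.
rewrite rmorphB /= map_polyX map_polyC /= rmorphB /= comp_polyX comp_polyC.
have -> : X2 = (a i)%:P%:P * (ei i)%:P%:P * 'X.
  by rewrite /X2 /X' -mul_polyC rmorphM /= map_polyC /= map_polyX (eiE i) !polyCM.
have -> : (t i \Po X') = (z i)%:P%:P * ((a i)%:P * (ei i)%:P * 'X) - (c i)%:P * (ei i)%:P.
  by rewrite rmorphB /= comp_polyZ comp_polyX comp_polyC /X' -!mul_polyC (eiE i) !polyCM.
rewrite biE !(polyCN, polyCM, polyCD); ring.
Qed.

End Special.

Lemma deriv0_comp (R : idomainType) (p : nat) (g : {poly R}) : p \in [pchar R] -> g^`() = 0 ->
  exists g1, g = g1 \Po 'X^p.
Proof.
move=> cp g0; have p0 : (0 < p)%N by apply: prime_gt0; apply: pcharf_prime cp.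
exists (\poly_(i < size g) g`_(i * p)); apply/polyP => i.
rewrite coef_comp_poly_Xn // coef_poly; case: (boolP (p %| i)%N) => [dv|ndv].
  rewrite divnK //; case: ltnP => // le; rewrite nth_default //.
  by apply: leq_trans le _; apply: leq_div.
have [i0|] := posnP i; first by move: ndv; rewrite i0 dvdn0.
case: i ndv => // i ndv _; have /(congr1 (fun u : {poly R} => u`_i)) := g0.
rewrite coef_deriv coef0 -mulr_natl => /eqP; rewrite mulf_eq0 => /orP[|/eqP//].
by rewrite -(dvdn_pcharf cp) (negbTE ndv).
Qed.

(** * Reduction to a separable polynomial *)

Section Inseparable.
Variable F : finFieldType.
Local Notation A := {poly F}.

Lemma separable_part (p : nat) (g : {poly A}) : p \in [pchar F] -> (1 < size g)%N ->
  exists k (h : {poly A}), g = h \Po 'X^(p ^ k) /\ h^`() != 0.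
Proof.
move=> cp; have pp : prime p := pcharf_prime cp; have p1 := prime_gt1 pp.
elim: {g}(size g) {-2}g (leqnn (size g)) => [|n IH] g sg g1.
  by move: g1; rewrite ltnNge (leq_trans sg).
have [g0|g0] := eqVneq (g^`()) 0; last by exists 0%N, g; rewrite expn0 expr1 comp_polyXr.
have cpA : p \in [pchar A] by rewrite pchar_poly.
have [g' gE] := deriv0_comp cpA g0.
have sg' : ((size g).-1 = (size g').-1 * p)%N by rewrite gE size_comp_poly size_polyXn.
have g'1 : (1 < size g')%N by move: sg' g1; case: (size g') => [|[|x]] //=; rewrite mul0n; lia.
have [|k [h [g'E h']]] := IH g' _ g'1.
  by move: sg' sg g1 g'1 p1; move: (size g) (size g') => x y; clear; nia.
exists k.+1, h; split=> //; rewrite gE g'E -comp_polyA; congr (_ \Po _).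
by rewrite comp_Xn_poly -exprM expnS.
Qed.

Lemma insep_reduction (g : {poly A}) (ts : seq {poly A}) :
  g \is monic -> (1 < size g)%N -> irreducible_poly g ->
  all (fun t : {poly A} => size t == 2%N) ts ->
  g^:P - g%:P = \prod_(t <- ts) ('X - t%:P) :> {poly {poly A}} ->
  exists (N : nat) (h : {poly A}) (s : seq {poly A}),
  [/\ [pchar F].-nat N, g = h \Po 'X^N, h \is monic, (1 < size h)%N & irreducible_poly h] /\
  [/\ h^`() != 0, uniq s, size s = (size h).-1 & forall t, t \in s -> h \Po t = h].
Proof.
move=> gm g1 girr ts2 gE; have [p pp cp] := finPcharP F.
have [k [h [ghE h']]] := separable_part cp g1.
pose N := (p ^ k)%N; have N0 : (0 < N)%N by rewrite expn_gt0 prime_gt0.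
have NF : [pchar F].-nat N.
  by rewrite (eq_pnat _ (pcharf_eq cp)) pnatX pnat_id.
have NA (R : comNzRingType) : [pchar R] =i [pchar F] -> [pchar R].-nat N.
  by move=> e; rewrite (eq_pnat _ e).
have XN1 : (1 < size ('X^N : {poly A}))%N by rewrite size_polyXn ltnS.
have sgh : ((size g).-1 = (size h).-1 * N)%N by rewrite ghE size_comp_poly size_polyXn.
have h1 : (1 < size h)%N by move: sgh g1; case: (size h) => [|[|x]] //=; rewrite mul0n; lia.
have h0 : h != 0 by rewrite -size_poly_gt0 ltnW.
have hm : h \is monic.
  move: gm; rewrite monicE ghE lead_coef_comp // lead_coefXn expr1n mulr1.
  by rewrite monicE.
have hirr : irreducible_poly h.
  split=> // u su uh; rewrite -dvdp_size_eqp //.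
  have uN : u \Po 'X^N %| g.
    have := uh; rewrite Pdiv.Idomain.dvdp_eq => /eqP/(congr1 (fun v : {poly A} => v \Po 'X^N)).
    rewrite comp_polyZ rmorphM /= -ghE => e.
    have u0 : lead_coef u != 0.
      by rewrite lead_coef_eq0; apply: contraTneq uh => ->; rewrite dvd0p.
    by rewrite -(@dvdpZr _ (lead_coef u ^+ scalp h u)) ?expf_neq0 // e dvdp_mulIr.
  have [_ irr] := girr.
  have sc v : ((size (v \Po 'X^N : {poly A})).-1 = (size v).-1 * N)%N.
    by rewrite size_comp_poly size_polyXn.
  have u0 : u != 0 by apply: contraTneq uh => ->; rewrite dvd0p.
  have e1 : size (u \Po 'X^N) = size g.
    apply: eqp_size; apply: irr uN; apply: contra su => /eqP e.
    have := sc u; rewrite e /= => /esym/eqP; rewrite muln_eq0 [N == _]gtn_eqF // orbF => /eqP.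
    by move: u0; rewrite -size_poly_gt0; case: (size u) => [|[|]].
  have := sc u; rewrite e1 sgh => /eqP; rewrite eqn_pmul2r // => /eqP e2.
  by move: u0 h1 e2; rewrite -size_poly_gt0; move: (size u) (size h) => x y; clear; lia.
(* Frobenius twist of the affine map t: it sends X^N to t^N, so it stabilizes [h] when t stabilizes
   [g]. *)
pose fr (t : {poly A}) : {poly A} := t`_1 ^+ N *: 'X + (t`_0 ^+ N)%:P.
have t2 t : t \in ts -> t = t`_1 *: 'X + (t`_0)%:P.
  move=> /(allP ts2)/eqP st; apply/polyP => i; rewrite coefD coefZ coefX coefC.
  case: i => [|[|i]] /=; rewrite ?mulr0 ?mulr1 ?add0r ?addr0 //.
  by rewrite nth_default // st.
have frE t : t \in ts -> fr t \Po 'X^N = t ^+ N.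
  move=> tts; rewrite {2}(t2 t tts) exprDn_pchar; last first.
    by apply: NA => x; rewrite !pchar_poly.
  by rewrite exprZn /fr comp_polyD comp_polyZ comp_polyX comp_polyC polyC_exp.
have gt t : t \in ts -> g \Po t = g.
  move=> tts; have /(congr1 (fun v : {poly {poly A}} => v.[t])) := gE.
  rewrite hornerD hornerN hornerC -/(g \Po t) (big_rem t tts) /= hornerM hornerXsubC subrr mul0r.
  by move/eqP; rewrite subr_eq0 => /eqP.
have hfr t : t \in ts -> h \Po fr t = h.
  move=> tts; apply: (comp_poly_inj_gt1 XN1) => /=; rewrite -comp_polyA frE //.
  by rewrite -comp_Xn_poly comp_polyA -ghE gt.
(* Roots are listed in [ts] with multiplicity, and g(X) - g(Y) has multiple ones when N > 1. *)
pose s := undup [seq fr t | t <- ts].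
have sP t : t \in s -> h \Po t = h by rewrite mem_undup => /mapP[u uts ->]; apply: hfr.
exists N, h, s; split; split=> //; first exact: undup_uniq.
have [|U UE] := @uniq_roots_factor _ (h^:P - h%:P) s (undup_uniq _).
  apply/allP => t ts'; rewrite rootE hornerD hornerN hornerC.
  by rewrite -[h^:P.[t]]/(h \Po t) sP ?subrr.
have pm : \prod_(t <- s) ('X - t%:P) \is monic by apply: monic_prod_XsubC.
have sH : size (h^:P - h%:P) = size h.
  rewrite size_polyDl ?size_map_polyC //.
  by rewrite size_polyN size_polyC; apply: leq_ltn_trans h1; case: (h != 0).
have U0 : U != 0.
  by apply: contraTneq h1 => z; rewrite -sH UE z mul0r size_poly0.
suff sU : (size U <= 1)%N.
  move: sH; rewrite UE size_Mmonic // size_prod_XsubC; rewrite -size_poly_gt0 in U0.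
  by move: (size U) (size s) (size h) sU U0 => x y z; clear; lia.
rewrite leqNgt; apply/negP => U1.
(* Substitution of X^N and Y^N, which turns h(X) - h(Y) into the split g(X) - g(Y). If the cofactor
   U were not constant, some t in [ts] would be a root of [sig U], making [fr t] a root of U as well
   as of the product over [s]; this double root contradicts that [h] has nonzero derivative. *)
pose sig (G : {poly {poly A}}) := map_poly (comp_poly 'X^N) G \Po 'X^N.
have sigM G H : sig (G * H) = sig G * sig H by rewrite /sig !rmorphM.
have sigH : sig (h^:P - h%:P) = g^:P - g%:P.
  rewrite /sig !rmorphB /= map_polyC /= comp_polyC -ghE; congr (_ - _).
  rewrite ghE map_comp_poly /= map_polyXn; congr (_ \Po _).
  by rewrite -map_poly_comp; apply: eq_map_poly => x /=; rewrite comp_polyC.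
have sigU : (1 < size (sig U))%N.
  have := size_comp_poly (map_poly (comp_poly 'X^N) U) 'X^N; rewrite size_polyXn /= -/(sig U).
  rewrite size_map_inj_poly ?comp_poly0 //; last exact: comp_poly_inj_gt1.
  by move: U1 N0; move: (size U) (size (sig U)) => x y; clear; nia.
have eU : sig U * sig (\prod_(t <- s) ('X - t%:P)) = \prod_(t <- ts) ('X - t%:P).
  by rewrite -sigM -UE sigH.
have [t tts] := root_of_split eU sigU.
have e3 : (map_poly (comp_poly 'X^N) U).[fr t \Po 'X^N] = U.[fr t] \Po 'X^N.
  exact: (horner_map (comp_poly 'X^N) U (fr t)).
have e4 : (sig U).[t] = U.[fr t] \Po 'X^N.
  by rewrite -e3 (frE t tts) /sig horner_comp hornerXn.
rewrite rootE e4 comp_poly_eq0 // => Ut.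
have fs : fr t \in s by rewrite mem_undup map_f.
have /(congr1 (fun v : {poly {poly A}} => v^`().[fr t])) := UE.
rewrite (big_rem _ fs) /= derivB derivC subr0 deriv_map mulrCA derivM derivXsubC mul1r.
rewrite hornerD !hornerM hornerXsubC subrr mul0r addr0 (eqP Ut) mul0r => /eqP.
rewrite -[_.[_]]/(h^`() \Po fr t) comp_poly_eq0 ?(negbTE h') //.
have := size_comp_poly h (fr t); rewrite hfr //; move: h1.
by move: (size h) (size (fr t)) => x y; clear; nia.
Qed.

End Inseparable.

(** * From the separable polynomial back to f *)

Section SpecialReduction.
Variable F : finFieldType.
Local Notation A := {poly F}.

Lemma frob_sub (R : comNzRingType) (N : nat) (x y : R) : [pchar R].-nat N ->
  x ^+ N - y ^+ N = (x - y) ^+ N.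
Proof. by move=> hN; rewrite -{1}(subrK y x) exprDn_pchar // addrK. Qed.

Lemma frob_sum (R : comNzRingType) (p : nat) (I : Type) (r : seq I) (E : I -> R) :
  p \in [pchar R] -> (\sum_(i <- r) E i) ^+ p = \sum_(i <- r) E i ^+ p.
Proof.
move=> cp; elim: r => [|i r IH].
  by rewrite !big_nil expr0n gtn_eqF // prime_gt0 // (pcharf_prime cp).
rewrite !big_cons exprDn_pchar ?IH // (eq_pnat _ (pcharf_eq cp)) pnat_id //.
exact: pcharf_prime cp.
Qed.

Lemma finfield_root (p : nat) (x : F) : p \in [pchar F] -> exists y, x = y ^+ p.
Proof.
move=> cp; have inj : injective (fun y : F => y ^+ p).
  move=> y z /eqP; rewrite -subr_eq0 frob_sub; last first.
    by rewrite (eq_pnat _ (pcharf_eq cp)) pnat_id // (pcharf_prime cp).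
  by rewrite expf_eq0 subr_eq0 => /andP[_ /eqP].
by have /codomP[y ->] := injF_onto inj x; exists y.
Qed.

(** A zero derivative leaves only powers of T^p, and the coefficients have p-th roots because a
    finite field is perfect. *)
Lemma poly_deriv0_root (p : nat) (a : A) : p \in [pchar F] -> a^`() = 0 ->
  exists y, a = y ^+ p.
Proof.
move=> cp a0; have [b bE] := deriv0_comp cp a0.
have [rt rtE] := choice (fun x => finfield_root x cp).
exists (\poly_(i < size b) rt b`_i); rewrite bE poly_def frob_sum ?pchar_poly //.
rewrite comp_polyE; apply: eq_bigr => i _.
by rewrite exprZn -exprM mulnC exprM -rtE.
Qed.

Lemma special_data (f : {poly A}) : irreducible_elt f -> special f -> (2 <= deg f)%N ->
  exists (N : nat) (h : {poly A}) (s : seq {poly A}),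
  [/\ [pchar F].-nat N, irreducible_poly (h \Po 'X^N), h \is monic, (1 < size h)%N & irreducible_poly h] /\
  [/\ h^`() != 0, uniq s, size s = (size h).-1, forall t, t \in s -> h \Po t = h &
   (forall x, lead_coef f ^+ (deg f).-1 * f.[x] = h.[(lead_coef f * x) ^+ N]) /\ (deg h <= deg f)%N].
Proof.
move=> fi fs d2; have f0 : f != 0 by case: fi.
have d0 : (0 < deg f)%N by apply: leq_trans d2.
have f1 : (1 < size f)%N by rewrite -degS // ltnS.
have firr := irreducible_elt_poly f1 fi.
have gi := monize_irreducible d0 firr.
have [ts [ts2 tsE]] := special_monize f0 d0 fs.
have g1 : (1 < size (monize f))%N by rewrite size_monize ltnS.
have [N [h [s [[hN gE hm h1 hi] [h' us ss sP]]]]] :=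
  insep_reduction (monize_monic f) g1 gi ts2 tsE.
exists N, h, s; split; split=> //; first by rewrite -gE.
split=> [x|].
  have /(congr1 (fun u : {poly A} => u.[x])) := monizeE f0 d0.
  by rewrite horner_comp gE horner_comp !hornerE => ->.
have := size_comp_poly h 'X^N; rewrite -gE size_monize size_polyXn /= -/(deg h) => ->.
by rewrite leq_pmulr //; case/andP: hN.
Qed.

(** The map r -> (c r)^N permutes the residues mod P, since P does not divide c and Frobenius is
    injective on a field; it carries roots of [f] to roots of [h]. *)
Lemma nroots_special (f h : {poly A}) (N : nat) (P : A) : mirr P -> ~~ (P %| lead_coef f) ->
  [pchar F].-nat N ->
  (forall x, lead_coef f ^+ (deg f).-1 * f.[x] = h.[(lead_coef f * x) ^+ N]) ->
  nroots f P = nroots h P.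
Proof.
move=> hP nP hN fE; have P0 := mirr_neq0 hP; set c := lead_coef f in nP fE.
pose phi (r : {poly_(deg P) F}) := npolyp (deg P) ((c * polyn r) ^+ N %% P).
have phiE r : polyn (phi r) = (c * polyn r) ^+ N %% P by rewrite npolypK ?size_modP.
have NA : [pchar A].-nat N by rewrite (eq_pnat _ (pchar_poly F)).
have N0 : (0 < N)%N by case/andP: hN.
have small (r : {poly_(deg P) F}) : polyn r %% P = polyn r.
  by rewrite modp_small // -(degS P0) ltnS size_npoly.
have inj : injective phi.
  move=> r r' /(congr1 (@polyn _ _)); rewrite !phiE => /eqP e.
  have : P %| (c * polyn r) ^+ N - (c * polyn r') ^+ N.
    by rewrite /dvdp modpD modpN subr_eq0.
  rewrite frob_sub // -mulrBr exprMn => dv.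
  have dv2 : P %| c ^+ N * (polyn r - polyn r') ^+ N by [].
  have {}dv : P %| polyn r - polyn r'.
    have Pexp x : P %| x ^+ N -> P %| x.
      elim: (N) => [|k IH]; first by rewrite expr0 dvdp1 gtn_eqF // mirr_size.
      by rewrite exprS => /(mirr_euclid hP)/orP[|/IH].
    case/(mirr_euclid hP)/orP: dv2 => /Pexp //.
    by rewrite (negbTE nP).
  apply: val_inj => /=; rewrite -(small r) -(small r').
  by apply/eqP; rewrite -subr_eq0 -modpN -modpD.
rewrite !nrootsE [RHS](reindex_inj inj) /=; apply: eq_bigl => r.
have -> : (P %| f.[polyn r]) = (P %| c ^+ (deg f).-1 * f.[polyn r]).
  by rewrite Gauss_dvdpr // coprimep_expr // mirr_coprime.
have dv := @dvdp_horner_congr F P h ((c * polyn r) ^+ N) (polyn (phi r)) _.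
rewrite fE -[h.[_]](subrK h.[polyn (phi r)]) dvdp_addr // dv // phiE.
rewrite {1}(divp_eq ((c * polyn r) ^+ N) P) addrK; exact: dvdp_mulIr.
Qed.

Theorem special_mertens (R : realType) (f : {poly A}) (eps : R) :
  irreducible_elt f -> special f -> (2 <= deg f)%N -> 0 < eps ->
  exists2 M0 : A, M0 != 0 &
  forall M, M != 0 -> M0 %| M -> exists n0, forall n, (n0 <= n)%N ->
    `|mertens_sum R f M n - n%:R| <= eps * n%:R.
Proof.
move=> fi fs d2 e0.
have [N [h [s [[hN gi hm h1 hi] [h' us ss sP [fE dh]]]]]] := special_data fi fs d2.
have [M0 M00 hM0] := mertens_asymp hm h1 us ss sP hi h' e0.
have f0 : f != 0 by case: fi.
exists (M0 * lead_coef f); first by rewrite mulf_neq0 // lead_coef_eq0.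
move=> M Mn0 dv.
have [|n0 hn0] := hM0 M Mn0; first by apply: dvdp_trans dv; apply: dvdp_mulIl.
exists n0 => n /hn0; congr (`|_ - _| <= _); rewrite /mertens_sum.
rewrite big_seq_cond [RHS]big_seq_cond; apply: eq_bigr => P /andP[].
rewrite mem_irreds => /andP[hP _] nP; rewrite (nroots_special hP _ hN fE) //.
by apply: contra nP => Pl; apply: dvdp_trans dv; apply: dvdp_mull.
Qed.

Lemma dvdp_sqr_deriv (P y : A) : P ^+ 2 %| y -> P %| y^`().
Proof.
case/dvdpP=> w ->; rewrite derivM; apply: dvdp_add.
  by apply: dvdp_mull; rewrite exprS dvdp_mulIl.
by apply: dvdp_mull; rewrite expr2 derivM dvdp_add // ?dvdp_mulIl ?dvdp_mulIr.
Qed.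

Lemma deriv_horner (h : {poly A}) (z : A) :
  (h.[z])^`() = (map_poly (@deriv F) h).[z] + h^`().[z] * z^`().
Proof.
elim/poly_ind: h => [|h a IH].
  by rewrite deriv0 !horner0 deriv0 map_poly0 horner0 mul0r addr0.
have -> : map_poly (@deriv F) (h * 'X + a%:P) = map_poly (@deriv F) h * 'X + (a^`())%:P.
  apply/polyP => i; rewrite coefD coefMX coefC !coef_map_id0 ?deriv0 //.
  by rewrite coefD coefMX coefC derivD; case: i => [|i] /=; rewrite ?deriv0.
rewrite derivMXaddC hornerD !hornerMXaddC hornerMX derivD derivM IH; ring.
Qed.

(** For N = 1, fix one solution x2: P^2 divides the product of the c x - t(c x2), and two factors
    cannot share P because conjugate roots are distinct mod P. So P^2 divides one factor, which
    fixes x mod P^2. For N > 1 no solution exists. *)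
Lemma special_sqr (f : {poly A}) :
  irreducible_elt f -> special f -> (2 <= deg f)%N ->
  exists2 b : A, b != 0 & forall P, mirr P -> ~~ (P %| b) ->
    (nroots f P <= deg f)%N /\
    exists ys : seq A, (size ys <= deg f)%N /\
      forall x, P ^+ 2 %| f.[x] -> exists2 y, y \in ys & P ^+ 2 %| x - y.
Proof.
move=> fi fs d2.
have [N [h [s [[hN gi hm h1 hi] [h' us ss sP [fE dh]]]]]] := special_data fi fs d2.
have f0 : f != 0 by case: fi.
set c := lead_coef f in fE; have c0 : c != 0 by rewrite lead_coef_eq0.
have [b1 b10 hb1] := sep_exists hm hi h'.
have rle P : mirr P -> ~~ (P %| c) -> ~~ (P %| b1) -> (nroots f P <= deg f)%N.
  move=> hP nc nb; rewrite (nroots_special hP nc hN fE); apply: leq_trans dh.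
  exact: (nroots_le hm h1 us ss sP hP (hb1 P nb)).
have [N1|N1] := eqVneq N 1%N.
  exists (c * b1); first by rewrite mulf_neq0.
  move=> P hP nP.
  have nc : ~~ (P %| c) by apply: contra nP => dv; apply: dvdp_mulr.
  have nb : ~~ (P %| b1) by apply: contra nP => dv; apply: dvdp_mull.
  split; first exact: rle.
  have [[x2 Px2]|nx] := pselect (exists x, P ^+ 2 %| f.[x]); last first.
    by exists [::]; split=> // x Px; case: nx; exists x.
  have hdv x : P ^+ 2 %| f.[x] -> P ^+ 2 %| h.[c * x].
    by move=> dv; have := fE x; rewrite N1 expr1 => <-; apply: dvdp_mull.
  have cop : coprimep c (P ^+ 2) by rewrite coprimep_sym coprimep_expl // mirr_coprime.
  have /Bezout_eq1_coprimepP[[u v] /= uv] := cop.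
  exists [seq u * t.[c * x2] | t <- s]; split; first by rewrite size_map ss.
  move=> x Px; have : P ^+ 2 %| \prod_(t <- s) (c * x - t.[c * x2]).
    by rewrite -(stab_horner hm h1 us ss sP) dvdp_sub // hdv.
  have Ph2 : P %| h.[c * x2] by apply: dvdp_trans (hdv _ Px2); rewrite expr2 dvdp_mulIl.
  case/(dvdp_prod_sqr hP us) => [[t [t' [ts ts' tt' Pt Pt']]]|[t ts Pt]].
    have := stab_distinct hm h1 us ss sP (hb1 P nb) Ph2 ts ts' tt'.
    have -> : t.[c * x2] - t'.[c * x2] = (c * x - t'.[c * x2]) - (c * x - t.[c * x2]) by ring.
    by rewrite dvdp_sub.
  exists (u * t.[c * x2]); first by apply/mapP; exists t.
  have -> : x - u * t.[c * x2] = u * (c * x - t.[c * x2]) + v * x * P ^+ 2.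
    by rewrite -{1}[x]mul1r -uv; ring.
  by apply: dvdp_add; [exact: dvdp_mull | exact: dvdp_mulIr].
(* Inseparable case: with [hT] the derivative of [h] in T, P^2 | h(z) and z' = 0 give
   P | hT(z), and [hT] is coprime to [h], as otherwise h(X^N) would be a p-th power. *)
have [p pp cp] := finPcharP F.
have pN : (p %| N)%N.
  have /andP[N0 _] := hN; have N1' : (1 < N)%N by rewrite ltn_neqAle eq_sym N1.
  have := pnatP _ N0 => /(_ [pchar F])/elimT/(_ hN) pNat.
  have := pNat _ (pdiv_prime N1') (pdiv_dvd N); rewrite (pcharf_eq cp) inE => /eqP <-.
  exact: pdiv_dvd.
pose hT := map_poly (@deriv F) h.
have hTi i : hT`_i = (h`_i)^`() by rewrite coef_map_id0 ?deriv0.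
have hT0 : hT != 0.
  apply/eqP => hT0; have hi0 i : (h`_i)^`() = 0 by rewrite -hTi hT0 coef0.
  have [rt rtE] := choice (fun i => poly_deriv0_root cp (hi0 i)).
  pose w : {poly A} := \sum_(i < size h) rt i *: 'X^(i * (N %/ p)).
  have wE : w ^+ p = h \Po 'X^N.
    rewrite /w frob_sum ?pchar_poly ?pchar_poly // comp_polyE; apply: eq_bigr => i _.
    by rewrite exprZn -!exprM -rtE -mulnA divnK // mulnC.
  have [g1 irr] := gi; have p1 := prime_gt1 pp.
  have sw : ((size (h \Po 'X^N)).-1 = (size w).-1 * p)%N by rewrite -wE size_exp.
  have : w %= h \Po 'X^N.
    apply: irr; last by rewrite -wE -(prednK (prime_gt0 pp)) exprS dvdp_mulIl.
    by apply: contraTneq g1 => w1; move: sw; rewrite w1 /= mul0n; move: (size _) => x; clear; lia.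
  move/eqp_size => e; move: sw; rewrite e; move: g1.
  by move: (size _) => x; move: p1; clear; nia.
have shT : (size hT < size h)%N.
  have h0 := monic_neq0 hm.
  rewrite -(degS h0) ltnS; apply/leq_sizeP => j jd; rewrite hTi.
  have [le|] := leqP (size h) j; first by rewrite nth_default // deriv0.
  rewrite -(degS h0) ltnS => jd2.
  have -> : j = deg h by apply/eqP; rewrite eqn_leq jd jd2.
  by rewrite -[h`_(deg h)]/(lead_coef h) (eqP hm) derivC.
have [u [v [b2 [b20 uvb]]]] := irreducible_bezout hi hT0 shT.
exists (c * b1 * b2); first by rewrite !mulf_neq0.
move=> P hP nP.
have nc : ~~ (P %| c) by apply: contra nP => dv; rewrite -mulrA dvdp_mulr.
have nb : ~~ (P %| b1) by apply: contra nP => dv; rewrite dvdp_mulr // dvdp_mull.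
have nb2 : ~~ (P %| b2) by apply: contra nP => dv; apply: dvdp_mull.
split; first exact: rle.
exists [::]; split=> // x Px; case/negP: nb2.
set z := (c * x) ^+ N; have Pz : P ^+ 2 %| h.[z] by rewrite -fE dvdp_mull.
have z' : z^`() = 0.
  rewrite /z deriv_exp -mulr_natr.
  have -> : (N%:R : A) = 0 by apply/eqP; rewrite -(dvdn_pcharf (_ : p \in [pchar A])) // pchar_poly.
  by rewrite mulr0.
have := dvdp_sqr_deriv Pz; rewrite deriv_horner z' mulr0 addr0 => PT.
have /(congr1 (fun u : {poly A} => u.[z])) := uvb; rewrite !hornerE => <-.
rewrite dvdp_add // dvdp_mull //; apply: dvdp_trans Pz; rewrite expr2; exact: dvdp_mulIl.
Qed.

End SpecialReduction.

(** * Values at monic polynomials *)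

Section MonicCounting.
Variable F : finFieldType.
Local Notation A := {poly F}.
Local Notation q := #|F|.

Lemma vp_mulM (P a b : A) : mirr P -> a != 0 -> b != 0 -> vp P (a * b) = (vp P a + vp P b)%N.
Proof.
move=> hP; elim: {a}(size a) {-2}a (leqnn (size a)) => [|n IH] a sa a0 b0.
  by move: sa; rewrite leqn0 size_poly_eq0 (negbTE a0).
have ab0 : a * b != 0 by rewrite mulf_neq0.
case: (boolP (P %| a)) => [/dvdpP[a' aE]|nPa].
  have a'0 : a' != 0 by apply: contraNneq a0 => z; rewrite aE z mul0r.
  have sa' : (size a' <= n)%N.
    move: sa; rewrite aE size_mul //; last exact: mirr_neq0.
    have := mirr_size hP; rewrite -size_poly_gt0 in a'0.
    by move: (size a') (size P) a'0 => x y; clear; lia.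
  by rewrite aE (mulrC a') -mulrA (vp_mul hP hP) ?mulf_neq0 // (vp_mul hP hP a'0) eqxx IH // addnA.
have -> : vp P a = 0%N by apply/eqP; rewrite -leqn0 leqNgt vp_gt0.
apply: vp_uniq => // k; rewrite add0n -dvdp_exp_vp // Gauss_dvdpr //.
by rewrite coprimep_expl // mirr_coprime.
Qed.

(** Pigeonhole on valuations: factors of valuation below [j] cannot reach [size r * j] together. *)
Lemma dvdp_exp_prod (I : eqType) (P : A) (r : seq I) (E : I -> A) j : mirr P -> r != [::] ->
  P ^+ (size r * j) %| \prod_(i <- r) E i -> exists2 i, i \in r & P ^+ j %| E i.
Proof.
move=> hP r0 dv.
have [/hasP[i ir /eqP Ei]|/hasPn n0] := boolP (has (fun i => E i == 0) r).
  by exists i; rewrite // Ei dvdp0.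
apply: contrapT => ne.
have lt i : i \in r -> (vp P (E i) < j)%N.
  move=> ir; rewrite ltnNge -dvdp_exp_vp ?n0 //; apply/negP => h; apply: ne; by exists i.
have key (r' : seq I) : {subset r' <= r} -> (\prod_(i <- r') E i != 0) /\
    (r' != [::] -> vp P (\prod_(i <- r') E i) < size r' * j)%N.
  elim: r' => [|i r' IH] sub; first by rewrite big_nil oner_neq0.
  have [|p0 IH2] := IH; first by move=> k kr; apply: sub; rewrite inE kr orbT.
  have ir : i \in r by apply: sub; rewrite mem_head.
  rewrite big_cons; split; first by rewrite mulf_neq0 ?n0.
  move=> _; rewrite vp_mulM ?n0 // mulSn; have := lt i ir.
  case: r' {sub IH} p0 IH2 => [_ _|k r' _ /(_ isT)] /=.
    rewrite big_nil; have -> : vp P 1 = 0%N.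
      by apply: vp_uniq; rewrite ?oner_neq0 // => k; rewrite dvdp1 leqn0; case: k => [|k];
        rewrite ?expr0 ?size_poly1 // gtn_eqF // (leq_ltn_trans _ (size_mirr_exp k.+1 hP)).
    lia.
  set w := (_ * j)%N => h1 h2; rewrite -/(size r') -/w.
  by move: h1 h2; move: (vp P _) (vp P _) => x y; clear; lia.
have [p0 /(_ r0)] := key r (fun i ir => ir).
by rewrite ltnNge -dvdp_exp_vp // dv.
Qed.

(* [monic_pt] identifies {poly_n F} with M_n. *)
Definition monic_pt n (u : {poly_n F}) : A := 'X^n + polyn u.

Lemma size_monic_pt n (u : {poly_n F}) : size (monic_pt u) = n.+1.
Proof. by rewrite size_polyDl size_polyXn // ltnS size_npoly. Qed.

Lemma monic_pt_monic n (u : {poly_n F}) : monic_pt u \is monic.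
Proof. by rewrite monicE lead_coefDl ?lead_coefXn // size_polyXn ltnS size_npoly. Qed.

Lemma deg_monic_pt n (u : {poly_n F}) : deg (monic_pt u) = n.
Proof. by rewrite /deg size_monic_pt. Qed.

Lemma monic_ptP n (Q : A) : Q \is monic -> deg Q = n -> exists u : {poly_n F}, Q = monic_pt u.
Proof.
move=> Qm dQ; have Q0 := monic_neq0 Qm.
have sz : (size (Q - 'X^n)%R <= n)%N.
  apply/leq_sizeP => j nj; rewrite coefB coefXn.
  move: nj; rewrite leq_eqVlt => /orP[/eqP<-|lt].
    by rewrite eqxx -dQ -[Q`_(deg Q)]/(lead_coef Q) (eqP Qm) subrr.
  by rewrite (gtn_eqF lt) subr0 nth_default // -degS // dQ.
by exists (NPoly sz); rewrite /monic_pt /= addrC subrK.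
Qed.

Lemma card_monic_pt_res n (m y : A) : m != 0 -> (deg m <= n)%N ->
  (#|[pred u : {poly_n F} | (m %| monic_pt u - y)%R]| * q ^ deg m = q ^ n)%N.
Proof.
move=> m0 mn; pose psi (u : {poly_n F}) := npolyp (deg m) (polyn u %% m).
have sm (x : A) : (size (x %% m)%R <= deg m)%N by rewrite -ltnS degS // ltn_modp.
have psiE u v : psi u = psi v <-> polyn u %% m = polyn v %% m.
  split=> [/(congr1 (@polyn _ _))|e]; first by rewrite !npolypK.
  by rewrite /psi e.
have := @card_fibers _ _ psi (fun u0 v0 x0 => x0 - u0 + v0) _ _ _ _ (npolyp (deg m) ((y - 'X^n) %% m)).
rewrite !card_npoly => <-.
- congr (_ * _)%N; apply: eq_card => u; rewrite !inE.
  have -> : monic_pt u - y = polyn u - (y - 'X^n) by rewrite /monic_pt; ring.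
  apply/idP/asboolP => [dv|/(congr1 (@polyn _ _))].
    congr npolyp; apply/eqP; rewrite -subr_eq0 -modpN -modpD; exact: dv.
  by rewrite !npolypK // => e; rewrite /dvdp modpD modpN e subrr.
- by move=> u0 v0; apply: (can_inj (g := fun x => x - v0 + u0)) => x; rewrite addrK subrK.
- by move=> u0 v0; rewrite subrr add0r.
- by move=> u0 v0 x x' /psiE e; apply/psiE; rewrite /= !modpD !modpN e.
move=> z; exists (npolyp n (polyn z)); apply: val_inj => /=.
rewrite npolypK // npolypK ?modp_small // ?(leq_trans (size_npoly z)) //.
by rewrite -(degS m0) ltnS size_npoly.
Qed.

(** The truncated exponent covers both ranges: for deg m > n it is 0, and two solutions would differ
    by a nonzero multiple of [m] of too small degree. *)
Lemma card_monic_pt_le n (m y : A) : m != 0 ->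
  (#|[pred u : {poly_n F} | (m %| monic_pt u - y)%R]| <= q ^ (n - deg m))%N.
Proof.
move=> m0; have [le|lt] := leqP (deg m) n.
  have qm : (0 < q ^ deg m)%N by rewrite expn_gt0 (ltnW (card_finNzRing_gt1 F)).
  by rewrite -(leq_pmul2r qm) card_monic_pt_res // -expnD subnK.
rewrite (eqP (_ : n - deg m == 0)%N) ?expn0 ?subn_eq0 ?(ltnW lt) //.
apply/card_le1_eqP => u v; rewrite !inE => du dv; apply: val_inj => /=; apply/eqP.
have dv' : m %| polyn v - polyn u.
  have -> : polyn v - polyn u = (monic_pt v - y) - (monic_pt u - y) by rewrite /monic_pt; ring.
  exact: dvdp_sub.
rewrite -subr_eq0; apply: contraTT lt => ne; rewrite -leqNgt.
have := dvdp_leq ne dv'; rewrite -(degS m0) => h; apply: leq_trans (ltnW h) _.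
by apply: leq_trans (size_polyD _ _) _; rewrite size_polyN geq_max !size_npoly.
Qed.

Lemma card_monic_pt_cover n (X : pred {poly_n F}) (ys : seq A) (m : A) : m != 0 ->
  (forall u, X u -> exists2 y, y \in ys & m %| monic_pt u - y) ->
  (#|X| <= size ys * q ^ (n - deg m))%N.
Proof.
move=> m0 cov; apply: leq_trans (_ : \sum_(y <- ys) #|[pred u : {poly_n F} | (m %| monic_pt u - y)%R]| <= _)%N.
  apply: leq_trans (_ : \sum_u \sum_(y <- ys) ((m %| monic_pt u - y)%R : nat) <= _)%N.
    rewrite -sum1_card big_mkcond /=; apply: leq_sum => u _; case: ifP => // /cov[y yys dv].
    by rewrite (big_rem y) //= dv.
  rewrite exchange_big; apply: eq_leq; apply: eq_bigr => y _.
  by rewrite -sum1_card [RHS]big_mkcond /=; apply: eq_bigr => u _; rewrite inE; case: (_ %| _).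
rewrite -sum1_size big_distrl /=; apply: leq_sum => y _; rewrite mul1n; exact: card_monic_pt_le.
Qed.

Section Values.
Variable f : {poly A}.

Lemma card_root_monic_pt n (P : A) : mirr P ->
  #|[pred u : {poly_n F} | (P %| f.[monic_pt u])%R]| =
  (\sum_(r : {poly_(deg P) F} | (P %| f.[polyn r])%R)
     #|[pred u : {poly_n F} | (P %| monic_pt u - polyn r)%R]|)%N.
Proof.
move=> hP; have P0 := mirr_neq0 hP.
pose res (u : {poly_n F}) := npolyp (deg P) (monic_pt u %% P).
have resE u : polyn (res u) = monic_pt u %% P by rewrite npolypK ?size_modP.
have resD u : P %| monic_pt u - polyn (res u).
  by rewrite resE {1}(divp_eq (monic_pt u) P) addrK dvdp_mulIr.
have tr (x y : A) : P %| x - y -> (P %| f.[x]) = (P %| f.[y]).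
  by move=> /(@dvdp_horner_congr F P f) dv; rewrite -[f.[x]](subrK f.[y]) dvdp_addr.
rewrite -sum1_card (partition_big res (fun r => P %| f.[polyn r])) /=; last first.
  by move=> u; rewrite inE (tr _ _ (resD u)).
apply: eq_bigr => r Pr; rewrite -sum1_card; apply: eq_bigl => u; rewrite !inE.
apply/andP/idP => [[_ /eqP <-]//|dv]; split; first by rewrite (tr _ _ dv).
apply/eqP/val_inj; rewrite /= resE -[RHS](@modp_small _ _ P); last first.
  by rewrite -(degS P0) ltnS size_npoly.
by apply/eqP; rewrite -subr_eq0 -modpN -modpD; exact: dv.
Qed.

Lemma card_root_exact n (P : A) : mirr P -> (deg P <= n)%N ->
  (#|[pred u : {poly_n F} | (P %| f.[monic_pt u])%R]| * q ^ deg P = nroots f P * q ^ n)%N.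
Proof.
move=> hP le; rewrite card_root_monic_pt // nrootsE !big_distrl /=; apply: eq_bigr => r _.
by rewrite card_monic_pt_res ?mirr_neq0 // mul1n.
Qed.

Lemma card_root_le n (P : A) : mirr P -> (n < deg P)%N ->
  (#|[pred u : {poly_n F} | (P %| f.[monic_pt u])%R]| <= nroots f P)%N.
Proof.
move=> hP lt; rewrite card_root_monic_pt // nrootsE; apply: leq_sum => r _.
have := card_monic_pt_le n (polyn r) (mirr_neq0 hP).
by rewrite (eqP (_ : n - deg P == 0)%N) ?expn0 // subn_eq0 ltnW.
Qed.

(** Once [n] is at least the size of every coefficient, the leading term strictly dominates the
    value. *)
Lemma deg_horner_monic_pt : f != 0 -> (0 < deg f)%N -> exists n1, forall n, (n1 <= n)%N ->
  forall u : {poly_n F}, f.[monic_pt u] != 0 /\ deg f.[monic_pt u] = (deg f * n + deg (lead_coef f))%N.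
Proof.
move=> f0 d0; exists (\max_(i < size f) size (f`_i)%R)%N => n n1 u.
have lc0 : lead_coef f != 0 by rewrite lead_coef_eq0.
have coefn i : (size (f`_i)%R <= n)%N.
  have [ii|ii] := ltnP i (size f); last by rewrite nth_default // size_poly0.
  apply: leq_trans n1.
  exact: (bigop.leq_bigmax_cond (F := fun i : 'I_(size f) => size f`_i) (Ordinal ii)).
have sQ i : size (monic_pt u ^+ i) = (n * i).+1.
  have := size_exp (monic_pt u) i; rewrite size_monic_pt /= => <-.
  by rewrite prednK // size_poly_gt0 expf_neq0 // monic_neq0 // monic_pt_monic.
have topsz : size (lead_coef f * monic_pt u ^+ deg f) = (deg f * n + size (lead_coef f))%N.
  by rewrite size_Mmonic ?monic_exp ?monic_pt_monic // sQ addnS /= mulnC addnC.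
have sz : size f.[monic_pt u] = (deg f * n + size (lead_coef f))%N.
  rewrite horner_coef -(degS f0) big_ord_recr /= addrC size_polyDl topsz //.
  have lcs : (0 < size (lead_coef f))%N by rewrite size_poly_gt0.
  apply: leq_ltn_trans (_ : deg f * n < _)%N; last by rewrite -[ltnLHS]addn0 ltn_add2l.
  apply: leq_trans (size_sum _ _ _) _; apply/bigmax_leqP => i _.
  apply: leq_trans (size_polyMleq _ _) _; rewrite sQ addnS /=.
  apply: leq_trans (leq_add (coefn i) (leqnn _)) _.
  by rewrite -mulnS mulnC leq_mul2r ltn_ord orbT.
split; first by rewrite -size_poly_gt0 sz addn_gt0 size_poly_gt0 lc0 orbT.
by rewrite /deg sz -(degS lc0) addnS.
Qed.

(* Fixing one value divisible by P^(d j), any other one makes one of the linear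
   factors divisible by P^j, which pins its argument modulo P^J. *)
Lemma special_deep (P : A) (J : nat) : f != 0 -> (0 < deg f)%N -> special f -> mirr P ->
  exists K, forall n,
    (#|[pred u : {poly_n F} | (P ^+ K %| f.[monic_pt u])%R]| <= deg f * q ^ (n - J * deg P))%N.
Proof.
move=> f0 d0 [_ [a [b [c e0]]]] hP; have e := special_comp e0.
have [lcE a0 _] := special_lead f0 d0 e; have eh := special_horner e.
have lc0 : lead_coef f != 0 by rewrite lead_coef_eq0.
(* [tau] bounds the power of P in each a_i, as these divide the leading coefficient; it is lost when
   a_i is cancelled below. *)
pose tau := vp P (lead_coef f); pose j := (tau + J)%N.
exists (deg f * j)%N => n.
have [[u2 Pu2]|none] := pselect (exists u2 : {poly_n F}, P ^+ (deg f * j) %| f.[monic_pt u2]); last first.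
  by rewrite eq_card0 // => u; rewrite inE; apply/negP => h; apply: none; exists u.
pose good i x := P ^+ j %| a i * x + b i * monic_pt u2 + c i.
(* A reference solution for the i-th factor; the default 0 is reached only when there is none. *)
pose yi i : A := if pselect (exists x, good i x) is left h then sval (cid h) else 0.
have yiP i x : good i x -> good i (yi i).
  by rewrite /yi => gx; case: pselect => [h|[]]; [exact: svalP (cid h) | exists x].
apply: leq_trans (@card_monic_pt_cover n _ [seq yi i | i <- enum 'I_(deg f)] (P ^+ J) _ _) _.
- by rewrite expf_neq0 // mirr_neq0.
- move=> u Pu; have : P ^+ (deg f * j) %| \prod_(i <- enum 'I_(deg f)) (a i * monic_pt u + b i * monic_pt u2 + c i).
    by rewrite big_enum /= -eh dvdp_sub.
  rewrite -{1}(size_enum_ord (deg f)) => /(dvdp_exp_prod hP)[|i _ gi].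
    by rewrite -size_eq0 size_enum_ord gtn_eqF.
  exists (yi i); first by rewrite map_f // mem_enum.
  have gy := yiP i _ gi.
  have : P ^+ j %| a i * (monic_pt u - yi i).
    have -> : a i * (monic_pt u - yi i) = (a i * monic_pt u + b i * monic_pt u2 + c i) - (a i * yi i + b i * monic_pt u2 + c i) by ring.
    exact: dvdp_sub.
  have [->|ne] := eqVneq (monic_pt u) (yi i); first by rewrite subrr dvdp0.
  rewrite -subr_eq0 in ne.
  rewrite !dvdp_exp_vp ?mulf_neq0 // vp_mulM // => le.
  have : (vp P (a i) <= tau)%N.
    rewrite -dvdp_exp_vp // lcE (bigD1 i) //=; apply: dvdp_mulr.
    by rewrite dvdp_exp_vp.
  by move: le; rewrite /j; move: (vp P _) (vp P _) => x y; clear; lia.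
by rewrite size_map size_enum_ord deg_exp (mulnC (deg P)).
Qed.

End Values.

End MonicCounting.

(** * The least common multiple *)

Section LcmStructure.
Variable F : finFieldType.
Local Notation A := {poly F}.
Local Notation q := #|F|.
Variable f : {poly A}.

Section FixedDegree.
Variable n : nat.
Hypothesis fn0 : forall u : {poly_n F}, f.[monic_pt u] != 0.
Local Notation L := (L_ f n).

Lemma dvdp_L (u : {poly_n F}) : f.[monic_pt u] %| L.
Proof. by move: (dvdpp L) => /L_P; apply; rewrite ?monic_pt_monic ?deg_monic_pt. Qed.

Lemma L_dvdp m : (forall u : {poly_n F}, f.[monic_pt u] %| m) -> L %| m.
Proof. by move=> h; apply/L_P => Q Qm /(monic_ptP Qm)[u ->]. Qed.

Lemma L_neq0 : L != 0.
Proof.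
have p0 : \prod_(u : {poly_n F}) f.[monic_pt u] != 0 by apply/prodf_neq0 => u _; apply: fn0.
apply: contraNneq p0 => L0; rewrite -dvd0p -L0; apply: L_dvdp => u.
by rewrite (bigD1 u) //= dvdp_mulIl.
Qed.

Lemma vp_le_L (P : A) (u : {poly_n F}) : mirr P -> (vp P f.[monic_pt u] <= vp P L)%N.
Proof.
move=> hP; rewrite -dvdp_exp_vp ?L_neq0 //; apply: dvdp_trans (dvdp_L u).
by rewrite dvdp_exp_vp.
Qed.

(** If no value carried the full power of P, lowering that power by one would leave a common
    multiple of smaller degree. *)
Lemma vp_L_exists (P : A) : mirr P -> (0 < vp P L)%N ->
  exists u : {poly_n F}, (vp P L <= vp P f.[monic_pt u])%N.
Proof.
move=> hP k0; apply: contrapT => none; have L0 := L_neq0; have P0 := mirr_neq0 hP.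
have lt (u : {poly_n F}) : (vp P f.[monic_pt u] < vp P L)%N.
  by rewrite ltnNge; apply/negP => h; apply: none; exists u.
have : P ^+ vp P L %| L by rewrite dvdp_exp_vp.
case/dvdpP => L' LE; set k := vp P L in k0 lt LE.
have L'0 : L' != 0 by apply: contraNneq L0 => z; rewrite LE z mul0r.
have : L %| L' * P ^+ k.-1.
  apply: L_dvdp => u; have : P ^+ vp P f.[monic_pt u] %| f.[monic_pt u] by rewrite dvdp_exp_vp.
  case/dvdpP => w wE; have w0 : w != 0 by apply: contraNneq (fn0 u) => z; rewrite wE z mul0r.
  have nPw : ~~ (P %| w).
    apply/negP => Pw; have : P ^+ (vp P f.[monic_pt u]).+1 %| f.[monic_pt u].
      by rewrite {2}wE exprS dvdp_mul.
    by rewrite dvdp_exp_vp // ltnn.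
  have wL' : w %| L'.
    rewrite -(Gauss_dvdpl _ (q := P ^+ k)); last by rewrite coprimep_sym coprimep_expl // mirr_coprime.
    by rewrite -LE; apply: dvdp_trans (dvdp_L u); rewrite wE dvdp_mulIl.
  rewrite wE dvdp_mul // dvdp_exp2l // -ltnS prednK // lt.
have L1 : L' * P ^+ k.-1 != 0 by rewrite mulf_neq0 // expf_neq0.
move/(dvdp_leq L1); rewrite leqNgt => /negP; apply.
have -> : L = (L' * P ^+ k.-1) * P by rewrite LE -mulrA -exprSr prednK.
rewrite [ltnRHS]size_mul //; have := mirr_size hP.
by move: (size _) (size P) => x y; clear; lia.
Qed.

Lemma vp_L_deg (P : A) e0 : mirr P -> (forall u : {poly_n F}, deg f.[monic_pt u] = e0) ->
  (deg P * vp P L <= e0)%N.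
Proof.
move=> hP de; have [->|k0] := posnP (vp P L); first by rewrite muln0.
have [u le] := vp_L_exists hP k0; rewrite -(de u).
apply: leq_trans (_ : deg P * vp P f.[monic_pt u] <= _)%N; first by rewrite leq_mul2l le orbT.
rewrite -deg_exp; have : P ^+ vp P f.[monic_pt u] %| f.[monic_pt u] by rewrite dvdp_exp_vp.
by move/(dvdp_leq (fn0 u)); rewrite /deg; move: (size _) (size _) => x y; clear; lia.
Qed.

End FixedDegree.

Hypotheses (f0 : f != 0) (d0 : (0 < deg f)%N) (fs : special f).
Local Notation vs := (fset_set (V_ f)).

Lemma memV g : (g \in vs) = `[< V_ f g >].
Proof.
rewrite in_fset_set; last exact: finite_V.
by apply/idP/idP => [/set_mem h|/asboolP h]; [apply/asboolP | exact: mem_set].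
Qed.

Lemma V_horner g x : V_ f g -> f.[x + g] = f.[x].
Proof.
by move=> /(congr1 (fun p : {poly A} => p.[x])); rewrite horner_comp !hornerE.
Qed.

Lemma cardV_gt0 : (0 < #|` vs|)%N.
Proof.
have : 0 \in vs by rewrite memV; apply/asboolP; rewrite /V_ /= addr0 comp_polyXr.
by rewrite cardfs_gt0 => h; apply/fset0Pn; exists 0.
Qed.

Lemma V_bound : exists n2, forall g, V_ f g -> (size g <= n2)%N.
Proof.
exists (\max_(g <- enum_fset vs) size g)%N => g Vg.
have gv : g \in enum_fset vs by have : g \in vs by rewrite memV; apply/asboolP.
elim: (enum_fset vs) gv => // x r IH; rewrite inE big_cons leq_max => /orP[/eqP->|/IH->].
  by rewrite leqnn.
by rewrite orbT.
Qed.

(* For such [P] the linear factor divisible by [P] has degree less than deg P, so it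
   vanishes; comparing leading terms, it is a multiple of X - Y - g with g in V_f. *)
Lemma large_prime_stab : exists C1, forall n, (C1 <= n)%N -> forall P, mirr P -> (n + C1 < deg P)%N ->
  forall u1 u2 : {poly_n F}, P %| f.[monic_pt u1] -> P %| f.[monic_pt u2] -> V_ f (polyn u1 - polyn u2).
Proof.
have [_ [a [b [c e0]]]] := fs; have e := special_comp e0.
have [lcE a0 bE] := special_lead f0 d0 e; have eh := special_horner e.
pose C1 := (\sum_i (size (a i) + size (b i) + size (c i)))%N.
have C1i i : (size (a i) + size (b i) + size (c i) <= C1)%N.
  by rewrite /C1 (bigD1 i) //= leq_addr.
exists C1 => n nC P hP big u1 u2 P1 P2.
have : P %| \prod_(i <- index_enum 'I_(deg f)) (a i * monic_pt u1 + b i * monic_pt u2 + c i).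
  by rewrite -eh dvdp_sub.
case/(mirr_dvd_prod hP) => i _ dv.
have sm (x : A) (u : {poly_n F}) : (size (x * monic_pt u)%R <= size x + n)%N.
  by apply: leq_trans (size_polyMleq _ _) _; rewrite size_monic_pt addnS.
have l0 : a i * monic_pt u1 + b i * monic_pt u2 + c i = 0.
  apply/eqP; apply: contraTT big => ne; rewrite -leqNgt.
  have := dvdp_leq ne dv; rewrite -(degS (mirr_neq0 hP)) => h; apply: leq_trans (ltnW h) _.
  apply: leq_trans (size_polyD _ _) _; rewrite geq_max; apply/andP; split.
    apply: leq_trans (size_polyD _ _) _; rewrite geq_max; apply/andP; split.
      by apply: leq_trans (sm _ _) _; have := C1i i; move: (size (a i)) (size (b i)) (size (c i)) (C1) => x1 x2 x3 x4; clear; lia.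
    by apply: leq_trans (sm _ _) _; have := C1i i; move: (size (a i)) (size (b i)) (size (c i)) (C1) => x1 x2 x3 x4; clear; lia.
  by have := C1i i; move: (size (a i)) (size (b i)) (size (c i)) (C1) => x1 x2 x3 x4; clear; lia.
have [z z0 biE] := bE i.
have e1 : a i * (monic_pt u1 - z%:P * monic_pt u2) = - c i.
  by apply/eqP; rewrite -subr_eq0 opprK -l0 biE; apply/eqP; ring.
have z1 : z = 1.
  apply/eqP; apply: contraTT nC => z1; rewrite -ltnNge.
  have tn : (monic_pt u1 - z%:P * monic_pt u2)`_n != 0.
    have lcq (u : {poly_n F}) : (monic_pt u)`_n = 1.
      by have := monic_pt_monic u; rewrite monicE /lead_coef size_monic_pt => /eqP.
    by rewrite coefB coefCM !lcq mulr1 subr_eq0 eq_sym.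
  have sn : (n < size (monic_pt u1 - z%:P * monic_pt u2)%R)%N.
    by rewrite ltnNge; apply: contra tn => le; rewrite nth_default.
  have ne : monic_pt u1 - z%:P * monic_pt u2 != 0 by rewrite -size_poly_gt0 (leq_trans _ sn).
  have := congr1 (fun p : A => size p) e1; rewrite size_polyN size_mul //.
  have := a0 i; rewrite -size_poly_gt0; move: sn (C1i i).
  by move: (size (a i)) (size (b i)) (size (c i)) (size _) => x1 x2 x3 x4; clear; lia.
rewrite z1 mul1r in e1; rewrite z1 mul1r in biE.
have gE : monic_pt u1 - monic_pt u2 = polyn u1 - polyn u2 by rewrite /monic_pt; ring.
rewrite gE in e1; apply/eqP; rewrite /V_ /= -subr_eq0 -{2}(comp_polyXr f) e.
rewrite (bigD1 i) //= biE.
have -> : (a i)%:P * ('X + (polyn u1 - polyn u2)%:P) + (- a i)%:P * 'X + (c i)%:P =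
    (a i * (polyn u1 - polyn u2) + c i)%:P.
  by rewrite !(polyCD, polyCM, polyCN); ring.
by rewrite e1 addNr mul0r.
Qed.

(** V_f is finite, so for [n] large its elements have degree below [n] and the whole coset of V_f
    through one solution stays in M_n. The values on it are equal, which makes the multiplicity
    exactly |V_f|. *)
Lemma sum_vp_big : exists C1 n3, forall n, (n3 <= n)%N -> forall P, mirr P -> (n + C1 < deg P)%N ->
  (#|` vs| * vp P (L_ f n) = \sum_(u : {poly_n F}) vp P f.[monic_pt u])%N.
Proof.
have [C1 hC1] := large_prime_stab; have [n2 hn2] := V_bound; have [n1 hn1] := deg_horner_monic_pt f0 d0.
exists C1, (C1 + n1 + n2)%N => n nn P hP big.
have nC : (C1 <= n)%N by move: nn; clear; lia.
have fn0 (u : {poly_n F}) : f.[monic_pt u] != 0.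
  by have [] := hn1 n _ u; first by move: nn; clear; lia.
have [[u0 Pu0]|none] := pselect (exists u0 : {poly_n F}, P %| f.[monic_pt u0]); last first.
  have z (u : {poly_n F}) : vp P f.[monic_pt u] = 0%N.
    apply/eqP; rewrite -leqn0 leqNgt vp_gt0 //; apply/negP => h; apply: none; by exists u.
  have vL0 : vp P (L_ f n) = 0%N.
    have [//|k0] := posnP (vp P (L_ f n)); have [u] := vp_L_exists fn0 hP k0.
    by rewrite z leqn0 => /eqP.
  by rewrite vL0 muln0 big1.
have same (u : {poly_n F}) : P %| f.[monic_pt u] -> f.[monic_pt u] = f.[monic_pt u0].
  move=> Pu; have := V_horner (monic_pt u0) (hC1 n nC P hP big u u0 Pu Pu0).
  by have -> : monic_pt u0 + (polyn u - polyn u0) = monic_pt u by rewrite /monic_pt; ring.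
have vpL : vp P (L_ f n) = vp P f.[monic_pt u0].
  apply/eqP; rewrite eqn_leq vp_le_L // andbT.
  have k0 : (0 < vp P (L_ f n))%N.
    by apply: leq_trans (vp_le_L fn0 u0 hP); rewrite vp_gt0.
  have [u le] := vp_L_exists fn0 hP k0.
  have Pu : P %| f.[monic_pt u] by rewrite -vp_gt0 // (leq_trans k0).
  by rewrite -(same u Pu).
pose s := [seq npolyp n (polyn u0 + g) | g <- enum_fset vs].
have inV g : g \in enum_fset vs -> V_ f g.
  by move=> gv; apply/asboolP; rewrite -memV.
have npK g : V_ f g -> polyn (npolyp n (polyn u0 + g)) = polyn u0 + g.
  move=> /hn2 sg; rewrite npolypK //; apply: leq_trans (size_polyD _ _) _.
  rewrite geq_max size_npoly (leq_trans sg) //; move: nn; clear; lia.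
have us : uniq s.
  rewrite map_inj_in_uniq ?fset_uniq // => g g' /inV Vg /inV Vg' /(congr1 (@polyn _ _)).
  by rewrite !npK // => /addrI.
have memS (u : {poly_n F}) : (u \in s) = (P %| f.[monic_pt u]).
  apply/mapP/idP => [[g /inV Vg ->]|Pu].
    have -> : monic_pt (npolyp n (polyn u0 + g)) = monic_pt u0 + g by rewrite /monic_pt npK // addrA.
    by rewrite V_horner.
  exists (polyn u - polyn u0).
    have : polyn u - polyn u0 \in vs by rewrite memV; apply/asboolP; apply: hC1 Pu Pu0.
    by [].
  by apply: val_inj => /=; rewrite addrC subrK npolypK // size_npoly.
rewrite vpL (bigID (fun u : {poly_n F} => P %| f.[monic_pt u])) /= [X in (_ + X)%N]big1 ?addn0; last first.
  by move=> u nPu; apply/eqP; rewrite -leqn0 leqNgt vp_gt0.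
rewrite (eq_bigr (fun=> vp P f.[monic_pt u0])) => [|u Pu]; last by rewrite same.
rewrite sum_nat_const; congr (_ * _)%N.
rewrite -(size_map (fun g => npolyp n (polyn u0 + g))) -/s -(card_uniqP us).
by apply: eq_card => u; rewrite memS.
Qed.

(** Both degrees are split at deg P = n + C1, above which [sum_vp_big] matches them; the identity is
    arranged without subtraction. The second clause makes the small-prime part of the lcm O(q^n):
    O(q^n / n) primes, each contributing at most the degree of one value. *)
Lemma lcm_identity : exists C1 n3, forall n, (n3 <= n)%N ->
  [/\ (#|` vs| * deg (L_ f n) + \sum_(P <- irreds F (n + C1)) deg P * \sum_(u : {poly_n F}) vp P f.[monic_pt u] =
    #|` vs| * (\sum_(P <- irreds F (n + C1)) deg P * vp P (L_ f n)) + q ^ n * (deg f * n + deg (lead_coef f)))%N,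
    (\sum_(P <- irreds F (n + C1)) deg P * vp P (L_ f n) <=
      size (irreds F (n + C1)) * (deg f * n + deg (lead_coef f)))%N,
    forall u : {poly_n F}, f.[monic_pt u] != 0 &
    forall u : {poly_n F}, deg f.[monic_pt u] = (deg f * n + deg (lead_coef f))%N].
Proof.
have [C1 [n3 h3]] := sum_vp_big; have [n1 hn1] := deg_horner_monic_pt f0 d0.
exists C1, (n3 + n1)%N => n nn.
have fn (u : {poly_n F}) := hn1 n (leq_trans (leq_addl n3 n1) nn) u.
have fn0 (u : {poly_n F}) : f.[monic_pt u] != 0 by have [] := fn u.
have fd (u : {poly_n F}) : deg f.[monic_pt u] = (deg f * n + deg (lead_coef f))%N by have [] := fn u.
split=> //; last first.
  rewrite -sum1_size big_distrl /= big_seq [leqRHS]big_seq; apply: leq_sum => P.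
  by rewrite mem_irreds mul1n => /andP[hP _]; apply: vp_L_deg.
set y := (n + C1)%N; set E := (deg f * n + deg (lead_coef f))%N in fd *.
(* Any common bound for the degrees of the lcm and the values, and for the cutoff, allows all sums
   to run over one list of primes. *)
pose B := (deg (L_ f n) + E + y)%N.
have yB : (y <= B)%N by rewrite /B leq_addl.
have dL : deg (L_ f n) = (\sum_(P <- irreds F B) deg P * vp P (L_ f n))%N.
  by apply: deg_sum_irreds; [exact: L_neq0 | rewrite /B -addnA leq_addr].
have dE : (q ^ n * E = \sum_(P <- irreds F B) deg P * \sum_(u : {poly_n F}) vp P f.[monic_pt u])%N.
  rewrite -card_npoly -sum_nat_const (eq_bigr (fun u : {poly_n F} =>
      \sum_(P <- irreds F B) deg P * vp P f.[monic_pt u])%N).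
    by rewrite exchange_big /=; apply: eq_bigr => P _; rewrite big_distrr.
  by move=> u _; rewrite -(fd u); apply: deg_sum_irreds; rewrite // fd /B addnAC leq_addl.
have sy (G : A -> nat) : (\sum_(P <- irreds F y) G P = \sum_(P <- irreds F B | deg P <= y) G P)%N.
  exact: (big_irreds_le (V := nat) G predT yB).
rewrite dL dE !sy.
rewrite (bigID (fun P : A => (deg P <= y)%N)) /= [in RHS](bigID (fun P : A => (deg P <= y)%N) predT (fun P => deg P * \sum_u _)%N) /=.
rewrite mulnDr -!addnA; congr (_ + _)%N; rewrite addnC; congr (_ + _)%N.
rewrite big_distrr /= big_seq_cond [RHS]big_seq_cond; apply: eq_bigr => P /andP[].
rewrite mem_irreds -ltnNge => /andP[hP _] big.
by rewrite mulnCA (h3 n (leq_trans (leq_addr n1 n3) nn) P hP big).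
Qed.

End LcmStructure.

(** * Contribution of the small primes to the values *)

Section ValueSums.
Variables (F : finFieldType) (R : realType).
Local Notation A := {poly F}.
Local Notation q := #|F|.

Lemma natr_le_expr (Q : R) k : 2 <= Q -> k%:R <= Q ^+ k.
Proof.
move=> Q2; elim: k => [|k IH]; first by rewrite expr0.
rewrite -natr1 exprS; have : 1 <= Q ^+ k by rewrite exprn_ege1 //; move: Q2; clear; lra.
by move: (Q ^+ k) IH Q2; clear; move=> y; nra.
Qed.

Lemma size_irreds_bound (Q : R) N : Q = q%:R -> N%:R * (size (irreds F N))%:R <= 10 * Q ^+ N.
Proof.
move=> QE; have Q2 : 2 <= Q by rewrite QE ler_nat; exact: card_finNzRing_gt1.
apply: le_trans (size_irreds_small QE N) _.
have h1 : N%:R <= 2 * Q ^+ N./2 + 1.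
  have NE : N%:R = (odd N)%:R + N./2%:R * 2 :> R.
    by rewrite -{1}(odd_double_half N) natrD -muln2 natrM.
  have : (odd N)%:R <= 1 :> R by case: odd.
  have := natr_le_expr N./2 Q2; rewrite NE.
  by move: (Q ^+ N./2) ((odd N)%:R : R) (N./2%:R : R) => y z t; clear; lra.
have h2 : Q ^+ N./2 * Q ^+ N./2 <= Q ^+ N.
  rewrite -exprD; apply: ler_weXn2l; first by move: Q2; clear; lra.
  by have := odd_double_half N; rewrite -addnn; clear; lia.
have h3 : 1 <= Q ^+ N./2 by rewrite exprn_ege1 //; move: Q2; clear; lra.
by move: (Q ^+ N./2) (Q ^+ N) (N%:R) h1 h2 h3 => y z t; clear; nra.
Qed.

Variable f : {poly A}.
Variables (n y E : nat).
Hypothesis fn0 : forall u : {poly_n F}, f.[monic_pt u] != 0.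
Hypothesis fd : forall u : {poly_n F}, deg f.[monic_pt u] = E.
Hypothesis ny : (n <= y)%N.
Variable Q : R.
Hypothesis QE : Q = q%:R.
Local Notation W := (\sum_(P <- irreds F y) deg P * \sum_(u : {poly_n F}) vp P f.[monic_pt u])%N.

Let Q0 : 0 < Q.
Proof. by rewrite QE ltr0n; apply: ltnW; exact: card_finNzRing_gt1. Qed.

Lemma vp_deg_val (P : A) (u : {poly_n F}) : mirr P -> (deg P * vp P f.[monic_pt u] <= E)%N.
Proof.
move=> hP; rewrite -(fd u) -deg_exp.
have : P ^+ vp P f.[monic_pt u] %| f.[monic_pt u] by rewrite dvdp_exp_vp.
by move/(dvdp_leq (fn0 u)); rewrite /deg; move: (size _) (size _) => a b; clear; lia.
Qed.

(** The valuation is at most K unless P^(K+1) divides the value, and then the degree E of the value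
    bounds deg P times the valuation. *)
Lemma sum_vp_le (P : A) K : mirr P ->
  (deg P * \sum_(u : {poly_n F}) vp P f.[monic_pt u] <=
   deg P * (K * #|[pred u : {poly_n F} | (P %| f.[monic_pt u])%R]|) +
   E * #|[pred u : {poly_n F} | (P ^+ K.+1 %| f.[monic_pt u])%R]|)%N.
Proof.
move=> hP; rewrite -!sum1_card !big_distrr /= !(big_mkcond (fun u : {poly_n F} => _ \in _)) /=.
rewrite -big_split /=; apply: leq_sum => u _; rewrite !inE dvdp_exp_vp // -vp_gt0 //.
have := vp_deg_val u hP; case: (posnP (vp P f.[monic_pt u])) => [->|k0]; first by rewrite muln0.
case: ltnP => lt le; rewrite ?muln1 ?muln0 ?addn0.
  by apply: leq_trans le _; rewrite leq_addl.
by rewrite leq_mul2l lt orbT.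
Qed.

Lemma sum_values_lower (M : A) : Q ^+ n * mertens_sum R f M n <= W%:R.
Proof.
rewrite /mertens_sum -QE mulr_sumr natr_sum (big_irreds_le _ _ ny) big_mkcond /=.
rewrite big_seq [leRHS]big_seq; apply: ler_sum => P; rewrite mem_irreds => /andP[hP _].
case: ifP => [/andP[_ le]|_] //.
have /(congr1 (fun k => k%:R : R)) := card_root_exact f hP le.
rewrite !natrM !natrX -QE => cE.
have -> : Q ^+ n * ((deg P)%:R * (nroots f P)%:R / Q ^+ deg P) =
    (deg P)%:R * #|[pred u : {poly_n F} | P %| f.[monic_pt u]]|%:R.
  have Qd : Q ^+ deg P != 0 by rewrite expf_neq0 // gt_eqF.
  apply: (mulIf Qd); rewrite -[RHS]mulrA cE mulrA divfK //; ring.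
apply: ler_wpM2l => //; rewrite ler_nat.
rewrite -sum1_card big_mkcond /=; apply: leq_sum => u _; rewrite inE.
by case: ifP => // Pu; rewrite vp_gt0.
Qed.

Variables (M : A) (d D0 J sM : nat) (KM : R).
Hypothesis hgood : forall P, mirr P -> ~~ (P %| M) -> [/\ (D0 <= deg P)%N, (nroots f P <= d)%N &
  (#|[pred u : {poly_n F} | (P ^+ 2 %| f.[monic_pt u])%R]| <= d * q ^ (n - 2 * deg P))%N].
Hypothesis hbad : exists K : A -> nat,
  (forall P, mirr P -> P %| M ->
    (#|[pred u : {poly_n F} | (P ^+ (K P).+1 %| f.[monic_pt u])%R]| <= d * q ^ (n - J * deg P))%N) /\
  \sum_(P <- irreds F y | P %| M) (deg P * K P)%:R <= KM.
Hypothesis hsM : (count (fun P : A => (P %| M)%R) (irreds F y) <= sM)%N.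
Hypothesis hJ : (J <= n)%N.

(** The 1 pays for truncated subtraction when [a] exceeds [n]. *)
Lemma expr_trunc a : (q ^ (n - a))%:R <= Q ^+ n * Q ^- a + 1.
Proof.
have [le|lt] := leqP a n.
  rewrite natrX -QE -{2}(subnK le) exprD mulfK ?lerDl // expf_neq0 // gt_eqF //.
rewrite (eqP (_ : n - a == 0)%N) ?subn_eq0 ?(ltnW lt) // expn0 lerDr.
by rewrite mulr_ge0 // ?invr_ge0 exprn_ge0 // ltW.
Qed.

(** After the main term come, in order: primes outside M of degree between n and y; values divisible
    by P^2 for P outside M; primes dividing M counted up to the multiplicity K P; and values in
    which such primes exceed it. *)
Lemma sum_values_upper :
  W%:R <= Q ^+ n * mertens_sum R f M n + d%:R * (2 * Q ^+ y)
    + E%:R * (d%:R * (Q ^+ n * (2 * Q ^- D0) + (size (irreds F y))%:R))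
    + Q ^+ n * KM + E%:R * (d%:R * (sM%:R * (Q ^+ n * Q ^- J))).
Proof.
have Qn0 : 0 <= Q ^+ n by rewrite exprn_ge0 // ltW.
rewrite natr_sum (bigID (fun P => P %| M)) /= addrC -addrA; apply: lerD; last first.
  have [K [hK sK]] := hbad.
  apply: le_trans (_ : \sum_(P <- irreds F y | P %| M) (Q ^+ n * (deg P * K P)%:R +
      E%:R * (d%:R * (Q ^+ n * Q ^- J))) <= _).
    rewrite big_seq_cond [leRHS]big_seq_cond; apply: ler_sum => P /andP[].
    rewrite mem_irreds => /andP[hP _] PM.
    apply: le_trans (_ : (deg P * (K P * q ^ n) + E * (d * q ^ (n - J)))%:R <= _).
      rewrite ler_nat; apply: leq_trans (sum_vp_le (K P) hP) _; apply: leq_add.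
        rewrite leq_mul2l; apply/orP; right; rewrite leq_mul2l; apply/orP; right.
        by rewrite -card_npoly; apply: max_card.
      rewrite leq_mul2l; apply/orP; right; apply: leq_trans (hK P hP PM) _.
      rewrite leq_mul2l; apply/orP; right.
      rewrite leq_exp2l ?card_finNzRing_gt1 //; apply: leq_sub2l.
      by rewrite leq_pmulr // mirr_deg.
    rewrite natrD mulnA natrM natrX -QE mulrC lerD // !natrM natrX -QE.
    apply: ler_wpM2l => //; apply: ler_wpM2l => //.
    by rewrite -{2}(subnK hJ) exprD mulfK // expf_neq0 // gt_eqF.
  rewrite big_split /= -mulr_sumr; apply: lerD; first exact: ler_wpM2l.
  rewrite big_const_seq iter_addr addr0 -[_ *+ _]mulr_natr -!mulrA.
  apply: ler_wpM2l => //; apply: ler_wpM2l => //.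
  rewrite mulrA mulrC; apply: ler_wpM2r; last by rewrite ler_nat.
  by rewrite mulr_ge0 // invr_ge0 exprn_ge0 // ltW.
apply: le_trans (_ : \sum_(P <- irreds F y | ~~ (P %| M))
   ((deg P * #|[pred u : {poly_n F} | (P %| f.[monic_pt u])%R]|)%:R +
    E%:R * (d%:R * (Q ^+ n * Q ^- (2 * deg P) + 1))) <= _).
  rewrite big_seq_cond [leRHS]big_seq_cond; apply: ler_sum => P /andP[].
  rewrite mem_irreds => /andP[hP _] nP; have [_ _ h2] := hgood hP nP.
  apply: le_trans (_ : (deg P * #|[pred u : {poly_n F} | (P %| f.[monic_pt u])%R]| + E * (d * q ^ (n - 2 * deg P)))%:R <= _).
    rewrite ler_nat; apply: leq_trans (sum_vp_le 1 hP) _; rewrite mul1n leq_add2l.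
    by rewrite leq_mul2l h2 orbT.
  rewrite natrD lerD // !natrM; apply: ler_wpM2l => //; apply: ler_wpM2l => //.
  exact: expr_trunc.
rewrite big_split /=; apply: lerD.
  rewrite (bigID (fun P : A => (deg P <= n)%N)) /=; apply: lerD.
    rewrite /mertens_sum -QE mulr_sumr (big_irreds_le _ _ ny).
    rewrite big_seq_cond [leRHS]big_seq_cond; apply: ler_sum => P /and3P[].
    rewrite mem_irreds => /andP[hP _] _ le.
    have /(congr1 (fun k => k%:R : R)) := card_root_exact f hP le.
    rewrite !natrM !natrX -QE => cE.
    have Qd : Q ^+ deg P != 0 by rewrite expf_neq0 // gt_eqF.
    have -> : Q ^+ n * ((deg P)%:R * (nroots f P)%:R / Q ^+ deg P) =
        (deg P)%:R * #|[pred u : {poly_n F} | P %| f.[monic_pt u]]|%:R.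
      by apply: (mulIf Qd); rewrite -[RHS]mulrA cE mulrA divfK //; ring.
    by [].
  apply: le_trans (_ : \sum_(P <- irreds F y) d%:R * (deg P)%:R <= _); last first.
    by rewrite -mulr_sumr; apply: ler_wpM2l => //; exact: (sum_irreds_deg_le QE).
  rewrite big_mkcond /= big_seq [leRHS]big_seq; apply: ler_sum => P.
  rewrite mem_irreds => /andP[hP _]; case: ifP => [/andP[nP]|_]; last by rewrite mulr_ge0.
  rewrite -ltnNge => lt; have [_ hr _] := hgood hP nP.
  rewrite -natrM ler_nat mulnC leq_mul2r; apply/orP; right.
  exact: leq_trans (card_root_le f hP lt) hr.
rewrite -!mulr_sumr; apply: ler_wpM2l => //; apply: ler_wpM2l => //.
rewrite big_split /=; apply: lerD; last first.
  rewrite big_const_seq iter_addr addr0 ler_nat; exact: count_size.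
rewrite -mulr_sumr; apply: ler_wpM2l => //.
apply: le_trans (sum_irreds_tail QE y D0).
rewrite big_mkcond [leRHS]big_mkcond /= big_seq [leRHS]big_seq; apply: ler_sum => P.
rewrite mem_irreds => /andP[hP _]; case: ifP => [nP|_].
  by have [-> _ _] := hgood hP nP.
by case: ifP => // _; rewrite invr_ge0 exprn_ge0 // ltW.
Qed.

End ValueSums.

Lemma archi_natr (R : realType) (x eps : R) : 0 < eps ->
  exists k, forall n, (k <= n)%N -> x <= eps * n%:R.
Proof.
move=> e0; exists (Num.bound (x / eps)) => n kn.
rewrite mulrC -ler_pdivrMr //.
apply: le_trans (ltW (le_lt_trans (ler_norm _) (archi_boundP (normr_ge0 _)))) _.
by rewrite ler_nat; apply: leq_trans kn; rewrite /Num.bound normr_id.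
Qed.

(** * Asymptotics of the value sum and of the lcm *)

Section ValueAsymptotics.
Variables (F : finFieldType) (R : realType) (f : {poly {poly F}}).
Local Notation A := {poly F}.
Local Notation q := #|F|.
Hypotheses (fi : irreducible_elt f) (fs : special f) (d2 : (2 <= deg f)%N).

Lemma exists_good_modulus (eps : R) D0 : 0 < eps ->
  exists2 M : A, M != 0 &
  (exists n0, forall n, (n0 <= n)%N -> `|mertens_sum R f M n - n%:R| <= eps * n%:R) /\
  forall n P, mirr P -> ~~ (P %| M) -> [/\ (D0 <= deg P)%N, (nroots f P <= deg f)%N &
  (#|[pred u : {poly_n F} | (P ^+ 2 %| f.[monic_pt u])%R]| <= deg f * q ^ (n - 2 * deg P))%N].
Proof.
move=> e0; have [M0 M00 hM0] := special_mertens fi fs d2 e0.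
have [b b0 hb] := special_sqr fi fs d2.
have [W W0 hW] := small_primes_multiple F D0.
exists (M0 * b * W); first by rewrite !mulf_neq0.
split; first by apply: hM0; [rewrite !mulf_neq0 | rewrite -mulrA dvdp_mulIl].
move=> n P hP nP.
have nW : ~~ (P %| W) by apply: contra nP => h; apply: dvdp_mull.
have nb : ~~ (P %| b) by apply: contra nP => h; apply: dvdp_mulr; apply: dvdp_mull.
have [hr [ys [sys hys]]] := hb P hP nb.
split=> //; first exact: hW.
apply: leq_trans (@card_monic_pt_cover F n _ ys (P ^+ 2) _ _) _.
- by rewrite expf_neq0 // mirr_neq0.
- by move=> u; rewrite /= => /hys.
by rewrite deg_exp [(deg P * 2)%N]mulnC leq_mul2r sys orbT.
Qed.

Lemma exists_deep_exponent J : exists K : A -> nat, forall n P, mirr P ->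
  (#|[pred u : {poly_n F} | (P ^+ (K P).+1 %| f.[monic_pt u])%R]| <= deg f * q ^ (n - J * deg P))%N.
Proof.
have f0 : f != 0 by case: fi.
have h P : exists K, mirr P -> forall n,
    (#|[pred u : {poly_n F} | (P ^+ K.+1 %| f.[monic_pt u])%R]| <= deg f * q ^ (n - J * deg P))%N.
  have [hP|nP] := pselect (mirr P); last by exists 0%N.
  have [K hK] := special_deep J f0 (ltnW d2) fs hP.
  exists K => _ n; apply: leq_trans (hK n); apply: subset_leq_card.
  apply/fintype.subsetP => u; rewrite !inE; apply: dvdp_trans.
  by rewrite exprS dvdp_mulIr.
have [K hK] := choice h; exists K => n P hP; exact: hK.
Qed.

Lemma sum_irreds_dvdp (V : nmodType) (M : A) N (G : A -> V) : M != 0 -> (deg M <= N)%N ->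
  \sum_(P <- irreds F N | P %| M) G P = \sum_(P <- irreds F (deg M) | P %| M) G P.
Proof.
move=> M0 MN; rewrite (big_irreds_le _ _ MN); apply: eq_bigl => P.
apply/idP/andP => [PM|[]//]; split=> //.
by have := dvdp_leq M0 PM; rewrite /deg; move: (size _) (size _) => a b; clear; lia.
Qed.

End ValueAsymptotics.

(** The two errors that carry the degree of the values are of order n q^n, with factors q^(-D0) and
    q^(-J); the others are O(q^n). Hence the order of choices: D0 from eps, then M, then J and the
    multiplicities K from M, and [n] last. *)
Lemma values_sum_asymp (F : finFieldType) (R : realType) (f : {poly {poly F}}) (C1 : nat)
    (eps : R) (Q := #|F|%:R : R) :
  irreducible_elt f -> special f -> (2 <= deg f)%N -> 0 < eps ->
  exists n0, forall n, (n0 <= n)%N ->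
    (forall u : {poly_n F}, f.[monic_pt u] != 0) ->
    (forall u : {poly_n F}, deg f.[monic_pt u] = (deg f * n + deg (lead_coef f))%N) ->
  `|(\sum_(P <- irreds F (n + C1)) deg P * \sum_(u : {poly_n F}) vp P f.[monic_pt u])%N%:R
    - n%:R * Q ^+ n| <= eps * (n%:R * Q ^+ n).
Proof.
move=> fi fs d2 e0; set d := deg f; set l := deg (lead_coef f).
have e4 : 0 < eps / 4 by rewrite divr_gt0.
have Q2 : 2 <= Q by rewrite ler_nat; exact: card_finNzRing_gt1.
have Q0 : 0 < Q by apply: lt_le_trans Q2.
have [D0 hD0] := archi_expr ((d.+1 * d * 2)%:R / (eps / 4)) Q2.
have [M M0 [[n1 hn1] hgood]] := exists_good_modulus fi fs d2 D0 e4.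
pose sM := size (irreds F (deg M)).
(* J has to beat the number [sM] of primes up to degree deg M, among which are all those dividing M,
   so it comes after M. *)
have [J hJ] := archi_expr ((d.+1 * d * sM)%:R / (eps / 4)) Q2.
have [K hK] := exists_deep_exponent fi fs d2 J.
pose KM : R := \sum_(P <- irreds F (deg M) | P %| M) (deg P * K P)%:R.
have [n2 hn2] := archi_natr ((d * 2)%:R * Q ^+ C1 + (d.+1 * d * 10)%:R * Q ^+ C1 + KM) e4.
exists (n1 + n2 + deg M + J + l)%N => n nn fn0 fd.
have nn1 : (n1 <= n)%N by move: nn; clear; lia.
have nn2 : (n2 <= n)%N by move: nn; clear; lia.
have nM : (deg M <= n + C1)%N by move: nn; clear; lia.
have nJ : (J <= n)%N by move: nn; clear; lia.
have nl : (l <= n)%N by move: nn; clear; lia.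
have ny : (n <= n + C1)%N by rewrite leq_addr.
have lower := sum_values_lower fn0 ny (erefl Q) M.
have upper := @sum_values_upper F R f n (n + C1) (d * n + l) fn0 fd ny Q (erefl Q)
  M d D0 J sM KM (hgood n).
have {upper} := upper (ex_intro _ K (conj (fun P hP _ => hK n P hP) _)) _ nJ.
rewrite (sum_irreds_dvdp _ M0 nM) => /(_ (lexx _)).
have -> : (count (fun P : {poly F} => (P %| M)%R) (irreds F (n + C1)) <= sM)%N.
  by rewrite -sum1_count (sum_irreds_dvdp _ M0 nM) sum1_count count_size.
move=> /(_ isT); move: lower (hn1 n nn1) (hn2 n nn2).
set W := (\sum_(P <- irreds F (n + C1)) _)%N; set S0 := mertens_sum _ _ _ _.
have Qn0 : 0 < Q ^+ n by rewrite exprn_gt0.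
have QI k : 0 <= Q ^- k by rewrite invr_ge0 ltW // exprn_gt0.
have hD : (d.+1 * d)%:R * (2 * Q ^- D0) <= eps / 4.
  rewrite mulrA -natrM ler_pdivrMr ?exprn_gt0 // [leRHS]mulrC -ler_pdivrMr //.
  exact: hD0.
have hJ' : (d.+1 * d)%:R * (sM%:R * Q ^- J) <= eps / 4.
  rewrite mulrA -natrM ler_pdivrMr ?exprn_gt0 // [leRHS]mulrC -ler_pdivrMr //.
  exact: hJ.
have hE : (d * n + l)%:R <= d.+1%:R * n%:R :> R.
  by rewrite -natrM ler_nat mulSn addnC leq_add2r.
have hs : n%:R * (size (irreds F (n + C1)))%:R <= 10 * Q ^+ C1 * Q ^+ n.
  rewrite -mulrA -exprD [(C1 + n)%N]addnC; apply: le_trans (size_irreds_bound _ (erefl Q)).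
  by apply: ler_wpM2r; rewrite // ler_nat.
have i1 : (d * n + l)%:R * (d%:R * (Q ^+ n * (2 * Q ^- D0) + (size (irreds F (n + C1)))%:R)) <=
    eps / 4 * (n%:R * Q ^+ n) + (d.+1 * d * 10)%:R * Q ^+ C1 * Q ^+ n.
  apply: le_trans (_ : d.+1%:R * n%:R * (d%:R * (Q ^+ n * (2 * Q ^- D0) + (size (irreds F (n + C1)))%:R)) <= _).
    by apply: ler_wpM2r => //; apply: mulr_ge0 => //; rewrite addr_ge0 // !mulr_ge0 // ltW.
  have -> : d.+1%:R * n%:R * (d%:R * (Q ^+ n * (2 * Q ^- D0) + (size (irreds F (n + C1)))%:R)) =
    (d.+1 * d)%:R * (2 * Q ^- D0) * (n%:R * Q ^+ n) +
    (d.+1 * d)%:R * (n%:R * (size (irreds F (n + C1)))%:R).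
    by rewrite natrM; ring.
  apply: lerD; first by apply: ler_wpM2r => //; rewrite mulr_ge0 // ltW.
  by rewrite [(d.+1 * d * 10)%:R]natrM -[_ * 10 * _]mulrA -[leRHS]mulrA; apply: ler_wpM2l.
have i2 : (d * n + l)%:R * (d%:R * (sM%:R * (Q ^+ n * Q ^- J))) <= eps / 4 * (n%:R * Q ^+ n).
  apply: le_trans (_ : d.+1%:R * n%:R * (d%:R * (sM%:R * (Q ^+ n * Q ^- J))) <= _).
    by apply: ler_wpM2r => //; rewrite !mulr_ge0 // ltW.
  have -> : d.+1%:R * n%:R * (d%:R * (sM%:R * (Q ^+ n * Q ^- J))) =
     (d.+1 * d)%:R * (sM%:R * Q ^- J) * (n%:R * Q ^+ n) by rewrite natrM; ring.
  by apply: ler_wpM2r => //; rewrite mulr_ge0 // ltW.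
have i3 : d%:R * (2 * Q ^+ (n + C1)) = (d * 2)%:R * Q ^+ C1 * Q ^+ n.
  by rewrite natrM exprD; ring.
rewrite i3 => lower; rewrite ler_distl => /andP[a1 a2] b1 upper.
have j1 := ler_wpM2r (ltW Qn0) a1; have j2 := ler_wpM2r (ltW Qn0) a2.
have j3 := ler_wpM2r (ltW Qn0) b1.
rewrite ler_distl; apply/andP; split.
  apply: le_trans lower; rewrite [leRHS]mulrC; apply: le_trans j1.
  have : 0 <= eps * (n%:R * Q ^+ n) by rewrite !mulr_ge0 // ltW.
  have -> : (n%:R - eps / 4 * n%:R) * Q ^+ n = n%:R * Q ^+ n - eps / 4 * (n%:R * Q ^+ n) by ring.
  by move: (n%:R * Q ^+ n) (eps) => z e; clear; lra.
have {}j2 : Q ^+ n * S0 <= n%:R * Q ^+ n + eps / 4 * (n%:R * Q ^+ n).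
  by rewrite mulrC; apply: le_trans j2 _; rewrite mulrDl -[eps / 4 * _ * _]mulrA.
have {}j3 : (d * 2)%:R * Q ^+ C1 * Q ^+ n + (d.+1 * d * 10)%:R * Q ^+ C1 * Q ^+ n +
    Q ^+ n * KM <= eps / 4 * (n%:R * Q ^+ n).
  by move: j3; rewrite !mulrDl [KM * _]mulrC -[eps / 4 * _ * _]mulrA.
move: i1 i2 upper j2 j3.
move: (_ * (_ * (_ + (size _)%:R))) (_ * (_ * (sM%:R * _))) (n%:R * Q ^+ n) => z1 z2 z3.
move: ((d * 2)%:R * _ * _) ((d.+1 * d * 10)%:R * _ * _) (Q ^+ n * S0) (Q ^+ n * KM) (W%:R) (eps).
by clear=> *; lra.
Qed.

Lemma lcm_degree_asymp (R : realType) (F : finFieldType) (f : {poly {poly F}}) (eps : R) :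
  irreducible_elt f -> special f -> (2 <= deg f)%N -> 0 < eps ->
  exists n0, forall n, (n0 <= n)%N ->
  `|#|` fset_set (V_ f)|%fset%:R * (deg (L_ f n))%:R - (deg f - 1)%:R * (n%:R * #|F|%:R ^+ n)|
    <= eps * (n%:R * #|F|%:R ^+ n).
Proof.
move=> fi fs d2 e0; have f0 : f != 0 by case: fi.
have [C1 [n3 h3]] := lcm_identity f0 (ltnW d2) fs.
have e2 : 0 < eps / 2 by rewrite divr_gt0.
have [n1 h1] := values_sum_asymp C1 fi fs d2 e2.
pose Q : R := #|F|%:R; pose v := #|` fset_set (V_ f)|%fset.
pose d := deg f; pose l := deg (lead_coef f).
have [n2 h2] := archi_natr ((v * d.+1)%:R * (10 * Q ^+ C1) + l%:R) e2.
exists (n1 + n2 + n3 + l)%N => n nn.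
have /h3[] : (n3 <= n)%N by move: nn; clear; lia.
rewrite -/v -/d -/l => idt hZ fn0 fd.
have /h1/(_ fn0 fd) : (n1 <= n)%N by move: nn; clear; lia.
have /h2 : (n2 <= n)%N by move: nn; clear; lia.
have nl : (l <= n)%N by move: nn; clear; lia.
have Qn0 : 0 < Q ^+ n by rewrite exprn_gt0 // ltr0n; apply: ltnW; exact: card_finNzRing_gt1.
move: idt hZ; rewrite -/Q.
set W := (\sum_(P <- irreds F (n + C1)) deg P * \sum_(u : {poly_n F}) vp P f.[monic_pt u])%N.
set Z := (\sum_(P <- irreds F (n + C1)) _)%N; set L := deg (L_ f n).
move=> /(congr1 (fun k => k%:R : R)).
rewrite !natrD !natrM natrD natrX -/Q natrM => idt hZ hn2.
have {}hZ : Z%:R <= d.+1%:R * (10 * Q ^+ C1) * Q ^+ n.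
  apply: le_trans (_ : (size (irreds F (n + C1)) * (d.+1 * n))%:R <= _).
    rewrite ler_nat; apply: leq_trans hZ _; rewrite leq_mul2l; apply/orP; right.
    by rewrite mulSn addnC leq_add2r.
  rewrite mulnC -mulnA natrM -mulrA; apply: ler_wpM2l => //.
  rewrite -mulrA -exprD [(C1 + n)%N]addnC natrM.
  apply: le_trans (size_irreds_bound _ (erefl Q)).
  by apply: ler_wpM2r; rewrite // ler_nat leq_addr.
have k1 := ler_wpM2l (ler0n R v) hZ; have k2 := ler_wpM2r (ltW Qn0) hn2.
have dE : (d - 1)%:R = d%:R - 1 :> R by rewrite natrB // ltnW.
(* Of the total degree d n q^n, one n q^n is cancelled by W; the terms in Z and l are O(q^n). *)
have LE : v%:R * L%:R - (d - 1)%:R * (n%:R * Q ^+ n) =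
    v%:R * Z%:R + l%:R * Q ^+ n - (W%:R - n%:R * Q ^+ n).
  rewrite dE; have -> : v%:R * L%:R = v%:R * Z%:R + Q ^+ n * (d%:R * n%:R + l%:R) - W%:R.
    by rewrite -idt addrK.
  ring.
rewrite LE => hW; apply: le_trans (ler_normB _ _) _.
rewrite ger0_norm; last by rewrite addr_ge0 // mulr_ge0 // ltW.
have k3 : v%:R * Z%:R + l%:R * Q ^+ n <= eps / 2 * (n%:R * Q ^+ n).
  rewrite [leRHS]mulrA; apply: le_trans k2; rewrite mulrDl lerD2r.
  by apply: le_trans k1 _; rewrite !mulrA.
by apply: le_trans (lerD k3 hW) _; rewrite -mulrDl -splitr.
Qed.

Import numFieldNormedType.Exports.
Local Open Scope classical_set_scope.
Local Open Scope ring_scope.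

Theorem theorem1p8 (R : realType) (F : finFieldType) (f : {poly {poly F}})
    (hirr : irreducible_elt f) (hspec : special f) (hdeg : (2 <= deg f)%N) :
  (deg (L_ f n))%:R / (c_ R f * (deg f - 1)%:R * n%:R * #|F|%:R ^+ n)
    @[n --> \oo] --> (1 : R).
Proof.
apply/cvgrPdist_le => eps e0.
have [n0 h0] := lcm_degree_asymp hirr hspec hdeg e0.
(* The successor keeps [n] positive, so the denominator does not vanish. *)
exists n0.+1 => // n /= nn; have := h0 n (ltnW nn); rewrite /c_.
set v := (#|` _|)%:R; set L := (deg (L_ f n))%:R; set t := n%:R * _.
have v0 : 0 < v by rewrite ltr0n; apply: cardV_gt0; exact: ltnW.
have t0 : 0 < t.
  rewrite mulr_gt0 ?ltr0n //; first exact: leq_trans nn.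
  by rewrite exprn_gt0 // ltr0n; apply: ltnW; exact: card_finNzRing_gt1.
have d1 : 1 <= (deg f - 1)%:R :> R by rewrite ler1n subn_gt0.
have d0 : 0 < (deg f - 1)%:R :> R by apply: lt_le_trans d1.
move=> hb; rewrite -[v^-1 * _ * _ * _]mulrA -/t.
have -> : 1 - L / (v^-1 * (deg f - 1)%:R * t) =
    - (v * L - (deg f - 1)%:R * t) / ((deg f - 1)%:R * t).
  by field; rewrite !gt_eqF.
rewrite normrM normrN normfV (gtr0_norm (mulr_gt0 d0 t0)).
rewrite (ler_pdivrMr _ _ (mulr_gt0 d0 t0)).
apply: le_trans hb _.
apply: ler_wpM2l; first exact: ltW.
by rewrite ler_peMl // ltW.
Qed.
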